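(* Let $f:\mathbb{N}\to\mathbb{R}$ be an additive function, and suppose there are a set of primes $\mathcal{P}$ and a constant $c\in[1,2]$ such that \[ |f(p)|\ll\frac{1}{(\log p)^c}\quad(p\in\mathcal{P}),\qquad \sum_{p\text{ prime},\,p\notin\mathcal{P}}\frac1p\ll1. \] For $t\ge2$ set \[ g(t)=\frac{\sup\{|f(p)|(\log p)^c:\ p\ge t,\ p\in\mathcal{P}\}}{(\log t)^c}, \] and assume there is some $A\ge1$ such that \[ |f(p_2)-f(p_1)|\gg\min\left\{\frac{g(p_2)(p_2-p_1)}{p_2\log p_2},\ g\left(p_2^A\right)\right\}\qquad(p_1,p_2\in\mathcal{P},\ p_1<p_2). \] For $0<\epsilon\le 1/2$ let $K(\epsilon)=\min\{n\in\mathbb{N}: n\ge3,\ g(n)\le\epsilon\}$. Then for $0<\epsilon\le1/2$ and $y\ge K(\epsilon)^{1/A}$, \[ \frac{1}{\log K(\epsilon)}\ll Q_{\mathcal{F}_y}(\epsilon)\ll_A\frac{\min\{1/(c-1),\log(1/\epsilon)\}}{\log K(\epsilon)}, \] where $1/(c-1)=+\infty$ when $c=1$, and where, besides $A$, the implied constants depend only on the implied constants in the hypotheses.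
   Context: A function $f:\mathbb{N}\to\mathbb{R}$ is additive if $f(mn)=f(m)+f(n)$ whenever $\gcd(m,n)=1$. For $y\ge1$ define the distribution function \[ \mathcal{F}_y(u)=\prod_{p\le y}\left(1-\frac1p\right)\sum_{\substack{n\ge1:\ p\mid n\Rightarrow p\le y\\ f(n)\le u}}\frac1n\qquad(u\in\mathbb{R}), \] where $p$ runs over primes. For a distribution function $G$, its concentration function is $Q_G(\epsilon)=\sup_{u\in\mathbb{R}}\{G(u+\epsilon)-G(u)\}$. The notation $X\ll Y$ means $|X|\le CY$ for some constant $C$. *)

(* Defs.v *)
From HB Require Import structures.
From mathcomp Require Import all_boot all_order all_algebra.
From mathcomp Require Import all_classical all_reals all_analysis.

Set Implicit Arguments.
Unset Strict Implicit.
Unset Printing Implicit Defensive.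

Import Order.TTheory GRing.Theory Num.Theory.

Local Open Scope classical_set_scope.
Local Open Scope ring_scope.

(* The arithmetic domain is the positive integers: the value f 0 is never used. *)
Definition additive_fun (R : realType) (f : nat -> R) : Prop :=
  forall m n : nat, (0 < m)%N -> (0 < n)%N -> coprime m n ->
    f (m * n)%N = f m + f n.

Definition friable (R : realType) (y : R) (n : nat) : Prop :=
  (0 < n)%N /\ forall p : nat, prime p -> (p %| n)%N -> p%:R <= y.

(* The sum over friable n is finite (it is at most the inverse of the Euler
   product in front of it), so [fine] loses nothing. *)
Definition distr_fun (R : realType) (f : nat -> R) (y : R) (u : R) : R :=
  (\prod_(0 <= p < (Num.truncn y).+1 | prime p) (1 - p%:R^-1)) *
  fine (\esum_(n in [set n : nat | friable y n /\ f n <= u]) (n%:R^-1)%:E).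

Definition concentration (R : realType) (G : R -> R) (eps : R) : R :=
  sup [set G (u + eps) - G u | u in [set: R]].

(* [sup] is 0 on empty or unbounded sets; neither occurs when f p (log p)^c is
   bounded on P and the sum of 1/p over the primes outside P converges (P is
   then infinite). *)
Definition gsup (R : realType) (f : nat -> R) (P : set nat) (c t : R) : R :=
  sup [set `|f p| * ln p%:R `^ c | p in [set p : nat | P p /\ t <= p%:R]]
  / ln t `^ c.

(* The default value 0 is not reached when f p (log p)^c is bounded on P, as
   g then tends to 0. *)
Definition Kmin (R : realType) (f : nat -> R) (P : set nat) (c eps : R) : nat :=
  if pselect (exists n : nat, (3 <= n)%N && (gsup f P c n%:R <= eps)) is left ex
  then ex_minn ex else 0%N.

(* Main.v *)
Require Import Defs.
From HB Require Import structures.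
From mathcomp Require Import all_boot all_order all_algebra.
From mathcomp Require Import all_classical all_reals all_analysis.
From mathcomp Require Import zify ring lra.

Set Implicit Arguments.
Unset Strict Implicit.
Unset Printing Implicit Defensive.

Import Order.TTheory GRing.Theory Num.Theory.

Local Open Scope classical_set_scope.
Local Open Scope ring_scope.

(* The lower bound comes from the integers n all of whose prime factors lie in
   P and exceed K = K(eps): they have density about 1 / log K among the friable
   integers, and |f n| << eps on average over them.

   For the upper bound, the prime factors beyond a fixed power of K, and the part
   of n that is not a squarefree product of primes of P, can be frozen: only
   squarefree products of primes of P up to that power of K remain.  Write such an
   integer as a p m with p the least of its prime factors beyond some level.
   Given m, the value f p must lie in a window of length eps shifted by f a.  By
   the spacing condition the corresponding primes near x lie in few short
   intervals, so by a Brun-Titchmarsh inequality, obtained from Selberg's sieve,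
   their reciprocals sum to << eps / g x, up to an error that is negligible once
   p exceeds a power of log K.  Summing over the scales log p ~ 2^k with m free of
   primes below p produces the factor min {1/(c-1), log (1/eps)}.  The remaining
   short part a only has to satisfy f a in a window of length << g p, and an
   iteration of the same argument, from level i to level about log i, shows that
   this costs nothing on average.  The scales are p in [2^2^k, 2^2^(k+1)). *)

(** * Selberg's sieve *)

(** The primes of [P] between levels [k] and [J] have mass O(2^(J-k)), while a window of length at
    most g (dexp J) catches at level [k] reciprocals of total O(2^(-c(J-k))), up to a sieve error.
    The product is a term of a geometric series of ratio 2^(1-c), whose sum is O(1/(c-1)) and at
    most J; and J is O(log (1/eps)) because g (dexp J) is O(2^-J). The second term of the spacing
    condition shifts the levels by [a], where A <= 2^a. Two obstacles shape the proof. The sieve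
    error 1 / dexp (k-1) must beat a mass of size 2^J, which it does only from a level [i] of about
    log2 J on. And for the part of the integer below level [i], only a window of length O(g p) is
    known, where the trivial bound 2^i, of size J, is too large: hence the separate estimate
    [sfsum_small_window], proved first. All bounds are uniform in [f], [P] and [c], so constants are
    quantified before them, and errors are compared with the geometric sum itself and not with J. *)

Section Sieve.
Variable R : realType.
Implicit Types (a b d k l n D : nat).

(** The multiple 0 is counted, hence the quotient rounded up. *)
Lemma count_multiples_up d b : (0 < d)%N ->
  \sum_(0 <= n < b | (d %| n)%N) (1 : R) = ((b + d.-1) %/ d)%N%:R.
Proof.
move=> d0; elim: b => [|b IH].
  by rewrite big_nil add0n divn_small // prednK.
rewrite big_mkcond big_nat_recr //= -big_mkcond /= IH.
have -> : (b.+1 + d.-1 = (b + d.-1).+1)%N by lia.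
rewrite divnS //.
have -> : ((b + d.-1).+1 = b + d)%N by lia.
rewrite dvdn_addl // natrD addrC.
by case: ifP.
Qed.

Lemma count_multiples d a b : (0 < d)%N -> (a <= b)%N ->
  `|\sum_(a <= n < b | (d %| n)%N) (1 : R) - (b%:R - a%:R) / d%:R| <= 1.
Proof.
move=> d0 ab.
have E : \sum_(a <= n < b | (d %| n)%N) (1 : R) =
   ((b + d.-1) %/ d)%N%:R - ((a + d.-1) %/ d)%N%:R.
  rewrite -!count_multiples_up //.
  by rewrite (big_cat_nat (leq0n a) ab) /= [RHS]addrC addKr.
rewrite E.
have H c : c%:R / d%:R <= (((c + d.-1) %/ d)%N%:R : R) <= c%:R / d%:R + 1.
  have dR : (0 : R) < d%:R by rewrite ltr0n.
  have -> : c%:R / d%:R + 1 = (c%:R + d%:R) / d%:R :> R.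
    by field; rewrite gt_eqF.
  rewrite ler_pdivrMr // ler_pdivlMr // -!natrM -natrD !ler_nat.
  have := divn_eq (c + d.-1) d; have := ltn_pmod (c + d.-1) d0.
  by move: ((c + d.-1) %/ d)%N ((c + d.-1) %% d)%N => q r; nia.
have := H a; have := H b.
rewrite mulrBl ler_norml.
move: (_ / _) (_ / _) => u v; lra.
Qed.

(** Induction on [s]: expanding the factor at [p] multiplies the modulus by [p] in one of two sums,
    which is why a modulus [d] coprime to [s] is carried along. The two errors add up with weights
    |al p| and |be p|. *)
Lemma sieve_sum (s : seq nat) (al be : nat -> R) d a b :
  uniq s -> all prime s -> all (coprime d) s -> (0 < d)%N -> (a <= b)%N ->
  `|\sum_(a <= n < b | (d %| n)%N)
       \prod_(p <- s) (al p * (p %| n)%N%:R + be p)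
     - (b%:R - a%:R) / d%:R * \prod_(p <- s) (al p / p%:R + be p)|
  <= \prod_(p <- s) (`|al p| + `|be p|).
Proof.
move=> us ps cs d0 ab; elim: s d us ps cs d0 => [|p s IH] d us ps cs d0.
  rewrite !big_nil mulr1; under eq_bigr do rewrite big_nil.
  exact: count_multiples.
move: us ps cs => /= /andP[pns us] /andP[pp ps] /andP[cp cs].
have p0 := prime_gt0 pp.
have IH1 := IH d us ps cs d0.
have cs2 : all (coprime (d * p)) s.
  apply/allP => q qs; rewrite coprimeMl (allP cs) //=.
  rewrite prime_coprime // dvdn_prime2 // ?(allP ps) //.
  by apply: contraNN pns => /eqP ->.
have dp0 : (0 < d * p)%N by rewrite muln_gt0 d0.
have IH2 := IH (d * p)%N us ps cs2 dp0.
rewrite !big_cons.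
under eq_bigr do rewrite big_cons.
pose F n := \prod_(j <- s) (al j * (j %| n)%N%:R + be j).
have -> : \sum_(a <= n < b | (d %| n)%N) ((al p * (p %| n)%N%:R + be p) * F n) =
   al p * (\sum_(a <= n < b | (d * p %| n)%N) F n) +
   be p * (\sum_(a <= n < b | (d %| n)%N) F n).
  rewrite [X in al p * X]big_mkcond [X in be p * X]big_mkcond.
  rewrite [LHS]big_mkcond !big_distrr -big_split /=.
  apply: eq_bigr => n _; rewrite Gauss_dvd //.
  by case: (d %| n)%N; case: (p %| n)%N; rewrite /= /F /=; ring.
move: IH1 IH2; rewrite -/F.
move: (\sum_(_ <= _ < _ | (d %| _)%N) _) => S1.
move: (\sum_(_ <= _ < _ | _) _) => S2.
move: (\prod_(_ <- _) _) => M.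
move: (\prod_(_ <- _) _) => B IH1 IH2.
have -> : al p * S2 + be p * S1 - (b%:R - a%:R) / d%:R * ((al p / p%:R + be p) * M)
  = al p * (S2 - (b%:R - a%:R) / (d * p)%:R * M) +
    be p * (S1 - (b%:R - a%:R) / d%:R * M).
  rewrite natrM; field.
  by rewrite !pnatr_eq0; lia.
apply: (le_trans (ler_normD _ _)); rewrite !normrM [leRHS]mulrDl.
by apply: lerD; apply: ler_wpM2l.
Qed.

Definition primes_upto D := [seq p <- iota 0 D.+1 | prime p].

Lemma mem_primes_upto D p : (p \in primes_upto D) = prime p && (p <= D)%N.
Proof. by rewrite mem_filter mem_iota add0n ltnS. Qed.

Lemma uniq_primes_upto D : uniq (primes_upto D).
Proof. by rewrite filter_uniq // iota_uniq. Qed.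

Lemma all_primes_upto D : all prime (primes_upto D).
Proof. by apply/allP => p; rewrite mem_primes_upto => /andP[]. Qed.

(** Being equal to one's radical, in a product form that can be compared prime by prime with [sgn]
    and [cfun]. It rules out [k = 0]. *)
Definition sqfree D k := (k == \prod_(p <- primes_upto D | p %| k) p)%N.

(* The Moebius function at squarefree [k <= D]. *)
Definition sgn D k : R := \prod_(p <- primes_upto D) (if (p %| k)%N then -1 else 1).

(* These functions of [n] are orthogonal on average as [k] varies, and equal to
   the Moebius function of [k] at every [n] free of prime factors up to [D] *)
Definition cfun D k n : R :=
  \prod_(p <- primes_upto D) (if (p %| k)%N then p%:R * (p %| n)%N%:R - 1 else 1).

Definition sqfree_sum D : R := \sum_(1 <= k < D.+1 | sqfree D k) k%:R^-1.

(** For squarefree [k], [cfun D k] is the Ramanujan sum of modulus [k]. At a prime dividing exactly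
    one of [k] and [l] the local mean [al p / p + be p] is 1 - 1 = 0, and distinct radicals have
    such a prime; at a prime dividing both it is p - 1. The error of [sieve_sum] costs at most a
    factor p^2 for each of [k], [l] that p divides. *)
Lemma cfun_corr D k l a b : (a <= b)%N -> sqfree D k -> sqfree D l ->
  (0 < k)%N -> (0 < l)%N ->
  `|\sum_(a <= n < b) cfun D k n * cfun D l n| <=
    (if k == l then (b%:R - a%:R) * k%:R else 0) + (k ^ 2 * l ^ 2)%N%:R.
Proof.
move=> ab sk sl k0 l0.
pose al p : R := if (p %| k)%N then if (p %| l)%N then p%:R ^+ 2 - 2 * p%:R else p%:R
          else if (p %| l)%N then p%:R else 0.
pose be p : R := if (p %| k)%N == (p %| l)%N then 1 else -1.
have E n : cfun D k n * cfun D l n =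
   \prod_(p <- primes_upto D) (al p * (p %| n)%N%:R + be p).
  rewrite /cfun -big_split /=; apply: eq_bigr => p _; rewrite /al /be.
  by case: (p %| k)%N; case: (p %| l)%N; case: (p %| n)%N => /=; ring.
under eq_bigr do rewrite E.
have := @sieve_sum (primes_upto D) al be 1 a b (uniq_primes_upto D)
  (all_primes_upto D).
have -> : all (coprime 1) (primes_upto D) by apply/allP => p _; rewrite coprime1n.
move=> /(_ isT isT ab).
rewrite divr1 [X in `|X - _|](eq_bigl xpredT); last by move=> n; rewrite dvd1n.
set S := \sum_(_ <= _ < _) _.
set M := \prod_(_ <- _) _.
set B := \prod_(_ <- _) _.
move=> H.
have pow (m : nat) : sqfree D m -> \prod_(p <- primes_upto D) (if (p %| m)%N then p%:R else 1) = m%:R :> R.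
  by move=> /eqP {2}->; rewrite natr_prod [RHS]big_mkcond.
have HB : B <= (k ^ 2 * l ^ 2)%N%:R.
  rewrite natrM !natrX -(pow _ sk) -(pow _ sl) -!prodrXl -big_split /=.
  rewrite /B !big_seq; apply: ler_prod => p.
  rewrite mem_primes_upto => /andP[pp _].
  rewrite addr_ge0 //=.
  have p2 : (2 : R) <= p%:R by rewrite ler_nat prime_gt1.
  rewrite /al /be; case: (p %| k)%N; case: (p %| l)%N => /=; rewrite ?normrN ?normr1.
  - rewrite ger0_norm; last nra.
    nra.
  - rewrite ger0_norm; last nra.
    nra.
  - rewrite ger0_norm; last nra.
    nra.
  - by rewrite normr0; lra.
have HM : `|(b%:R - a%:R) * M| <= (if k == l then (b%:R - a%:R) * k%:R else 0).
  have ab' : (0 : R) <= b%:R - a%:R by rewrite subr_ge0 ler_nat.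
  case: eqP => [kl|kl].
    rewrite normrM ger0_norm // ler_wpM2l // -(pow _ sk).
    rewrite /M normr_prod !big_seq; apply: ler_prod => p.
    rewrite mem_primes_upto => /andP[pp _].
    rewrite normr_ge0 /=.
    have p2 : (2 : R) <= p%:R by rewrite ler_nat prime_gt1.
    rewrite /al /be -kl; case: (p %| k)%N => /=.
      have -> : (p%:R ^+ 2 - 2 * p%:R) / p%:R + 1 = p%:R - 1 :> R by field; lra.
      by rewrite ger0_norm; lra.
    by rewrite mul0r add0r normr1.
  suff -> : M = 0 by rewrite mulr0 normr0.
  have [p pD pkl] : exists2 p, p \in primes_upto D & (p %| k)%N != (p %| l)%N.
    apply/hasP; rewrite -[has _ _]negbK; apply/negP => /hasPn Hn; apply: kl.
    move: sk sl => /eqP -> /eqP ->.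
    rewrite big_mkcond [RHS]big_mkcond /= !big_seq; apply: eq_bigr => p pD.
    by have := Hn _ pD; rewrite negbK => /eqP ->.
  have p0 : (p%:R : R) != 0.
    by move: pD; rewrite mem_primes_upto pnatr_eq0 -lt0n => /andP[/prime_gt0].
  apply/eqP; rewrite prodf_seq_eq0; apply/hasP; exists p => //=.
  move: pkl; rewrite /al /be; case: (p %| k)%N; case: (p %| l)%N => //= _.
    by rewrite divff // addrN.
  by rewrite divff // addrN.
have -> : S = (S - (b%:R - a%:R) * M) + (b%:R - a%:R) * M by ring.
rewrite addrC [leRHS]addrC addrC; apply: (le_trans (ler_normD _ _)).
by apply: lerD => //; apply: le_trans HB.
Qed.

End Sieve.

(** * The sieve inequality *)

Section SieveBound.
Variable R : realType.
Implicit Types (a b d k l n D : nat).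

(** A dual form of Selberg's sieve, with no quadratic form to optimise: [Lam] is constantly
    [sqfree_sum R D] on the sifted integers, where [sgn] and [cfun] cancel. When [Lam n ^+ 2] is
    summed over all [n] and expanded, the diagonal gives the main term and the errors [k * l] add up
    to at most D^4. *)
Lemma sieve_bound D a b : (a <= b)%N ->
  (\sum_(a <= n < b | all (fun p => ~~ (p %| n)%N) (primes_upto D)) 1)
    * sqfree_sum R D ^+ 2 <= (b%:R - a%:R) * sqfree_sum R D + (D ^ 4)%N%:R.
Proof.
move=> ab.
pose Lam n : R := \sum_(1 <= k < D.+1 | sqfree D k) k%:R^-1 * sgn R D k * cfun R D k n.
have HL n : all (fun p => ~~ (p %| n)%N) (primes_upto D) -> Lam n = sqfree_sum R D.
  move=> /allP pn; apply: eq_bigr => k _; rewrite -mulrA /sgn /cfun -big_split /=.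
  rewrite big_seq big1 ?mulr1 // => p /pn /negbTE ->.
  by case: ifP => _; rewrite /= ?mulr0 ?sub0r ?mulrNN ?mulr1.
have -> : (\sum_(a <= n < b | all (fun p => ~~ (p %| n)%N) (primes_upto D)) 1)
    * sqfree_sum R D ^+ 2 =
   \sum_(a <= n < b | all (fun p => ~~ (p %| n)%N) (primes_upto D)) Lam n ^+ 2.
  by rewrite big_distrl /=; apply: eq_bigr => n /HL ->; rewrite mul1r.
apply: (@le_trans _ _ (\sum_(a <= n < b) Lam n ^+ 2)).
  rewrite [leLHS]big_mkcond; apply: ler_sum => n _.
  by case: ifP => // _; rewrite sqr_ge0.
have sgn1 k : `|sgn R D k| = 1.
  by rewrite normr_prod big1 // => p _; case: ifP; rewrite ?normrN normr1.
pose S k l := \sum_(a <= n < b) cfun R D k n * cfun R D l n.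
have -> : \sum_(a <= n < b) Lam n ^+ 2 =
   \sum_(1 <= k < D.+1 | sqfree D k) \sum_(1 <= l < D.+1 | sqfree D l)
     (k%:R^-1 * l%:R^-1 * (sgn R D k * sgn R D l) * S k l).
  under eq_bigr => n _.
    rewrite expr2 {1}/Lam big_distrl /=.
    under eq_bigr => k _ do rewrite /Lam big_distrr /=.
    over.
  rewrite exchange_big /=; apply: eq_bigr => k _.
  rewrite exchange_big /=; apply: eq_bigr => l _.
  by rewrite /S big_distrr /=; apply: eq_bigr => n _; ring.
apply: (@le_trans _ _ (\sum_(1 <= k < D.+1 | sqfree D k)
    \sum_(1 <= l < D.+1 | sqfree D l)
     ((if k == l then (b%:R - a%:R) / k%:R else 0) + k%:R * l%:R))).
  rewrite big_nat_cond [leRHS]big_nat_cond; apply: ler_sum => k /andP[/andP[k0 _] sk].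
  rewrite big_nat_cond [leRHS]big_nat_cond; apply: ler_sum => l /andP[/andP[l0 _] sl].
  apply: (le_trans (ler_norm _)).
  rewrite !normrM !sgn1 !mulr1.
  have := cfun_corr R ab sk sl k0 l0; rewrite -/(S k l) => H.
  rewrite [`|k%:R^-1|]ger0_norm ?invr_ge0 // [`|l%:R^-1|]ger0_norm ?invr_ge0 //.
  have kl0 : (0 : R) <= k%:R^-1 * l%:R^-1 by rewrite mulr_ge0 // invr_ge0.
  apply: (le_trans (ler_wpM2l kl0 H)).
  have kR : (k%:R : R) != 0 by rewrite pnatr_eq0 -lt0n.
  have lR : (l%:R : R) != 0 by rewrite pnatr_eq0 -lt0n.
  rewrite natrM !natrX le_eqVlt; apply/orP; left; apply/eqP.
  case: eqP => [<-|_]; by field; rewrite ?kR ?lR.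
under eq_bigr => k _ do rewrite big_split /=.
rewrite big_split /=; apply: lerD.
  rewrite /sqfree_sum big_distrr /=.
  rewrite big_nat_cond [leRHS]big_nat_cond; apply: ler_sum => k /andP[/andP[k0 kD] sk].
  rewrite -big_mkcondr /= big_nat_cond.
  rewrite (eq_bigl (fun i => (i == k) && ((1 <= k < D.+1)%N && sqfree D k))); last first.
    by move=> i; rewrite [k == i]eq_sym; case: eqP => [->|_]; rewrite ?andbT ?andbF.
  rewrite k0 kD sk /=.
  under eq_bigl do rewrite andbT.
  rewrite -big_filter (@filter_pred1_uniq) ?iota_uniq // ?mem_index_iota ?k0 //.
  by rewrite big_seq1.
have P0 : (\sum_(1 <= k < D.+1 | sqfree D k) k%:R : R) <= D%:R ^+ 2.
  rewrite big_nat_cond.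
  apply: (@le_trans _ _ (\sum_(1 <= k < D.+1) D%:R)).
    rewrite [leLHS]big_mkcond [leRHS]big_nat_cond [leRHS]big_mkcond /=.
    apply: ler_sum => k _; case: (boolP (1 <= k < D.+1)%N) => //= /andP[_ kD].
    by case: ifP => _ //; rewrite ler_nat.
  by rewrite big_const_nat iter_addr_0 subSS subn0 -[_ *+ _]mulr_natr expr2.
have P1 : (0 : R) <= \sum_(1 <= k < D.+1 | sqfree D k) k%:R by apply: sumr_ge0.
have -> : \sum_(1 <= k < D.+1 | sqfree D k) \sum_(1 <= l < D.+1 | sqfree D l) k%:R * l%:R
   = (\sum_(1 <= k < D.+1 | sqfree D k) k%:R : R) ^+ 2.
  rewrite expr2 big_distrl /=; apply: eq_bigr => k _; by rewrite big_distrr.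
have -> : ((D ^ 4)%N%:R : R) = (D%:R ^+ 2) ^+ 2 by rewrite natrX -exprM.
by rewrite ler_sqr ?nnegrE // exprn_ge0.
Qed.

Lemma sqfree_of_no_square D k : (0 < k <= D)%N ->
  (forall p, prime p -> ~~ (p ^ 2 %| k)%N) -> sqfree D k.
Proof.
move=> /andP[k0 kD] nsq; apply/eqP.
rewrite -{1}(partnT k0) /partn big_filter_cond /primes_upto big_mkcond.
rewrite [RHS]big_mkcond.
have -> : iota 0 D.+1 = iota 0 k.+1 ++ iota k.+1 (D - k).
  by rewrite -[k.+1]addn0 -{2}[k.+1]add0n addn0 -iotaD; congr iota; lia.
rewrite big_cat /= [X in (_ = _ * X)%N]big_seq [X in (_ = _ * X)%N]big1 ?muln1.
  rewrite /index_iota subn0; apply: eq_bigr => p _.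
  case: (boolP (prime p)) => pp /=; last by rewrite lognE (negbTE pp).
  case: (boolP (p %| k)%N) => pk; last by rewrite lognE (negbTE pk) !andbF.
  have : logn p k == 1%N.
    rewrite eqn_leq logn_gt0 mem_primes pp k0 pk /= andbT.
    by have := nsq p pp; rewrite pfactor_dvdn // -ltnNge.
  by move=> /eqP ->.
move=> p; rewrite mem_iota => /andP[kp _]; case: ifP => // /andP[_ pk].
by have := dvdn_leq k0 pk; lia.
Qed.

Lemma square_decomp D n : (0 < n <= D)%N ->
  exists k m, [/\ sqfree D k, (0 < k <= D)%N, (0 < m <= D)%N & n = (k * m ^ 2)%N].
Proof.
move=> /andP[n0 nD].
have ex : exists m, (0 < m)%N && (m ^ 2 %| n)%N by exists 1%N; rewrite dvd1n.
have ub m : (0 < m)%N && (m ^ 2 %| n)%N -> (m <= n)%N.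
  by move=> /andP[m0 /(dvdn_leq n0)]; nia.
case: (ex_maxnP ex ub) => m /andP[m0 /dvdnP[k nk]] mmax.
have k0 : (0 < k)%N by move: n0; rewrite nk muln_gt0 => /andP[].
have kn : (k <= n)%N by rewrite nk leq_pmulr // expn_gt0 m0.
exists k, m; split => //; last 2 first.
- by rewrite k0 (leq_trans kn).
- rewrite m0 /=; apply: leq_trans nD; apply: ub; rewrite m0 nk; exact: dvdn_mull.
apply: sqfree_of_no_square; first by rewrite k0 (leq_trans kn).
move=> p pp; apply/negP => pk.
have p1 := prime_gt1 pp.
have : (0 < m * p)%N && ((m * p) ^ 2 %| n)%N.
  by rewrite muln_gt0 m0 prime_gt0 //= expnMn nk mulnC dvdn_mul.
move=> /mmax; nia.
Qed.

Lemma sum_inv_sq D : \sum_(1 <= m < D.+1) (m%:R ^+ 2)^-1 <= 2 :> R.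
Proof.
suff H : \sum_(1 <= m < D.+2) (m%:R ^+ 2)^-1 <= 2 - D.+1%:R^-1 :> R.
  apply: (@le_trans _ _ (\sum_(1 <= m < D.+2) (m%:R ^+ 2)^-1)).
    by rewrite [leRHS]big_nat_recr //= lerDl invr_ge0 exprn_ge0.
  by apply: (le_trans H); rewrite gerBl invr_ge0.
elim: D => [|D IH]; first by rewrite big_nat1 expr1n invr1; lra.
rewrite big_nat_recr //=; apply: (le_trans (lerD IH (lexx _))).
have x0 : (0 : R) < D.+1%:R by rewrite ltr0n.
have -> : D.+2%:R = D.+1%:R + 1 :> R by rewrite -[in LHS]addn1 natrD.
move: (D.+1%:R) x0 => x x0.
rewrite -subr_ge0.
have -> : 2 - (x + 1)^-1 - (2 - x^-1 + ((x + 1) ^+ 2)^-1) = (x * (x + 1) ^+ 2)^-1.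
  by field; lra.
by rewrite invr_ge0 mulr_ge0 ?exprn_ge0; lra.
Qed.

End SieveBound.

(** * Primes in short intervals *)

Section ShortIntervals.
Variable R : realType.
Implicit Types (a b d k l m n D e : nat).

Lemma ler_sum_subset (T : eqType) (s t : seq T) (F : T -> R) :
  uniq s -> {subset s <= t} -> (forall x, 0 <= F x) ->
  \sum_(x <- s) F x <= \sum_(x <- t) F x.
Proof.
elim: s t => [|x s IH] t /=; first by move=> _ _ F0; rewrite big_nil sumr_ge0.
move=> /andP[xs us] st F0; have xt : x \in t by apply: st; rewrite mem_head.
rewrite big_cons (perm_big _ (perm_to_rem xt)) big_cons lerD2l; apply: IH => // y ys.
have := st y; rewrite inE ys orbT => /(_ isT).
rewrite (perm_mem (perm_to_rem xt)) inE => /orP[/eqP yx|//].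
by rewrite -yx ys in xs.
Qed.

Lemma ln2_ge : 2^-1 <= ln 2 :> R.
Proof.
have := @le_ln1Dx R (- 2^-1); have -> : 1 + - 2^-1 = 2^-1 :> R by field.
by rewrite lnV ?posrE // => H; have := H ltac:(lra); lra.
Qed.

Lemma ln2_le : ln 2 <= 1 :> R.
Proof. have : 1 + 1 = 2 :> R by lra. by move=> E; have := @le_ln1Dx R 1; rewrite E; apply; lra. Qed.

Lemma ln_le_harmonic D : ln D.+1%:R <= \sum_(1 <= n < D.+1) n%:R^-1 :> R.
Proof.
elim: D => [|D IH]; first by rewrite ln1 big_nil.
rewrite big_nat_recr //=.
have x0 : (0 : R) < D.+1%:R by rewrite ltr0n.
have -> : D.+2%:R = D.+1%:R * (1 + D.+1%:R^-1) :> R.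
  by rewrite mulrDr mulr1 divff ?gt_eqF // -[in LHS]addn1 natrD.
have y0 : (0 : R) < D.+1%:R^-1 by rewrite invr_gt0.
rewrite lnM ?posrE ?addr_gt0 //.
by apply: lerD => //; apply: le_ln1Dx; apply: lt_trans y0; rewrite ltrN10.
Qed.

Lemma harmonic_le D : (0 < D)%N ->
  \sum_(1 <= n < D.+1) n%:R^-1 <= 1 + ln D%:R :> R.
Proof.
case: D => // D _; elim: D => [|D IH]; first by rewrite big_nat1 invr1 ln1 addr0.
rewrite big_nat_recr //=; apply: (le_trans (lerD IH (lexx _))).
have x0 : (0 : R) < D.+2%:R by rewrite ltr0n.
have x1 : (0 : R) < D.+1%:R by rewrite ltr0n.
rewrite -addrA lerD2l.
have E : D.+1%:R = D.+2%:R * (1 + - D.+2%:R^-1) :> R.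
  by rewrite mulrDr mulr1 mulrN divff ?gt_eqF // -[in RHS]addn1 natrD addrK.
have y0 : (0 : R) < 1 + - D.+2%:R^-1 by rewrite -(pmulr_rgt0 _ x0) -E.
rewrite [in leLHS]E lnM ?posrE // -addrA gerDl.
move: y0; move: (D.+2%:R^-1) => y y0.
have H : -1 < - y by lra.
by have := le_ln1Dx H; lra.
Qed.

(** Writing each [n <= D] as [k * m ^ 2] with [k] squarefree bounds the harmonic sum by
    [sqfree_sum R D] times the sum of 1/m^2, which is at most 2. *)
Lemma sqfree_sum_ge D : ln D.+1%:R <= 2 * sqfree_sum R D.
Proof.
apply: (le_trans (ln_le_harmonic D)).
apply: (@le_trans _ _ (\sum_(1 <= n < D.+1) \sum_(1 <= k < D.+1 | sqfree D k)
   \sum_(1 <= m < D.+1) (if n == (k * m ^ 2)%N then (k%:R * m%:R ^+ 2)^-1 else 0))).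
  rewrite big_nat_cond [leRHS]big_nat_cond; apply: ler_sum => n.
  rewrite andbT => /(@square_decomp D)[k [m [sk kD mD nE]]].
  have pos k' m' : 0 <= (if n == (k' * m' ^ 2)%N then (k'%:R * m'%:R ^+ 2)^-1 else 0) :> R.
    by case: ifP => // _; rewrite invr_ge0 mulr_ge0 ?exprn_ge0.
  rewrite [leRHS]big_mkcond (bigD1_seq k) ?mem_index_iota ?iota_uniq //= sk.
  rewrite [X in _ <= X + _](bigD1_seq m) ?mem_index_iota ?iota_uniq //=.
  rewrite -addrA -nE eqxx nE natrM natrX lerDl addr_ge0 //.
    by apply: sumr_ge0 => i _; rewrite -nE.
  by apply: sumr_ge0 => i _; case: ifP => // _; apply: sumr_ge0 => j _; rewrite -nE.
rewrite exchange_big /= /sqfree_sum mulrC big_distrl /=.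
rewrite big_nat_cond [leRHS]big_nat_cond; apply: ler_sum => k /andP[/andP[k0 _] _].
apply: (@le_trans _ _ (\sum_(1 <= m < D.+1) (k%:R^-1 * (m%:R ^+ 2)^-1))).
  rewrite exchange_big /=; apply: ler_sum => m _.
  rewrite -big_mkcond -invfM.
  set c := (_ * _)^-1.
  have c0 : 0 <= c by rewrite invr_ge0 mulr_ge0 ?exprn_ge0.
  case: (boolP (1 <= k * m ^ 2 < D.+1)%N) => H.
    rewrite -big_filter filter_pred1_uniq ?iota_uniq ?mem_index_iota //.
    by rewrite big_seq1.
  rewrite big_nat_cond big1 // => i /andP[iD /eqP ie].
  by move: H; rewrite -ie iD.
by rewrite -big_distrr /= ler_wpM2l ?invr_ge0 // sum_inv_sq.
Qed.

(** Sieve by the primes up to [D = 2 ^ e]: a length H >= D^5 makes the remainder D^4 at most H / e.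
    As [sqfree_sum R D >= e / 4], the constant is 21 = 4 + 16 + 1, for the main term, the remainder,
    and the primes up to D, which the sieve removes. *)
Lemma brun_titchmarsh e a b : (0 < e)%N -> (a + 2 ^ (5 * e) <= b)%N ->
  \sum_(a <= n < b | prime n) 1 <= 21 * (b%:R - a%:R) / e%:R :> R.
Proof.
move=> e0 Hab; set D := (2 ^ e)%N.
have ab : (a <= b)%N by apply: leq_trans Hab; rewrite leq_addr.
have D2 : (2 <= D)%N by rewrite /D -{1}[2%N]expn1 leq_exp2l.
have eR : (1 : R) <= e%:R by rewrite ler1n.
have D5 : (D ^ 5 <= b - a)%N by rewrite /D -expnM mulnC; lia.
set H : R := b%:R - a%:R.
have HE : H = (b - a)%N%:R by rewrite natrB.
have D5R : D%:R ^+ 5 <= H by rewrite HE -natrX ler_nat.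
set L := sqfree_sum R D.
have LD : e%:R / 4 <= L.
  have := sqfree_sum_ge D; rewrite -/L => HL.
  have : ln (D%:R : R) <= ln D.+1%:R.
    by rewrite ler_ln ?posrE ?ltr0n ?ler_nat //; lia.
  have -> : ln (D%:R : R) = ln 2 * e%:R by rewrite /D natrX lnXn // mulr_natr.
  have : 2^-1 * e%:R <= ln 2 * e%:R :> R by rewrite ler_wpM2r // ln2_ge.
  by lra.
set X : R := \sum_(a <= n < b | all (fun p => ~~ (p %| n)%N) (primes_upto D)) 1.
have SB : X * L ^+ 2 <= H * L + D%:R ^+ 4.
  by have := sieve_bound R D ab; rewrite natrX.
have DeR : e%:R <= D%:R :> R by rewrite ler_nat /D ltnW // ltn_expl.
have D4 : D%:R ^+ 4 <= H / e%:R.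
  rewrite ler_pdivlMr; last by lra.
  apply: le_trans D5R; rewrite [leRHS]exprSr ler_wpM2l ?exprn_ge0 //.
have L0 : 0 < L by lra.
have XB : X <= 4 * H / e%:R + 16 * (H / e%:R).
  have HL : H * (e%:R / 4) <= H * L by apply: ler_wpM2l => //; rewrite HE.
  have LL : (e%:R / 4) ^+ 2 <= L ^+ 2 by rewrite ler_sqr ?nnegrE; lra.
  have T1 : H / L <= 4 * H / e%:R.
    rewrite ler_pdivrMr // mulrAC ler_pdivlMr; last by lra.
    by move: HL; lra.
  have T2 : D%:R ^+ 4 / L ^+ 2 <= 16 * (H / e%:R).
    rewrite ler_pdivrMr ?exprn_gt0 //.
    apply: (le_trans D4).
    have : 1 <= 16 * L ^+ 2 by nra.
    have : 0 <= H / e%:R by rewrite divr_ge0 // HE.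
    by nra.
  apply: le_trans (lerD T1 T2).
  have -> : H / L + D%:R ^+ 4 / L ^+ 2 = (H * L + D%:R ^+ 4) / L ^+ 2.
    by field; rewrite gt_eqF.
  by rewrite ler_pdivlMr ?exprn_gt0.
apply: (@le_trans _ _ (X + D%:R)).
  rewrite (bigID (fun n => (n <= D)%N)) /= addrC; apply: lerD.
    rewrite /X big_mkcond [leRHS]big_mkcond /=; apply: ler_sum => n _.
    case: ifP => [/andP[pn nD]|_]; last by case: ifP.
    rewrite ifT //; apply/allP => p; rewrite mem_primes_upto => /andP[pp pD].
    by rewrite dvdn_prime2 //; apply: contra nD => /eqP <-.
  apply: (@le_trans _ _ (\sum_(1 <= n < D.+1) 1)); last first.
    by rewrite big_const_nat iter_addr_0 subSS subn0.
  rewrite -big_filter; apply: ler_sum_subset => //; first by rewrite filter_uniq ?iota_uniq.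
  move=> p; rewrite mem_filter mem_index_iota => /andP[/andP[/prime_gt0 p0 pD] _].
  by rewrite mem_index_iota p0.
have DD4 : D%:R <= D%:R ^+ 4 :> R.
  by rewrite -natrX ler_nat -{1}[D]expn1 leq_exp2l.
apply: (le_trans (lerD XB (le_trans DD4 D4))).
by rewrite le_eqVlt; apply/orP; left; apply/eqP; field; lra.
Qed.

End ShortIntervals.
(** * Sums over squarefree integers and Mertens' estimates *)

Section SquarefreeSums.
Variables (R : realType) (f : nat -> R).
Implicit Types (s t : seq nat) (p m n : nat) (phi psi : R -> R) (u v c : R).

(* [sfsum s phi] is the sum of phi(f(n)) / n over the products n of sublists
   of the list of primes [s], for additive [f]. *)
Fixpoint sfsum s phi : R :=
  if s is p :: s' then sfsum s' phi + p%:R^-1 * sfsum s' (fun v => phi (v + f p))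
  else phi 0.

Definition mass s : R := \prod_(p <- s) (1 + p%:R^-1).

Fixpoint sfproducts s : seq nat :=
  if s is p :: s' then sfproducts s' ++ [seq (p * n)%N | n <- sfproducts s']
  else [:: 1%N].

Lemma sfsum_le s phi psi : (forall v, phi v <= psi v) -> sfsum s phi <= sfsum s psi.
Proof.
elim: s phi psi => [|p s IH] phi psi H //=.
by apply: lerD; [exact: IH | apply: ler_wpM2l; rewrite ?invr_ge0 //; exact: IH].
Qed.

Lemma eq_sfsum s phi psi : (forall v, phi v = psi v) -> sfsum s phi = sfsum s psi.
Proof. by move=> H; apply/eqP; rewrite eq_le !sfsum_le // => v; rewrite H. Qed.

Lemma sfsumD s phi psi :
  sfsum s (fun v => phi v + psi v) = sfsum s phi + sfsum s psi.
Proof. by elim: s phi psi => [|p s IH] phi psi //=; rewrite !IH; ring. Qed.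

Lemma sfsumZ s c phi : sfsum s (fun v => c * phi v) = c * sfsum s phi.
Proof. by elim: s phi => [|p s IH] phi //=; rewrite !IH; ring. Qed.

Lemma sfsum0 s : sfsum s (fun=> 0) = 0.
Proof. by elim: s => [|p s IH] //=; rewrite IH mulr0 addr0. Qed.

Lemma sfsum_ge0 s phi : (forall v, 0 <= phi v) -> 0 <= sfsum s phi.
Proof. by move=> H; rewrite -(sfsum0 s); apply: sfsum_le. Qed.

Lemma sfsum_sum s (I : Type) (r : seq I) (F : I -> R -> R) :
  sfsum s (fun v => \sum_(i <- r) F i v) = \sum_(i <- r) sfsum s (F i).
Proof.
elim: r => [|i r IH].
  by rewrite big_nil -[RHS](sfsum0 s); apply: eq_sfsum => v; rewrite big_nil.
by rewrite big_cons -IH -sfsumD; apply: eq_sfsum => v; rewrite big_cons.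
Qed.

Lemma sfsum_cst s c : sfsum s (fun=> c) = mass s * c.
Proof.
rewrite /mass; elim: s => [|p s IH] /=; first by rewrite big_nil mul1r.
by rewrite IH big_cons; ring.
Qed.

Lemma sfsum_cat s t phi :
  sfsum (s ++ t) phi = sfsum s (fun v => sfsum t (fun w => phi (v + w))).
Proof.
elim: s phi => [|p s IH] phi /=.
  by apply: eq_sfsum => v; rewrite add0r.
rewrite !IH; congr (_ + _ * _); apply: eq_sfsum => v; apply: eq_sfsum => w.
by congr phi; ring.
Qed.

Lemma sfsum_swap s p t phi : sfsum (s ++ p :: t) phi = sfsum (p :: s ++ t) phi.
Proof.
elim: s phi => [//|q s IH] phi /=; rewrite !IH /=.
set F := sfsum _ _; set G := sfsum _ _; set H := sfsum _ _; set K := sfsum _ _.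
set K' := sfsum _ _.
have -> : K = K' by apply: eq_sfsum => v; congr phi; ring.
by ring.
Qed.

Lemma sfsum_catC s t phi : sfsum (s ++ t) phi = sfsum (t ++ s) phi.
Proof.
elim: s t phi => [|p s IH] t phi; first by rewrite cats0.
by rewrite sfsum_swap /= !IH.
Qed.

Lemma mass_ge1 s : 1 <= mass s.
Proof.
rewrite /mass; elim: s => [|p s IH]; first by rewrite big_nil.
have p0 : (0 : R) <= p%:R^-1 by rewrite invr_ge0.
by rewrite big_cons; nra.
Qed.

Lemma mass_cat s t : mass (s ++ t) = mass s * mass t.
Proof. exact: big_cat. Qed.

(** Including [p] moves the value by at most |f p| on a share of about 1/p. Markov's inequality with
    this first moment serves in [mass_primes_le] and in [concentration_lower]. *)
Lemma sfsum_mean s :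
  sfsum s (fun v => `|v|) <= mass s * \sum_(p <- s) `|f p| / p%:R.
Proof.
elim: s => [|p s IH] /=; first by rewrite big_nil normr0 mulr0.
have H : sfsum s (fun v => `|v + f p|) <= sfsum s (fun v => `|v|) + mass s * `|f p|.
  by rewrite -sfsum_cst -sfsumD; apply: sfsum_le => v; exact: ler_normD.
have p0 : (0 : R) <= p%:R^-1 by rewrite invr_ge0.
apply: (le_trans (lerD (lexx _) (ler_wpM2l p0 H))).
rewrite big_cons /mass big_cons -/(mass s).
have := mass_ge1 s; have := normr_ge0 (f p).
move: IH p0; move: (sfsum s _) (\sum_(_ <- _) _) (mass s) `|f p| (p%:R^-1).
move=> x y m a q xy q0 a0 m1.
have -> : (1 + q) * m * (a * q + y) = (1 + q) * (m * y) + q * (m * a) + (q * q) * (m * a) by ring.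
have : (1 + q) * x <= (1 + q) * (m * y) by apply: ler_wpM2l => //; lra.
have : 0 <= q * q * (m * a) by rewrite !mulr_ge0 //; lra.
lra.
Qed.

Lemma mem_sfproducts s n : all prime s -> n \in sfproducts s ->
  (0 < n)%N /\ (forall p, prime p -> (p %| n)%N -> p \in s).
Proof.
elim: s n => [|p s IH] n /=.
  by move=> _; rewrite inE => /eqP ->; split => // p pp; rewrite dvdn1 => /eqP p1; rewrite p1 in pp.
move=> /andP[pp ps]; rewrite mem_cat => /orP[/(IH _ ps)[n0 H]|/mapP[m /(IH _ ps)[m0 H] ->]].
  by split=> // q qp /(H _ qp); rewrite inE => ->; rewrite orbT.
split; first by rewrite muln_gt0 prime_gt0.
move=> q qp; rewrite Euclid_dvdM // => /orP[|/(H _ qp)].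
  by rewrite dvdn_prime2 // inE => ->.
by rewrite inE => ->; rewrite orbT.
Qed.

Lemma uniq_sfproducts s : all prime s -> uniq s -> uniq (sfproducts s).
Proof.
elim: s => [//|p s IH] /= /andP[pp ps] /andP[pns us].
rewrite cat_uniq IH //= map_inj_uniq ?IH //; last first.
  by move=> x y /eqP; rewrite eqn_pmul2l ?prime_gt0 // => /eqP.
rewrite andbT; apply/hasPn => x /mapP[y _ ->]; apply/negP => /(mem_sfproducts ps)[_ H].
by move: pns; rewrite (H p pp) // dvdn_mulr.
Qed.

(** Passage from the recursion to genuine integers, applied to the additive function of the theorem,
    to ln and to the zero function. *)
Lemma sfsumE s phi : all prime s -> uniq s -> f 1%N = 0 ->
  (forall p n, p \in s -> (0 < n)%N -> coprime p n -> f (p * n)%N = f p + f n) ->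
  sfsum s phi = \sum_(n <- sfproducts s) n%:R^-1 * phi (f n).
Proof.
move=> ps us f1; elim: s ps us phi => [|p s IH] /=.
  by move=> _ _ phi _; rewrite big_seq1 f1 invr1 mul1r.
move=> /andP[pp ps] /andP[pns us] phi fM.
have fM' q n : q \in s -> (0 < n)%N -> coprime q n -> f (q * n)%N = f q + f n.
  by move=> qs; apply: fM; rewrite inE qs orbT.
rewrite big_cat big_map !IH //; congr (_ + _).
rewrite big_distrr /= !big_seq; apply: eq_bigr => n /(mem_sfproducts ps)[n0 H].
rewrite natrM invfM mulrA fM ?mem_head // 1?addrC //.
rewrite prime_coprime //; apply/negP => /(H _ pp); exact/negP.
Qed.

Lemma mem_sfproducts_prod s (P : pred nat) :
  (\prod_(p <- s | P p) p)%N \in sfproducts s.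
Proof.
elim: s => [|p s IH] /=; first by rewrite big_nil inE.
rewrite big_cons mem_cat; case: ifP => _; last by rewrite IH.
by rewrite map_f ?orbT.
Qed.

End SquarefreeSums.

(** * Mertens' estimates *)

Section Mertens.
Variable R : realType.
Implicit Types (D m k i j : nat).

Definition primes_in a b := [seq p <- index_iota a b | prime p].

(** Scales at which the logarithm doubles: the primes of one block have bounded mass, those between
    levels [i] and [j] a mass of order 2^(j-i). *)
Definition dexp j := (2 ^ (2 ^ j))%N.

Lemma mem_primes_in a b p : (p \in primes_in a b) = prime p && (a <= p < b)%N.
Proof. by rewrite mem_filter mem_index_iota. Qed.

Lemma uniq_primes_in a b : uniq (primes_in a b).
Proof. by rewrite filter_uniq ?iota_uniq. Qed.

Lemma all_primes_in a b : all prime (primes_in a b).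
Proof. by apply/allP => p; rewrite mem_primes_in => /andP[]. Qed.

Lemma primes_in_cat a b c : (a <= b)%N -> (b <= c)%N ->
  primes_in a c = primes_in a b ++ primes_in b c.
Proof.
move=> ab bc; rewrite /primes_in.
have -> : index_iota a c = index_iota a b ++ index_iota b c.
  by rewrite /index_iota -{2}(subnKC ab) -iotaD; congr iota; lia.
exact: filter_cat.
Qed.

(** Brun-Titchmarsh with [e = m %/ 5], where m <= 9 e once m >= 5, gives 189 = 21 * 9. For smaller
    m, bounding the sum by 1 is enough. *)
Lemma dyadic_primes_sum m : (0 < m)%N ->
  \sum_(p <- primes_in (2 ^ m) (2 ^ m.+1)) p%:R^-1 <= 189 / m%:R :> R.
Proof.
move=> m0; rewrite big_filter.
have T0 : (0 : R) < (2 ^ m)%:R by rewrite ltr0n expn_gt0.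
have mR : (0 : R) < m%:R by rewrite ltr0n.
have E : \sum_(2 ^ m <= p < 2 ^ m.+1 | prime p) p%:R^-1 <=
    (2 ^ m)%:R^-1 * \sum_(2 ^ m <= p < 2 ^ m.+1 | prime p) 1 :> R.
  rewrite big_distrr /= big_nat_cond [leRHS]big_nat_cond.
  apply: ler_sum => p /andP[/andP[mp _] _].
  by rewrite mulr1 lef_pV2 ?posrE ?ler_nat // ltr0n (leq_trans _ mp) // expn_gt0.
have dH : (2 ^ m.+1)%:R - (2 ^ m)%:R = (2 ^ m)%:R :> R.
  by rewrite expnS natrM; ring.
apply: (le_trans E); case: (ltnP m 5) => m5.
  apply: (@le_trans _ _ ((2 ^ m)%:R^-1 * (2 ^ m)%:R)).
    rewrite ler_wpM2l ?invr_ge0 // -[leRHS]dH -natrB; last by rewrite leq_exp2l.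
    rewrite [leLHS]big_mkcond /= -sumr_const_nat.
    by apply: ler_sum => i _; case: ifP.
  rewrite mulVf ?gt_eqF // ler_pdivlMr // mul1r.
  have : m%:R <= 5 :> R by rewrite ler_nat ltnW.
  by lra.
have e0 : (0 < m %/ 5)%N by rewrite divn_gt0.
have eR : (0 : R) < (m %/ 5)%N%:R by rewrite ltr0n.
have Hle : (2 ^ m + 2 ^ (5 * (m %/ 5)) <= 2 ^ m.+1)%N.
  rewrite expnS mul2n -addnn leq_add2l leq_exp2l //.
  by rewrite mulnC leq_trunc_div.
have := brun_titchmarsh R e0 Hle; rewrite dH.
move=> H; have iT : (0 : R) <= (2 ^ m)%:R^-1 by rewrite invr_ge0.
apply: (le_trans (ler_wpM2l iT H)).
rewrite ler_pdivlMr //.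
have -> : (2 ^ m)%:R^-1 * (21 * (2 ^ m)%:R / (m %/ 5)%:R) * m%:R = 21 * m%:R / (m %/ 5)%:R :> R.
  by field; rewrite !gt_eqF.
rewrite ler_pdivrMr //.
have : m%:R <= 9 * (m %/ 5)%N%:R :> R by rewrite -natrM ler_nat; lia.
by lra.
Qed.

(** A dyadic block contributes at most (k+2) * 189 / (k+1) <= 378. *)
Lemma sum_ln_div_primes k :
  \sum_(p <- primes_in 2 (2 ^ k)) ln p%:R / p%:R <= 378 * k%:R :> R.
Proof.
elim: k => [|k IH]; first by rewrite /primes_in /index_iota expn0 big_nil mulr0.
case: k IH => [|k] IH.
  by rewrite /primes_in /index_iota expn1 subnn big_nil mulr1.
rewrite (@primes_in_cat 2 (2 ^ k.+1)) ?big_cat /=; last 2 first.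
- by rewrite -{1}[2%N]expn1 leq_exp2l.
- by rewrite leq_exp2l.
rewrite -[k.+2]addn1 [in leRHS]natrD mulrDr mulr1; apply: lerD; first exact: IH.
have kR : (0 : R) < k.+1%:R by rewrite ltr0n.
apply: (@le_trans _ _ (k.+2%:R * \sum_(p <- primes_in (2 ^ k.+1) (2 ^ k.+2)) p%:R^-1)).
  rewrite big_distrr /= addn1 big_seq [leRHS]big_seq; apply: ler_sum => p.
  rewrite mem_primes_in => /andP[pp /andP[_ pk]].
  rewrite ler_wpM2r ?invr_ge0 //.
  have p0 : (0 : R) < p%:R by rewrite ltr0n prime_gt0.
  apply: (@le_trans _ _ (ln ((2 ^ k.+2)%:R))).
    by rewrite ler_ln ?posrE ?ltr0n ?expn_gt0 ?prime_gt0 // ler_nat ltnW.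
  rewrite natrX lnXn // -[ln _ *+ _]mulr_natl ler_piMr //; exact: ln2_le.
apply: (le_trans (ler_wpM2l (ler0n _ _) (dyadic_primes_sum (ltn0Sn k)))).
rewrite mulrA ler_pdivrMr //.
have k1 : (1 : R) <= k.+1%:R by rewrite ler1n.
by rewrite -[k.+2]addn1 natrD; lra.
Qed.

(* Rankin's trick: at least half of the sum over squarefree [n] of [1/n] comes
   from [ln n <= T], because the mean of [ln n] is at most [T / 2]. *)
Lemma mass_primes_le : exists2 C : R, 1 <= C & forall k, (0 < k)%N ->
  mass R (primes_in 2 (2 ^ k)) <= C * k%:R.
Proof.
(* The argument ends with [M <= 2 + 2 * T], where T = 756 k and k >= 1. *)
exists (2 + 2 * (2 * 378)); first by lra.
move=> k k0; set s := primes_in _ _.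
pose f n : R := ln n%:R.
set T : R := 2 * 378 * k%:R.
have kR : (1 : R) <= k%:R by rewrite ler1n.
have T0 : 1 <= T by rewrite /T; lra.
set M := mass R s.
have M1 : 1 <= M by exact: mass_ge1.
have fE phi : sfsum f s phi = \sum_(n <- sfproducts s) n%:R^-1 * phi (f n).
  apply: sfsumE; rewrite ?all_primes_in ?uniq_primes_in // /f ?ln1 //.
  move=> p n; rewrite mem_primes_in => /andP[pp _] n0 _.
  by rewrite natrM lnM ?posrE ?ltr0n // prime_gt0.
have mean : sfsum f s (fun v => `|v|) <= M * (T / 2).
  apply: (le_trans (sfsum_mean _ _)); rewrite -/M ler_wpM2l //; first by lra.
  have := sum_ln_div_primes k; rewrite -/s => H.
  apply: le_trans (_ : 378 * k%:R <= _); last by rewrite /T; lra.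
  apply: le_trans H; rewrite big_seq [leRHS]big_seq; apply: ler_sum => p.
  rewrite mem_primes_in => /andP[pp _].
  by rewrite ger0_norm // /f ln_ge0 // ler1n prime_gt0.
pose ind (v : R) : R := if v <= T then 1 else 0.
have split1 : M <= sfsum f s ind + M / 2.
  rewrite -[M in leLHS]mulr1 -(sfsum_cst f).
  apply: (@le_trans _ _ (sfsum f s ind + T^-1 * sfsum f s (fun v => `|v|))).
    rewrite -sfsumZ -sfsumD; apply: sfsum_le => v; rewrite /ind.
    case: (leP v T) => vT; first by rewrite lerDl mulr_ge0 ?invr_ge0 //; lra.
    rewrite add0r mulrC ler_pdivlMr ?mul1r; last by lra.
    by rewrite (le_trans (ltW vT)) // ler_norm.
  rewrite lerD2l; apply: (@le_trans _ _ (T^-1 * (M * (T / 2)))).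
    by rewrite ler_wpM2l // invr_ge0; lra.
  by rewrite le_eqVlt; apply/orP; left; apply/eqP; field; lra.
set N := Num.truncn (expR T).
have eT : 1 <= expR T by rewrite -[leLHS]expR0 ler_expR; lra.
have N0 : (0 < N)%N by rewrite truncn_gt0.
have small : sfsum f s ind <= 1 + T.
  rewrite fE; apply: (@le_trans _ _ (\sum_(n <- [seq n <- sfproducts s | f n <= T]) n%:R^-1)).
    rewrite [leRHS]big_filter [leRHS]big_mkcond /=; apply: ler_sum => n _.
    by rewrite /ind; case: ifP => _; rewrite ?mulr1 ?mulr0.
  apply: (@le_trans _ _ (\sum_(1 <= n < N.+1) n%:R^-1)).
    apply: ler_sum_subset => //.
      by rewrite filter_uniq // uniq_sfproducts ?all_primes_in ?uniq_primes_in.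
    move=> n; rewrite mem_filter => /andP[nT /mem_sfproducts].
    rewrite all_primes_in => /(_ isT)[n0 _].
    rewrite mem_index_iota n0 ltnS truncn_ge_nat; last by lra.
    by rewrite -ler_ln ?posrE ?ltr0n ?expR_gt0 // expRK.
  apply: (le_trans (harmonic_le R N0)); rewrite lerD2l.
  rewrite -[leRHS]expRK ler_ln ?posrE ?ltr0n ?expR_gt0 //.
  by rewrite truncn_le; lra.
have : M <= 2 + 2 * T by lra.
by rewrite /T; move: kR; clear; lra.
Qed.

(** Each squarefree integer below [dexp j] is a product of distinct primes below [dexp j], so the
    mass is at least ln (dexp j) / 2; and ln 2 >= 1/2. *)
Lemma mass_primes_ge j : 2 ^+ j / 4 <= mass R (primes_in 2 (dexp j)).
Proof.
have d0 : (0 < dexp j)%N by rewrite expn_gt0.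
have L : 2 ^+ j / 4 <= sqfree_sum R (dexp j).-1.
  have := sqfree_sum_ge R (dexp j).-1; rewrite prednK //.
  rewrite /dexp natrX lnXn // -[ln _ *+ _]mulr_natr natrX.
  have : 0 <= (2 : R) ^+ j by rewrite exprn_ge0.
  move: (2 ^+ j) => x x0; have := ler_wpM2r x0 (ln2_ge R); lra.
apply: (le_trans L).
rewrite -[leRHS]mulr1 -(sfsum_cst (fun=> 0)) sfsumE ?all_primes_in ?uniq_primes_in //; last first.
  by move=> *; rewrite addr0.
under [leRHS]eq_bigr do rewrite mulr1.
rewrite /sqfree_sum -[leLHS]big_filter; apply: ler_sum_subset => //.
  by rewrite filter_uniq ?iota_uniq.
move=> k; rewrite mem_filter => /andP[/eqP -> _].
have -> : primes_upto (dexp j).-1 = primes_in 2 (dexp j).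
  rewrite /primes_upto prednK // /primes_in /index_iota.
  case: (dexp j) d0 => [|[|d]] // _.
  by rewrite /= subSS subSS subn0.
exact: mem_sfproducts_prod.
Qed.

Lemma dexp_mono i j : (i <= j)%N -> (dexp i <= dexp j)%N.
Proof. by move=> ij; rewrite leq_exp2l // leq_exp2l. Qed.

Lemma dexp_ge2 j : (2 <= dexp j)%N.
Proof. by rewrite (leq_trans _ (dexp_mono (leq0n j))). Qed.

(** Divide the upper bound for the mass up to [dexp j] by the lower bound up to [dexp i], which
    brings in the factor 4. *)
Lemma mass_blocks_le : exists2 C : R, 1 <= C & forall i j, (i <= j)%N ->
  mass R (primes_in (dexp i) (dexp j)) <= C * 2 ^+ (j - i).
Proof.
have [C C1 HC] := mass_primes_le.
exists (4 * C); first by lra.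
move=> i j ij.
have := HC (2 ^ j)%N; rewrite expn_gt0 /= -/(dexp j) => /(_ isT).
rewrite (primes_in_cat (dexp_ge2 i) (dexp_mono ij)) mass_cat.
have := mass_primes_ge i; have := mass_ge1 R (primes_in (dexp i) (dexp j)).
move: (mass R (primes_in 2 _)) (mass R (primes_in _ _)) => y x x1 y0.
rewrite natrX -{1}(subnK ij) exprD.
have : 0 < (2 : R) ^+ i by rewrite exprn_gt0.
move: (2 ^+ i) (2 ^+ (j - i)) y0 => u v y0 u0 H.
rewrite -(ler_pM2r u0).
have x0 : 0 <= x by lra.
have := ler_wpM2r x0 y0.
by lra.
Qed.

End Mertens.
(** * Splitting by the least prime factor *)

Section SmallestPrime.
Variables (R : realType) (f : nat -> R).
Implicit Types (s t b : seq nat) (u v x d : R).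

Definition win u d x : R := if u <= x <= u + d then 1 else 0.

Lemma win_ge0 u d x : 0 <= win u d x.
Proof. by rewrite /win; case: ifP. Qed.

Lemma winD u d x y : win u d (x + y) = win (u - x) d y.
Proof. by rewrite /win; congr (if _ then _ else _); apply/idP/idP => ?; lra. Qed.

Lemma win_split n u h x : 0 <= h ->
  win u (n.+1%:R * h) x <= \sum_(0 <= i < n.+1) win (u + i%:R * h) h x.
Proof.
move=> h0; elim: n => [|n IH]; first by rewrite big_nat1 mul0r addr0 mul1r.
rewrite big_nat_recr //=.
case: (lerP x (u + n.+1%:R * h)) => xu.
  apply: le_trans (_ : win u (n.+1%:R * h) x <= _).
    rewrite /win xu andbT; case: ifP => [/andP[-> _]//|_].
    by case: ifP.
  by apply: (le_trans IH); rewrite lerDl win_ge0.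
rewrite -[leLHS]add0r; apply: lerD; first by apply: sumr_ge0 => i _; exact: win_ge0.
rewrite /win; case: ifP => [/andP[_ H]|_]; last by case: ifP.
suff -> : u + n.+1%:R * h <= x <= u + n.+1%:R * h + h by [].
by rewrite ltW //= (le_trans H) // -[n.+2]addn1 natrD; lra.
Qed.

Lemma sfsum_cons_ge p s phi : (forall v, 0 <= phi v) ->
  sfsum f s phi <= sfsum f (p :: s) phi.
Proof. by move=> H; rewrite /= lerDl mulr_ge0 ?invr_ge0 // sfsum_ge0. Qed.

(** The sum is split by the first prime [p] of [b] that is used. The later primes are enlarged to
    all of [b], at no cost for an upper bound, so that one cofactor list serves every [p]. *)
Lemma sfsum_first b phi : (forall v, 0 <= phi v) ->
  sfsum f b phi <= phi 0 +
    \sum_(p <- b) p%:R^-1 * sfsum f b (fun v => phi (v + f p)).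
Proof.
move=> H; elim: b => [|p b IH]; first by rewrite big_nil addr0.
rewrite big_cons addrCA addrA [leLHS]/= [leLHS]addrC -addrA; apply: lerD.
  by apply: ler_wpM2l; rewrite ?invr_ge0 //; apply: sfsum_cons_ge.
apply: (le_trans IH); rewrite lerD2l; apply: ler_sum => q _.
by apply: ler_wpM2l; rewrite ?invr_ge0 //; apply: sfsum_cons_ge.
Qed.

(* Split according to the least prime factor [p] from the block [b], if any;
   the window for [f p] is then determined by the cofactor. *)
Lemma sfsum_win_block s b t d G W B : 0 <= W ->
  {in b, forall p, `|f p| <= G} ->
  (forall u, \sum_(p <- b) p%:R^-1 * win u d (f p) <= W) ->
  (forall u, sfsum f s (win u (d + 2 * G)) <= B) ->
  forall u, sfsum f (s ++ b ++ t) (win u d) <=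
    sfsum f (s ++ t) (win u d) + mass R (b ++ t) * W * B.
Proof.
move=> W0 hG hW hB u.
rewrite sfsum_catC -catA sfsum_cat.
set phi := fun v => sfsum f (t ++ s) (fun w => win u d (v + w)).
have phi0 v : 0 <= phi v by apply: sfsum_ge0 => w; exact: win_ge0.
apply: (le_trans (sfsum_first _ phi0)); apply: lerD.
  rewrite /phi sfsum_catC; apply: sfsum_le => v; by rewrite add0r.
under eq_bigr do rewrite -sfsumZ.
rewrite -sfsum_sum mass_cat -!mulrA -(sfsum_cst f); apply: sfsum_le => v.
under eq_bigr do rewrite /phi -sfsumZ.
rewrite -sfsum_sum sfsum_cat -(sfsum_cst f); apply: sfsum_le => w.
(* As |f p| <= G, the value [x] of the part from [s] must lie in the window widened by G on both
   sides, or no [p] contributes. If it does, the sum over [p] is at most [W], since [v], [w] and [x]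
   fix the window for [f p]. *)
apply: (@le_trans _ _ (W * sfsum f s (win (u - G - (v + w)) (d + 2 * G)))); last first.
  exact: ler_wpM2l.
rewrite -sfsumZ; apply: sfsum_le => x.
have E : \sum_(p <- b) p%:R^-1 * win u d (v + f p + (w + x)) =
         \sum_(p <- b) p%:R^-1 * win (u - (v + w + x)) d (f p).
  by apply: eq_bigr => p _; rewrite -winD; congr (_ * win _ _ _); ring.
rewrite E {E}.
rewrite {2}/win; case: ifP => H; first by rewrite mulr1; exact: hW.
rewrite mulr0 big_seq big1 // => p /hG pG; rewrite /win ifF ?mulr0 //.
apply/negP => H2; move/negP: H; apply.
by move: pG; rewrite ler_norml; lra.
Qed.

Variable P : pred nat.

Definition block i j := [seq p <- primes_in (dexp i) (dexp j) | P p].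

Lemma block_cat i j k : (i <= j)%N -> (j <= k)%N -> block i k = block i j ++ block j k.
Proof.
by move=> ij jk; rewrite /block (primes_in_cat (dexp_mono ij) (dexp_mono jk)) filter_cat.
Qed.

Lemma blockxx i : block i i = [::].
Proof. by rewrite /block /primes_in /index_iota subnn. Qed.

Lemma mem_block i j p : (p \in block i j) = [&& P p, prime p & (dexp i <= p < dexp j)%N].
Proof. by rewrite mem_filter mem_primes_in. Qed.

Lemma mass_filter_le s (Q : pred nat) : mass R [seq p <- s | Q p] <= mass R s.
Proof.
rewrite /mass big_filter; elim: s => [|p s IH]; first by rewrite !big_nil.
have p0 : (0 : R) <= p%:R^-1 by rewrite invr_ge0.
have m1 := mass_ge1 R [seq p <- s | Q p].
rewrite /mass big_filter in m1.
by rewrite !big_cons; case: ifP => _; nra.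
Qed.

(** Blocks are removed from the lowest upwards, so that for [p] in block [k] the cofactor beyond [s]
    has only primes from level [k] on. The resulting mass of [block k j], rather than [block i j],
    makes the sum over [k] geometric. *)
Lemma sfsum_win_blocks s i j d (G W B : nat -> R) : (i <= j)%N ->
  (forall k, (i <= k < j)%N -> 0 <= W k) ->
  (forall k, (i <= k < j)%N -> {in block k k.+1, forall p, `|f p| <= G k}) ->
  (forall k u, (i <= k < j)%N ->
     \sum_(p <- block k k.+1) p%:R^-1 * win u d (f p) <= W k) ->
  (forall k u, (i <= k < j)%N -> sfsum f s (win u (d + 2 * G k)) <= B k) ->
  forall u, sfsum f (s ++ block i j) (win u d) <=
    sfsum f s (win u d) + \sum_(i <= k < j) mass R (block k j) * W k * B k.
Proof.
elim: (j - i)%N {-2}i (erefl (j - i)%N) => [|n IH] {}i Hn ij hW0 hG hW hB u.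
  have -> : i = j by lia.
  by rewrite blockxx cats0 big_geq // addr0.
have ij' : (i < j)%N by lia.
rewrite (@block_cat i i.+1 j) // big_ltn //.
have ii : (i <= i < j)%N by rewrite leqnn.
have := @sfsum_win_block s (block i i.+1) (block i.+1 j) d _ _ _
  (hW0 i ii) (hG i ii) (fun u => hW i u ii) (fun u => hB i u ii) u.
move=> /le_trans; apply.
rewrite [leRHS]addrCA [leRHS]addrC; apply: lerD; last by rewrite -block_cat.
have sub k : (i.+1 <= k < j)%N -> (i <= k < j)%N by lia.
apply: IH => //; try lia.
- by move=> k /sub; exact: hW0.
- by move=> k /sub; exact: hG.
- by move=> k v /sub; exact: hW.
- by move=> k v /sub; exact: hB.
Qed.

End SmallestPrime.
(** * The spacing condition *)

Section Envelope.
Variables (R : realType) (f : nat -> R) (P : set nat) (c C1 : R).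
Hypotheses (hP : forall p, P p -> prime p) (c_ge1 : 1 <= c) (C1_gt0 : 0 < C1).
Hypothesis hf : forall p, P p -> `|f p| <= C1 / ln p%:R `^ c.
Implicit Types (s t : R) (p : nat).

Let values t : set R := [set `|f p| * ln p%:R `^ c | p in [set p : nat | P p /\ t <= p%:R]].

Lemma lnc_gt0 t : 1 < t -> 0 < ln t `^ c.
Proof. by move=> t1; rewrite powR_gt0 // ln_gt0. Qed.

Lemma lnc_mono s t : 1 < s -> s <= t -> ln s `^ c <= ln t `^ c.
Proof.
move=> s1 st; have t1 : 1 < t by apply: lt_le_trans st.
apply: (ge0_ler_powR (le_trans ler01 c_ge1)); rewrite ?nnegrE ?ln_ge0 ?(ltW s1) ?(ltW t1) //.
by rewrite ler_ln ?posrE //; lra.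
Qed.

Lemma prime_gt1R p : P p -> 1 < p%:R :> R.
Proof. by move=> /hP pp; rewrite ltr1n prime_gt1. Qed.

Lemma values_ub t : ubound (values t) C1.
Proof.
move=> _ [p [Pp _] <-].
by rewrite -ler_pdivlMr ?hf // lnc_gt0 // prime_gt1R.
Qed.

Lemma sup_values_ge0 t : 0 <= sup (values t).
Proof.
have [[x xt]|] := pselect (values t !=set0); last first.
  by move=> /nonemptyPn ->; rewrite sup0.
apply: le_trans (ub_le_sup _ xt); last by exists C1; exact: values_ub.
by case: xt => p _ <-; rewrite mulr_ge0 ?powR_ge0.
Qed.

Lemma sup_values_anti s t : s <= t -> sup (values t) <= sup (values s).
Proof.
move=> st; have [ne|] := pselect (values t !=set0); last first.
  by move=> /nonemptyPn ->; rewrite sup0 sup_values_ge0.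
apply: ge_sup => // _ [p [Pp tp] <-]; apply: ub_le_sup; first by exists C1; exact: values_ub.
by exists p => //; split=> //; apply: le_trans tp.
Qed.

Lemma gsupE t : 1 < t -> gsup f P c t * ln t `^ c = sup (values t).
Proof. by move=> t1; rewrite /gsup divfK // gt_eqF // lnc_gt0. Qed.

Lemma gsup_ge0 t : 0 <= gsup f P c t.
Proof. by rewrite divr_ge0 ?powR_ge0 // sup_values_ge0. Qed.

Lemma gsup_bound p t : 1 < t -> P p -> t <= p%:R ->
  `|f p| * ln p%:R `^ c <= gsup f P c t * ln t `^ c.
Proof.
move=> t1 Pp tp; rewrite gsupE //; apply: ub_le_sup; first by exists C1; exact: values_ub.
by exists p.
Qed.

Lemma gsup_anti s t : 1 < s -> s <= t ->
  gsup f P c t * ln t `^ c <= gsup f P c s * ln s `^ c.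
Proof. by move=> s1 st; rewrite !gsupE ?sup_values_anti //; lra. Qed.

Let le_of_scaled (a b x y : R) : 0 <= b -> 0 < x -> x <= y -> a * y <= b * x -> a <= b.
Proof.
move=> b0 x0 xy H; have y0 : 0 < y by lra.
by rewrite -(ler_pM2r y0); apply: (le_trans H); rewrite ler_wpM2l.
Qed.

Lemma gsup_mono s t : 1 < s -> s <= t -> gsup f P c t <= gsup f P c s.
Proof.
move=> s1 st; apply: le_of_scaled (gsup_anti s1 st); rewrite ?gsup_ge0 ?lnc_gt0 //.
exact: lnc_mono.
Qed.

Lemma norm_le_gsup p t : 1 < t -> P p -> t <= p%:R -> `|f p| <= gsup f P c t.
Proof.
move=> t1 Pp tp; apply: le_of_scaled (gsup_bound t1 Pp tp); rewrite ?gsup_ge0 ?lnc_gt0 //.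
exact: lnc_mono.
Qed.

Lemma gsup_le t : 1 < t -> gsup f P c t <= C1 / ln t `^ c.
Proof.
move=> t1; rewrite ler_pdivlMr ?lnc_gt0 // gsupE //.
have [ne|] := pselect (values t !=set0); first exact: ge_sup (@values_ub t).
by move=> /nonemptyPn ->; rewrite sup0 ltW.
Qed.

Lemma dexp_gt1 j : 1 < (dexp j)%:R :> R.
Proof. by rewrite ltr1n dexp_ge2. Qed.

Lemma ln_dexp j : ln (dexp j)%:R = 2 ^+ j * ln 2 :> R.
Proof. by rewrite natrX lnXn // -[ln _ *+ _]mulr_natl natrX. Qed.

(** Not only g but g(t) (ln t)^c is nonincreasing, and ln doubles at each level; hence a factor 2^-c
    per level, the source of the ratio 2^(1-c). *)
Lemma gsup_dexp j k : (j <= k)%N ->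
  gsup f P c (dexp k)%:R <= gsup f P c (dexp j)%:R * (2^-1 `^ c) ^+ (k - j).
Proof.
move=> jk.
have H : gsup f P c (dexp k)%:R * ln (dexp k)%:R `^ c <=
         gsup f P c (dexp j)%:R * ln (dexp j)%:R `^ c.
  by apply: gsup_anti; rewrite ?dexp_gt1 // ler_nat dexp_mono.
have L : ln (dexp j)%:R `^ c = (2^-1 `^ c) ^+ (k - j) * ln (dexp k)%:R `^ c.
  have -> : ln (dexp j)%:R = 2^-1 ^+ (k - j) * ln (dexp k)%:R :> R.
    rewrite !ln_dexp -{2}(subnK jk) exprD exprVn; field.
    by rewrite expf_neq0.
  rewrite powRM ?exprn_ge0 ?ln_ge0 //; last by rewrite ltW // dexp_gt1.
  by rewrite -!powR_mulrn ?powR_ge0 // powRAC.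
by rewrite -(ler_pM2r (lnc_gt0 (dexp_gt1 k))) -[leRHS]mulrA -L.
Qed.

End Envelope.

(** * Primes whose values fall in a window *)

Section BlockWindow.
Variable R : realType.
Implicit Types (f : nat -> R) (P : set nat) (c A C d u theta : R).

Lemma seq_max (s : seq nat) : s != [::] -> exists2 b, b \in s & {in s, forall p, (p <= b)%N}.
Proof.
elim: s => [//|p s IH] _; case: (eqVneq s [::]) => [->|/IH[b bs hb]].
  by exists p; rewrite ?mem_head // => q; rewrite inE => /eqP ->.
case: (leqP p b) => pb.
  by exists b; [rewrite inE bs orbT | move=> q; rewrite inE => /orP[/eqP ->|/hb]].
exists p; first exact: mem_head.
move=> q; rewrite inE => /orP[/eqP ->//|/hb /leq_trans]; apply; exact: ltnW.
Qed.

(** All of [s] lies within [theta * b] of its maximum [b], hence above 3b/4, so the sum is at most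
    4/(3b) times a count of primes in a short interval. The term 1 / dexp (j-1) pays for lengthening
    that interval when it is too short for [brun_titchmarsh]. *)
Lemma cluster_sum j theta (s : seq nat) : uniq s ->
  {in s, forall p, prime p && (dexp j <= p)%N} -> 0 <= theta <= 4^-1 ->
  {in s &, forall p q, (p < q)%N -> q%:R - p%:R <= theta * q%:R} ->
  \sum_(p <- s) p%:R^-1 <= 900 * (theta + (dexp j.-1)%:R^-1) / 2 ^+ j.
Proof.
move=> us hs /andP[th0 th1] gap.
have P2 : 0 < (2 : R) ^+ j by rewrite exprn_gt0.
have E0 : 0 < (dexp j.-1)%:R^-1 :> R by rewrite invr_gt0 ltr0n expn_gt0.
case: (eqVneq s [::]) => [->|/seq_max[b bs bmax]].
  rewrite big_nil; apply: divr_ge0; last exact: ltW.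
  by apply: mulr_ge0; [exact: ler0n|exact: addr_ge0 th0 (ltW E0)].
have /andP[bp bj] := hs _ bs.
have b0 : (0 : R) < b%:R by rewrite ltr0n prime_gt0.
have b1 : (1 : R) <= b%:R by rewrite ler1n prime_gt0.
have tb0 : 0 <= theta * b%:R by rewrite mulr_ge0 // ltW.
set m := Num.truncn (theta * b%:R).
have mR : m%:R <= theta * b%:R by rewrite truncn_le.
have mT n : n%:R <= theta * b%:R -> (n <= m)%N by move=> H; rewrite truncn_ge_nat.
clearbody m.
have near p : p \in s -> (b - m <= p)%N.
  move=> ps; have := bmax _ ps; rewrite leq_eqVlt => /orP[/eqP ->|pb]; first exact: leq_subr.
  have := gap _ _ ps bs pb; rewrite -natrB; last exact: ltnW.
  by move=> /mT; rewrite leq_subLR; clear -pb; lia.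
have inv p : p \in s -> p%:R^-1 <= 4 / 3 / b%:R :> R.
  move=> ps.
  have p0 : (0 : R) < p%:R by rewrite ltr0n prime_gt0 //; case/andP: (hs _ ps).
  rewrite -[leLHS]mul1r ler_pdivrMr // mulrAC ler_pdivlMr // mul1r.
  have mb : (m <= b)%N.
    rewrite -(ler_nat R); apply: (le_trans mR).
    rewrite ger_pMl //; lra.
  have : (b - m)%N%:R <= p%:R :> R by rewrite ler_nat near.
  rewrite natrB //.
  have : theta * b%:R <= 4^-1 * b%:R by rewrite ler_wpM2r // ltW.
  lra.
have cnt a : (a <= b - m)%N -> \sum_(p <- s) p%:R^-1 <=
    4 / 3 / b%:R * \sum_(a <= n < b.+1 | prime n) 1 :> R.
  move=> ab; apply: (@le_trans _ _ (4 / 3 / b%:R * \sum_(p <- s) 1)).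
    by rewrite big_distrr /= big_seq [leRHS]big_seq; apply: ler_sum => p /inv; rewrite mulr1.
  have c4 : 0 <= 4 / 3 / b%:R :> R by rewrite divr_ge0 // ltW.
  apply: ler_wpM2l => //.
  rewrite -[leRHS]big_filter; apply: ler_sum_subset => // p ps.
  rewrite mem_filter mem_index_iota ltnS bmax // (leq_trans ab) ?near //.
  by case/andP: (hs _ ps) => ->.
(* For j < 4 counting all integers is enough: 2^j <= 8 and dexp (j-1) <= 16. *)
case: (ltnP j 4) => j4.
  have c1 := cnt (b - m)%N (leqnn _).
  have c2 : \sum_(b - m <= n < b.+1 | prime n) 1 <= m.+1%:R :> R.
    apply: (@le_trans _ _ (\sum_(b - m <= n < b.+1) 1)).
      by rewrite [leLHS]big_mkcond; apply: ler_sum => n _; case: ifP.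
    by rewrite big_const_nat iter_addr_0 ler_nat; clear; lia.
  have c3 : m.+1%:R <= 2 * b%:R :> R.
    rewrite -[m.+1]addn1 natrD.
    have : theta * b%:R <= 4^-1 * b%:R by rewrite ler_wpM2r // ltW.
    by lra.
  have c4 : 0 <= 4 / 3 / b%:R :> R by rewrite divr_ge0 // ltW.
  apply: (le_trans c1); apply: (le_trans (ler_wpM2l c4 (le_trans c2 c3))).
  have -> : 4 / 3 / b%:R * (2 * b%:R) = 8 / 3 :> R by field; rewrite gt_eqF.
  rewrite ler_pdivlMr //.
  have : 2 ^+ j <= 8 :> R by case: j j4 {P2 E0 hs bj} => [|[|[|[|]]]] // _; rewrite -natrX ler_nat.
  have : 16^-1 <= (dexp j.-1)%:R^-1 :> R.
    rewrite lef_pV2 ?posrE ?ltr0n ?expn_gt0 //.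
    by case: j j4 {P2 E0 hs bj} => [|[|[|[|]]]] // _; rewrite ler_nat.
  lra.
(* With this [e], b >= dexp j = 2^(16e) and dexp (j-1) = 2^(8e), so the minimal length 2^(5e) is at
   most b / dexp (j-1). The constant below is 448 = 4/3 * 21 * 16. *)
set e := (2 ^ (j - 4))%N.
have e0 : (0 < e)%N by rewrite expn_gt0.
have eR : e%:R = 2 ^+ j / 16 :> R.
  rewrite /e natrX -{2}(subnK j4) exprD -[16]/((2 * 2 * 2 * 2)%N%:R).
  by field.
have bE : (2 ^ (16 * e) <= b)%N.
  apply: leq_trans bj; rewrite leq_exp2l // /e -[16%N]/(2 ^ 4)%N -expnD leq_exp2l //; clear -j4; lia.
have EE : (dexp j.-1 = 2 ^ (8 * e))%N.
  by rewrite /dexp /e -[8%N]/(2 ^ 3)%N -expnD; congr (2 ^ (2 ^ _))%N; clear -j4; lia.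
set M := maxn m.+1 (2 ^ (5 * e)).
have Mb : (M <= b.+1)%N.
  rewrite geq_max; apply/andP; split.
    rewrite ltnS -(ler_nat R); apply: (le_trans mR); rewrite ger_pMl //; lra.
  by rewrite ltnW // ltnS (leq_trans _ bE) // leq_exp2l //; clear; lia.
have Mm : (m < M)%N by rewrite leq_max leqnn.
have M5 : (2 ^ (5 * e) <= M)%N by rewrite leq_max leqnn orbT.
have M6 : (M <= m.+1 + 2 ^ (5 * e))%N by rewrite geq_max leq_addr leq_addl.
clearbody M.
have c1 := @cnt (b.+1 - M)%N ltac:(clear -Mb Mm; lia).
have c2 := @brun_titchmarsh R e (b.+1 - M) b.+1 e0 ltac:(move: Mb M5; clear; move: (2 ^ (5 * e))%N; lia).
have MR : b.+1%:R - (b.+1 - M)%N%:R = M%:R :> R by rewrite natrB // opprB addrCA subrr addr0.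
rewrite MR in c2.
have MB : M%:R <= theta * b%:R + 2 * (2 ^ (5 * e))%:R :> R.
  have X1 : (1 : R) <= (2 ^ (5 * e))%:R by rewrite ler1n expn_gt0.
  have : M%:R <= m.+1%:R + (2 ^ (5 * e))%:R :> R by rewrite -natrD ler_nat.
  by rewrite -[m.+1]addn1 natrD; lra.
have MB2 : (2 ^ (5 * e))%:R <= (dexp j.-1)%:R^-1 * b%:R :> R.
  rewrite mulrC ler_pdivlMr ?ltr0n ?expn_gt0 // -natrM ler_nat EE -expnD.
  by apply: leq_trans bE; rewrite leq_exp2l //; clear; lia.
have c4 : 0 <= 4 / 3 / b%:R :> R by rewrite divr_ge0 // ltW.
apply: (le_trans c1); apply: (le_trans (ler_wpM2l c4 c2)).
have e1 : (0 : R) < e%:R by rewrite ltr0n.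
have -> : 4 / 3 / b%:R * (21 * M%:R / e%:R) = (448 * (M%:R / b%:R)) / 2 ^+ j :> R.
  by rewrite eR; field; rewrite !gt_eqF.
rewrite ler_pM2r ?invr_gt0 //.
have : M%:R / b%:R <= theta + 2 * (dexp j.-1)%:R^-1.
  rewrite ler_pdivrMr // mulrDl -mulrA; apply: (le_trans MB); rewrite lerD2l; lra.
lra.
Qed.



(** The window is cut into pieces of length [h] with C h < d. Two primes with values in one piece
    cannot satisfy the spacing condition through its second term, so the first bounds their relative
    distance and [cluster_sum] applies to each piece. *)
Lemma window_block_sum C : 0 < C -> exists2 C', 0 < C' &
  forall f P c C1 A, (forall p, P p -> prime p) -> 1 <= c ->
  (forall p, P p -> `|f p| <= C1 / ln p%:R `^ c) ->
  (forall p1 p2, P p1 -> P p2 -> (p1 < p2)%N ->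
       Num.min (gsup f P c p2%:R * (p2%:R - p1%:R) / (p2%:R * ln p2%:R))
               (gsup f P c (p2%:R `^ A))
         <= C * `|f p2 - f p1|) ->
  forall j d, 0 < d -> d <= gsup f P c (dexp j.+1)%:R ->
  (forall p, P p -> (p < dexp j.+1)%N -> d <= gsup f P c (p%:R `^ A)) ->
  forall u, \sum_(p <- block (fun p => `[< P p >]) j j.+1) p%:R^-1 * win u d (f p) <=
    C' * (d / gsup f P c (dexp j.+1)%:R + (dexp j.-1)%:R^-1).
Proof.
move=> C0; exists (1800 * ((4 * C + 1) * 2)); first by lra.
move=> f P c C1 A hP c1 hf gap j d d0 dg dA u.
set E : R := (dexp j.-1)%:R^-1; set g := gsup f P c (dexp j.+1)%:R in dg *.
have g0 : 0 < g by apply: lt_le_trans dg.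
set lam := d / g; set k : R := 2 ^+ j.+1; set y := lam * k.
have lam0 : 0 < lam by rewrite divr_gt0.
have k0 : 0 < k by rewrite exprn_gt0.
have k1 : 1 <= k by rewrite exprn_ege1 //; lra.
have y0 : 0 < y by rewrite mulr_gt0.
have gy : g * y = d * k by rewrite /y mulrA; congr (_ * _); rewrite /lam mulrC divfK // gt_eqF.
have lamE : lam = y / k by rewrite /y mulfK // gt_eqF.
clearbody y lam.
have y1 : 1 + y != 0 by rewrite gt_eqF //; lra.
have k'0 : k != 0 by rewrite gt_eqF.
have E0 : 0 < E by rewrite invr_gt0 ltr0n expn_gt0.
have E1 : E <= 1 by rewrite invf_le1 ?ltr0n ?ler1n expn_gt0.
(* [T] fixes the number of pieces. Its summand 1 ensures C h < d; its summand [y] keeps the relative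
   gap C h 2^(j+1) / g below [theta], itself at most 1/4. *)
set T := 4 * C * (1 + y).
have T0 : 0 < T by rewrite !mulr_gt0 //; lra.
set n := Num.truncn T.
have nT : T < n.+1%:R by exact: truncnS_gt.
have nT2 : n%:R <= T by rewrite truncn_le ltW.
clearbody n.
have n0 : (0 : R) < n.+1%:R by rewrite ltr0n.
set h := d / n.+1%:R.
have h0 : 0 < h by rewrite divr_gt0.
have dE : d = n.+1%:R * h by rewrite /h mulrC divfK // gt_eqF.
set theta := y / (4 * (1 + y)).
have th0 : 0 <= theta by rewrite divr_ge0 //; lra.
have th1 : theta <= 4^-1 by rewrite ler_pdivrMr; lra.
set s := block _ _ _.
have piece v : \sum_(p <- s) p%:R^-1 * win v h (f p) <= 900 * (theta + E) / 2 ^+ j.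
  have -> : \sum_(p <- s) p%:R^-1 * win v h (f p) =
     \sum_(p <- [seq p <- s | v <= f p <= v + h]) p%:R^-1.
    rewrite [RHS]big_filter [RHS]big_mkcond; apply: eq_bigr => p _.
    by rewrite /win; case: ifP; rewrite ?mulr1 ?mulr0.
  have th : 0 <= theta <= 4^-1 by apply/andP; split.
  apply: cluster_sum => //.
  - by rewrite filter_uniq // /s /block filter_uniq // uniq_primes_in.
  - by move=> p; rewrite mem_filter /s mem_block => /andP[_ /and3P[_ -> /andP[-> _]]].
  move=> p q; rewrite [p \in _]mem_filter [q \in _]mem_filter /s !mem_block.
  move=> /andP[vp /and3P[/asboolP Pp pp _]] /andP[vq /and3P[/asboolP Pq pq /andP[_ qj]]] lpq.
  have q0 : (0 : R) < q%:R by rewrite ltr0n prime_gt0.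
  have lq0 : 0 < ln (q%:R : R) by rewrite ln_gt0 // ltr1n prime_gt1.
  have q1 : (1 : R) < q%:R by rewrite ltr1n prime_gt1.
  have Hgap := gap p q Pp Pq lpq.
  have D1 : C * `|f q - f p| <= C * h.
    by apply: ler_wpM2l; [exact: ltW|rewrite ler_norml; lra].
  have D2 : C * h < d.
    rewrite /h mulrA ltr_pdivrMr // mulrC ltr_pM2l //; apply: lt_trans nT.
    by rewrite /T; nra.
  have := le_trans Hgap D1; rewrite ge_min => /orP[]; last first.
    by have := dA _ Pq qj => H1 H2; lra.
  rewrite ler_pdivrMr ?mulr_gt0 // => H.
  have gq : g <= gsup f P c q%:R by apply: (gsup_mono hP c1 hf q1); rewrite ler_nat; exact: ltnW.
  have lq : ln q%:R <= k :> R.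
    apply: (@le_trans _ _ (ln (dexp j.+1)%:R)).
      have qj' : (q%:R : R) <= (dexp j.+1)%:R by rewrite ler_nat; exact: ltnW.
      by rewrite ler_ln // posrE; apply: lt_le_trans qj'.
    by rewrite ln_dexp; apply: ler_piMr; [exact: ltW|exact: ln2_le].
  have pq0 : (0 : R) <= q%:R - p%:R by rewrite subr_ge0 ler_nat ltnW.
  rewrite -(ler_pM2l g0); apply: (@le_trans _ _ (C * h * (q%:R * k))).
    apply: (@le_trans _ _ (gsup f P c q%:R * (q%:R - p%:R))); first by rewrite ler_wpM2r.
    apply: (le_trans H); apply: ler_wpM2l; first by rewrite mulr_ge0 // ltW.
    by rewrite ler_wpM2l // ltW.
  have Ch : C * h * (4 * (1 + y)) <= d.
    have -> : C * h * (4 * (1 + y)) = T * h by rewrite /T; ring.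
    by rewrite dE; apply: ler_wpM2r; exact: ltW.
  have -> : g * (theta * q%:R) = d * (q%:R * k) / (4 * (1 + y)).
    have -> : d * (q%:R * k) = g * y * q%:R by rewrite gy; ring.
    by rewrite /theta; field.
  rewrite ler_pdivlMr; last by lra.
  by rewrite mulrAC; apply: ler_wpM2r => //; rewrite mulr_ge0 // ltW.
apply: (@le_trans _ _ (\sum_(0 <= i < n.+1) \sum_(p <- s) p%:R^-1 * win (u + i%:R * h) h (f p))).
  rewrite exchange_big /=; apply: ler_sum => p _; rewrite -big_distrr /=.
  by apply: ler_wpM2l; rewrite ?invr_ge0 // {1}dE; apply: win_split; exact: ltW.
apply: (@le_trans _ _ (\sum_(0 <= i < n.+1) (900 * (theta + E) / 2 ^+ j))).
  by apply: ler_sum => i _; exact: piece.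
rewrite sumr_const_nat subn0 -[_ *+ n.+1]mulr_natl.
apply: (@le_trans _ _ ((T + 1) * (900 * (theta + E) / 2 ^+ j))).
  apply: ler_wpM2r; last by rewrite -[n.+1]addn1 natrD lerD2r.
  apply: divr_ge0; last by apply: exprn_ge0; exact: ler0n.
  by apply: mulr_ge0; [exact: ler0n|exact: ltW (ltr_wpDl th0 E0)].
have -> : 900 * (theta + E) / 2 ^+ j = 1800 * (theta + E) / k.
  by rewrite /k exprS; field; rewrite expf_neq0.
have T1 : T + 1 <= (4 * C + 1) * (1 + y) by rewrite /T; lra.
have X0 : 0 <= 1800 * (theta + E) / k.
  apply: divr_ge0; last exact: ltW.
  by apply: mulr_ge0; [exact: ler0n|exact: ltW (ltr_wpDl th0 E0)].
apply: (le_trans (ler_wpM2r X0 T1)).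
(* Cutting into about 1 + y pieces costs nothing in the main term, as (1 + y) theta = y / 4 and y /
   k = d / g. *)
have -> : (4 * C + 1) * (1 + y) * (1800 * (theta + E) / k) =
   1800 * (4 * C + 1) * (lam / 4 + E / k + E * lam).
  by rewrite /theta lamE; field; rewrite y1 k'0.
have Ek : E / k <= E by rewrite ler_pdivrMr // ler_peMr // ltW.
have El : E * lam <= lam by rewrite ler_piMl // ltW.
rewrite -mulrA -[leRHS]mulrA; apply: ler_wpM2l; first exact: ler0n.
by rewrite -[leRHS]mulrA; apply: ler_wpM2l; lra.
Qed.

End BlockWindow.
(** * Concentration of the squarefree model *)

Section SmallWindows.
Variable R : realType.
Implicit Types (f : nat -> R) (P : set nat) (c A C d u : R).

Definition spaced f P c A C := forall p1 p2 : nat, P p1 -> P p2 -> (p1 < p2)%N ->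
  Num.min (gsup f P c p2%:R * (p2%:R - p1%:R) / (p2%:R * ln p2%:R))
          (gsup f P c (p2%:R `^ A)) <= C * `|f p2 - f p1|.

Definition sblock P := block (fun p => `[< P p >]).

Lemma mass_sblock_le : exists2 Cm : R, 1 <= Cm & forall P i j, (i <= j)%N ->
  mass R (sblock P i j) <= Cm * 2 ^+ (j - i).
Proof.
have [Cm Cm1 H] := mass_blocks_le R; exists Cm => // P i j ij.
exact: le_trans (mass_filter_le _ _ _) (H i j ij).
Qed.

Lemma sfsum_win_le_mass f s u d : sfsum f s (win u d) <= mass R s.
Proof.
rewrite -[leRHS]mulr1 -(sfsum_cst f); apply: sfsum_le => v.
by rewrite /win; case: ifP.
Qed.

Lemma sum_sq_geom n : \sum_(0 <= l < n) l%:R ^+ 2 / 2 ^+ l <= 6 :> R.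
Proof.
suff -> : \sum_(0 <= l < n) l%:R ^+ 2 / 2 ^+ l =
    6 - 2 * (n%:R ^+ 2 + 2 * n%:R + 3) / 2 ^+ n :> R.
  by rewrite gerBl divr_ge0 ?exprn_ge0 // mulr_ge0 // !addr_ge0 ?mulr_ge0 ?exprn_ge0.
elim: n => [|n IH]; first by rewrite big_nil expr0; lra.
rewrite big_nat_recr //= IH -[n.+1]addn1 natrD exprD expr1.
have : (2 : R) ^+ n != 0 by rewrite expf_neq0.
by move: (2 ^+ n) => x x0; field.
Qed.

Lemma half_powR_le c : 1 <= c -> 2^-1 `^ c <= 2^-1 :> R.
Proof. by move=> c1; apply: ge1r_powR => //; lra. Qed.

(* [gsup] at level [K] dominates the second term of the spacing condition for
   all primes of level at most [K - a] when [A <= 2 ^ a]. *)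
Lemma window_sblock_sum C : 0 < C -> exists2 C' : R, 0 < C' &
  forall f P c C1 A a, (forall p, P p -> prime p) -> 1 <= c ->
  (forall p, P p -> `|f p| <= C1 / ln p%:R `^ c) ->
  1 <= A <= 2 ^+ a -> spaced f P c A C ->
  forall k K d, (k.+1 + a <= K)%N -> 0 < d -> d <= gsup f P c (dexp K)%:R ->
  forall u, \sum_(p <- sblock P k k.+1) p%:R^-1 * win u d (f p) <=
    C' * ((2^-1 `^ c) ^+ (K - k.+1) + (dexp k.-1)%:R^-1).
Proof.
move=> C0; have [C' C'0 H] := window_block_sum C0; exists C' => //.
move=> f P c C1 A a hP c1 hf /andP[A1 Aa] gap k K d kK d0 dK u.
have kK' : (k.+1 <= K)%N by apply: leq_trans kK; rewrite leq_addr.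
have dk : d <= gsup f P c (dexp k.+1)%:R.
  apply: (le_trans dK); apply: (gsup_mono hP c1 hf); first exact: dexp_gt1.
  by rewrite ler_nat dexp_mono.
have g0 : 0 < gsup f P c (dexp k.+1)%:R by apply: lt_le_trans dk.
apply: (le_trans (H _ _ _ _ _ hP c1 hf gap k d d0 dk _ u)); last first.
  apply: ler_wpM2l; first exact: ltW.
  rewrite lerD2r ler_pdivrMr //; apply: (le_trans dK).
  by rewrite mulrC; exact: (gsup_dexp hP hf).
move=> p Pp pk; apply: (le_trans dK).
have p1 : 1 < p%:R :> R by rewrite ltr1n prime_gt1 // hP.
have pA : p%:R <= p%:R `^ A by apply: le1r_powR => //; exact: ltW.
apply: (gsup_mono hP c1 hf); first by apply: lt_le_trans pA.
have A0 : 0 <= A by apply: le_trans A1.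
apply: (@le_trans _ _ ((dexp k.+1)%:R `^ A)).
  by apply: (ge0_ler_powR A0); rewrite ?nnegrE ?ler0n // ler_nat ltnW.
apply: (@le_trans _ _ ((dexp k.+1)%:R `^ (2 ^+ a))).
  by apply: ler_powR => //; rewrite ltW // dexp_gt1.
rewrite -natrX powR_mulrn // -natrX ler_nat /dexp -expnM -expnD.
by rewrite leq_exp2l // leq_exp2l.
Qed.

Lemma lt8_exp2 n : (6 <= n)%N -> (8 * n < 2 ^ n)%N.
Proof.
elim: n => // n IHn; rewrite leq_eqVlt => /orP[/eqP <- //|].
by rewrite ltnS => n6; rewrite expnS; have := IHn n6; lia.
Qed.

(** The cut-off level: 4 n <= 2^i makes the sieve error from level [i] on at most 2^(-2n), and 2^i
    <= 8 n keeps the mass below level [i] linear in [n]. *)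
Lemma exp2_between n : (0 < n)%N ->
  exists i, [/\ (4 * n <= 2 ^ i)%N, (2 ^ i <= 8 * n)%N & (0 < i)%N].
Proof.
move=> n0; have n4 : (1 < 4 * n)%N by lia.
have i0 : (0 < up_log 2 (4 * n))%N by rewrite up_log_gt0; lia.
exists (up_log 2 (4 * n)); split => //; first exact: up_logP.
have /andP[H _] := @up_log_bounds 2 (4 * n) isT n4.
by move: H i0; case: (up_log _ _) => // i; rewrite expnS /=; lia.
Qed.

Lemma inv_dexp_le (i k i' : nat) : (4 * i <= 2 ^ i')%N -> (i' <= k)%N -> (0 < i)%N ->
  (dexp k.-1)%:R^-1 <= (2 ^+ (2 * i))^-1 :> R.
Proof.
move=> ii ik i0; rewrite -natrX lef_pV2 ?posrE ?ltr0n ?expn_gt0 // ler_nat.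
rewrite leq_exp2l //.
have k0 : (0 < k)%N.
  by rewrite lt0n; apply/eqP => k0; move: ik ii; rewrite k0 leqn0 => /eqP ->; lia.
have : (4 * i <= 2 * 2 ^ k.-1)%N.
  by rewrite -expnS prednK // (leq_trans ii) // leq_exp2l.
by lia.
Qed.

(** Strong induction with a cut at [i'] of about log2 i. The part below [i'] gets the trivial bound
    by its mass, O(i), and each block beyond contributes O(i (2^(i-K) + 2^-i)). The induction
    carries the partial sum of l^2 / 2^l: each round adds the term of its own level, and the series
    is at most 6. *)
Lemma sfsum_small_window C (a : nat) : 0 < C -> exists2 D : R, 1 <= D &
  forall f P c C1 A, (forall p, P p -> prime p) -> 1 <= c ->
  (forall p, P p -> `|f p| <= C1 / ln p%:R `^ c) ->
  1 <= A <= 2 ^+ a -> spaced f P c A C ->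
  forall i K d u, (i + a <= K)%N -> 0 < d -> d <= gsup f P c (dexp K)%:R ->
  sfsum f (sblock P 0 i) (win u d) <= D * (1 + i%:R ^+ 2 * 2 ^+ i / 2 ^+ K).
Proof.
move=> C0; have [C' C'0 HW] := window_sblock_sum C0.
have [Cm Cm1 Hm] := mass_sblock_le.
set Q := 16 * Cm ^+ 2 * C'.
have Q0 : 0 <= Q by rewrite !mulr_ge0 ?exprn_ge0 //; lra.
exists (64 * Cm + 6 * Q); first by lra.
move=> f P c C1 A hP c1 hf hA gap i K d u.
suff main : (i + a <= K)%N -> 0 < d -> d <= gsup f P c (dexp K)%:R ->
  sfsum f (sblock P 0 i) (win u d) <=
  64 * Cm + Q * (\sum_(0 <= l < i.+1) l%:R ^+ 2 / 2 ^+ l) + 2 * Q * (i%:R ^+ 2 * 2 ^+ i / 2 ^+ K).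
  move=> iK d0 dK; apply: (le_trans (main iK d0 dK)).
  have := ler_wpM2l Q0 (sum_sq_geom i.+1).
  have : 0 <= i%:R ^+ 2 * 2 ^+ i / 2 ^+ K :> R.
    by rewrite divr_ge0 ?mulr_ge0 ?exprn_ge0.
  move: (_ / _) (\sum_(_ <= _ < _) _) => x y x0.
  have : 0 <= Cm * x by apply: mulr_ge0 => //; lra.
  have : 0 <= Q * x by apply: mulr_ge0.
  lra.
elim/ltn_ind: i u => i IH u iK d0 dK.
have pos l : 0 <= l%:R ^+ 2 / 2 ^+ l :> R by rewrite divr_ge0 ?exprn_ge0.
have pos2 : 0 <= i%:R ^+ 2 * 2 ^+ i / 2 ^+ K :> R.
  by rewrite divr_ge0 ?mulr_ge0 ?exprn_ge0.
(* The descent to [i' < i] uses 8 i < 2^i, valid from 6 on; below, the mass is at most 64 Cm. *)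
case: (ltnP i 6) => i6.
  apply: (le_trans (sfsum_win_le_mass _ _ _ _)); apply: (le_trans (Hm _ _ _ (leq0n i))).
  rewrite subn0.
  have i6' : 2 ^+ i <= 64 :> R.
    by rewrite -[64]/((2 ^ 6)%N%:R) -natrX ler_nat leq_exp2l // ltnW.
  have X : Cm * 2 ^+ i <= Cm * 64 by apply: ler_wpM2l => //; lra.
  have Y : 0 <= Q * (\sum_(0 <= l < i.+1) l%:R ^+ 2 / 2 ^+ l).
    by rewrite mulr_ge0 // sumr_ge0.
  have Z : 0 <= 2 * Q * (i%:R ^+ 2 * 2 ^+ i / 2 ^+ K).
    by apply: mulr_ge0 => //; apply: mulr_ge0.
  lra.
have i0 : (0 < i)%N by apply: leq_trans i6.
have [i' [i'1 i'2 _]] := exp2_between i0.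
have ii' : (i' < i)%N.
  rewrite -(ltn_exp2l _ _ (ltnSn 1)); apply: (leq_ltn_trans i'2).
  exact: lt8_exp2.
have split : sblock P 0 i = sblock P 0 i' ++ sblock P i' i.
  by apply: block_cat => //; exact: ltnW.
pose W k := C' * ((2^-1 `^ c) ^+ (K - k.+1) + (dexp k.-1)%:R^-1).
have rec := @sfsum_win_blocks R f (fun p => `[< P p >]) (sblock P 0 i') i' i d
  (fun k => gsup f P c (dexp k)%:R) W (fun=> Cm * 2 ^+ i') (ltnW ii').
have {}rec : sfsum f (sblock P 0 i' ++ sblock P i' i) (win u d) <=
    sfsum f (sblock P 0 i') (win u d) +
    \sum_(i' <= k < i) mass R (sblock P k i) * W k * (Cm * 2 ^+ i').
  apply: rec.
  - move=> k _; rewrite mulr_ge0 ?addr_ge0 ?exprn_ge0 ?powR_ge0 ?invr_ge0 //; exact: ltW.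
  - move=> k _ p; rewrite mem_block => /and3P[/asboolP Pp _ /andP[kp _]].
    by apply: (norm_le_gsup hP c1 hf); rewrite ?dexp_gt1 // ler_nat.
  - move=> k v /andP[_ ki]; apply: (HW _ _ _ _ _ _ hP c1 hf hA gap k K d) => //.
    by apply: leq_trans iK; rewrite leq_add2r.
  - move=> k v _; apply: (le_trans (sfsum_win_le_mass _ _ _ _)).
    by have := Hm P 0 i' (leq0n _); rewrite subn0.
rewrite split; apply: (le_trans rec).
have i'K : (i' + a <= K)%N by apply: leq_trans iK; rewrite leq_add2r ltnW.
apply: (le_trans (lerD (IH _ ii' u i'K d0 dK) (lexx _))).
have iR : (0 : R) <= i%:R by [].
have K0 : 0 < (2 : R) ^+ K by rewrite exprn_gt0.
have I0 : 0 < (2 : R) ^+ i by rewrite exprn_gt0.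
have term k : (i' <= k < i)%N -> mass R (sblock P k i) * W k * (Cm * 2 ^+ i') <=
    Q / 2 * i%:R * (2 * (2 ^+ i / 2 ^+ K) + (2 ^+ i)^-1).
  move=> /andP[ik ki].
  have kK : (k < K)%N by apply: leq_trans iK; apply: leq_trans ki _; rewrite leq_addr.
  have B : Cm * 2 ^+ i' <= Cm * (8 * i%:R).
    apply: ler_wpM2l; first by lra.
    by rewrite -natrX -natrM ler_nat.
  have k0 : 0 < (2 : R) ^+ k by rewrite exprn_gt0.
  have Wk : W k <= C' * (2 * (2 ^+ k / 2 ^+ K) + (2 ^+ (2 * i))^-1).
    apply: ler_wpM2l; first exact: ltW.
    apply: lerD; last exact: inv_dexp_le i'1 ik i0.
    apply: (@le_trans _ _ (2^-1 ^+ (K - k.+1))).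
      by apply: lerXn2r; rewrite ?nnegrE ?powR_ge0 ?invr_ge0 // half_powR_le.
    rewrite -{2}(subnK kK) exprD exprS exprVn.
    have K1 : (2 : R) ^+ (K - k.+1) != 0 by rewrite expf_neq0.
    by rewrite le_eqVlt; apply/orP; left; apply/eqP; field; rewrite K1 gt_eqF.
  have mk := Hm P k i (ltnW ki).
  have m1 := mass_ge1 R (sblock P k i).
  have Wk0 : 0 <= W k.
    by rewrite mulr_ge0 ?addr_ge0 ?exprn_ge0 ?powR_ge0 ?invr_ge0 //; exact: ltW.
  have Bk0 : 0 <= Cm * 2 ^+ i' by rewrite mulr_ge0 ?exprn_ge0 //; lra.
  apply: (@le_trans _ _ ((Cm * 2 ^+ (i - k)) *
     (C' * (2 * (2 ^+ k / 2 ^+ K) + (2 ^+ (2 * i))^-1)) * (Cm * (8 * i%:R)))).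
    apply: ler_pM => //; first by rewrite mulr_ge0 //; lra.
    by apply: ler_pM => //; lra.
  have ki2 : 2 ^+ (i - k) = 2 ^+ i / 2 ^+ k :> R.
    by rewrite -{2}(subnK (ltnW ki)) exprD mulfK // gt_eqF.
  have k1 : (1 : R) <= 2 ^+ k by rewrite exprn_ege1 //; lra.
  have -> : Cm * 2 ^+ (i - k) * (C' * (2 * (2 ^+ k / 2 ^+ K) + (2 ^+ (2 * i))^-1)) * (Cm * (8 * i%:R)) =
    Q / 2 * i%:R * (2 * (2 ^+ i / 2 ^+ K) + (2 ^+ i)^-1 / 2 ^+ k).
    rewrite ki2 mulnC exprM /Q; field; by rewrite !gt_eqF.
  apply: ler_wpM2l; first by rewrite mulr_ge0 // divr_ge0.
  by rewrite lerD2l ler_pdivrMr // ler_peMr // invr_ge0 ltW.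
have tot : \sum_(i' <= k < i) mass R (sblock P k i) * W k * (Cm * 2 ^+ i') <=
   Q * (i%:R ^+ 2 * 2 ^+ i / 2 ^+ K) + Q * (i%:R ^+ 2 / 2 ^+ i).
  apply: (@le_trans _ _ (\sum_(i' <= k < i) (Q / 2 * i%:R * (2 * (2 ^+ i / 2 ^+ K) + (2 ^+ i)^-1)))).
    rewrite big_nat_cond [leRHS]big_nat_cond; apply: ler_sum => k.
    by rewrite andbT; exact: term.
  set X := Q / 2 * i%:R * _.
  have X0 : 0 <= X.
    apply: mulr_ge0; first by rewrite mulr_ge0 // divr_ge0.
    by rewrite addr_ge0 ?mulr_ge0 ?invr_ge0 // ltW.
  rewrite sumr_const_nat -[X *+ _]mulr_natl.
  apply: (@le_trans _ _ (i%:R * X)); first by rewrite ler_wpM2r // ler_nat leq_subr.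
  have Y0 : 0 <= Q * (i%:R ^+ 2 / 2 ^+ i) by apply: mulr_ge0.
  have -> : i%:R * X = Q * (i%:R ^+ 2 * 2 ^+ i / 2 ^+ K) + Q * (i%:R ^+ 2 / 2 ^+ i) / 2.
    by rewrite /X; field; rewrite !gt_eqF.
  by rewrite lerD2l ler_pdivrMr // ler_peMr //; lra.
apply: (le_trans (lerD (lexx _) tot)).
have sum1 : \sum_(0 <= l < i'.+1) l%:R ^+ 2 / 2 ^+ l + i%:R ^+ 2 / 2 ^+ i <=
     \sum_(0 <= l < i.+1) l%:R ^+ 2 / 2 ^+ l :> R.
  rewrite [leRHS]big_nat_recr //= lerD2r.
  rewrite [leRHS](big_cat_nat (leq0n i'.+1) ii') /= lerDl.
  by apply: sumr_ge0.
(* This error at least doubles from [i'] to [i], so the coefficient 2 Q reproduces itself: half for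
   the previous rounds, half for this one. *)
have sq1 : 2 * (i'%:R ^+ 2 * 2 ^+ i' / 2 ^+ K) <= i%:R ^+ 2 * 2 ^+ i / 2 ^+ K :> R.
  rewrite mulrA ler_pM2r ?invr_gt0 //.
  rewrite mulrCA -exprS; apply: ler_pM; rewrite ?exprn_ge0 //.
    by rewrite lerXn2r ?nnegrE // ler_nat ltnW.
  by rewrite ler_weXn2l //; lra.
have H1 := ler_wpM2l Q0 sum1.
have H2 := ler_wpM2l Q0 sq1.
lra.
Qed.

End SmallWindows.

(** * The geometric loss factor *)

Section LargeWindow.
Variable R : realType.
Implicit Types (f : nat -> R) (P : set nat) (c A C D N d u x : R).

(** The first l + 1 terms are all at least x^l. This converts a single term into a small share of
    the whole sum, uniformly in [x]. *)
Lemma geom_term x (l J : nat) : 0 <= x <= 1 -> (l < J)%N ->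
  l.+1%:R * x ^+ l <= \sum_(0 <= m < J) x ^+ m.
Proof.
move=> /andP[x0 x1] lJ.
rewrite (big_cat_nat (leq0n l.+1) lJ) /=.
rewrite -[leLHS]addr0; apply: lerD; last by apply: sumr_ge0 => m _; exact: exprn_ge0.
rewrite mulr_natl -{1}[l.+1]subn0 -sumr_const_nat.
apply: ler_sum_nat => m /andP[_ ml].
by rewrite ler_wiXn2l.
Qed.

Lemma sum_lin_geom i n : (i <= n)%N ->
  \sum_(i <= k < n) k.+1%:R / 2 ^+ k <= (2 * i%:R + 4) / 2 ^+ i :> R.
Proof.
move=> iN.
suff -> : \sum_(i <= k < n) k.+1%:R / 2 ^+ k =
    (2 * i%:R + 4) / 2 ^+ i - (2 * n%:R + 4) / 2 ^+ n :> R.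
  by rewrite gerBl divr_ge0 ?exprn_ge0 // addr_ge0 ?mulr_ge0.
elim: n iN => [|n IH]; first by rewrite leqn0 => /eqP ->; rewrite big_nil subrr.
rewrite leq_eqVlt => /orP[/eqP ->|]; first by rewrite big_geq // subrr.
rewrite ltnS => iN; rewrite big_nat_recr //= IH // -[n.+1]addn1 natrD exprD expr1.
have : (2 : R) ^+ n != 0 by rewrite expf_neq0.
have : (2 : R) ^+ i != 0 by rewrite expf_neq0.
by move: (2 ^+ n) (2 ^+ i) => y z z0 y0; field; rewrite ?y0 ?z0.
Qed.

Lemma exp2_dominates (a J : nat) : (2 * a + 8 <= J)%N -> (8 * J * 2 ^ a <= 2 ^ J)%N.
Proof.
elim: J => [|J IH]; first by lia.
rewrite leq_eqVlt => /orP[/eqP <-|].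
  have -> : (2 * a + 8 = a + a + 8)%N by lia.
  rewrite !expnD; have : (a + 4 <= 4 * 2 ^ a)%N.
    by elim: a {IH} => [//|a IHa]; rewrite expnS; lia.
  by rewrite -[(2 ^ 8)%N]/(256)%N; move: (2 ^ a)%N => y; nia.
rewrite ltnS => aJ; rewrite expnS; have := IH aJ.
by move: (2 ^ a)%N (2 ^ J)%N => y z; nia.
Qed.

Lemma cube_le_exp2 i : (i ^ 3 <= 4 * 2 ^ i)%N.
Proof.
case: (ltnP i 5) => [|i5]; first by case: i => [|[|[|[|[|]]]]].
elim: i i5 => // i IH; rewrite leq_eqVlt => /orP[/eqP <- //|].
rewrite ltnS => i5; rewrite expnS; have := IH i5.
by move: (2 ^ i)%N => y; rewrite !expnS expn0; nia.
Qed.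

Lemma sq_le_exp2 l : l%:R ^+ 2 <= 6 * 2 ^+ l :> R.
Proof.
have l0 : (0 : R) < 2 ^+ l by rewrite exprn_gt0.
rewrite -ler_pdivrMr //; apply: le_trans (sum_sq_geom R l.+1).
rewrite big_nat_recr //= lerDr; apply: sumr_ge0 => i _.
by rewrite divr_ge0 ?exprn_ge0.
Qed.

(** In [sfsum_large_window] these bound in turn the part without primes beyond the cut-off, the
    excess of [sfsum_small_window] over a constant, and the sieve errors. *)
Lemma level_bounds (i J : nat) : (0 < i)%N -> (0 < J)%N -> (2 ^ i <= 8 * J)%N ->
  [/\ i%:R ^+ 2 * 2 ^+ i <= 2304 * 2 ^+ J :> R,
      4 * (i%:R ^+ 3 + 2 * i%:R ^+ 2) <= 384 * J%:R :> R &
      J%:R * (1 + i%:R ^+ 2) <= 294 * 2 ^+ J :> R].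
Proof.
move=> i0 J0 i2.
have i2R : 2 ^+ i <= 8 * J%:R :> R by rewrite -natrX -natrM ler_nat.
have iR : (1 : R) <= i%:R by rewrite ler1n.
have JR : (1 : R) <= J%:R by rewrite ler1n.
have sqJ : J%:R ^+ 2 <= 6 * 2 ^+ J :> R by exact: (sq_le_exp2 J).
have sqi : i%:R ^+ 2 <= 48 * J%:R :> R.
  by apply: (le_trans (sq_le_exp2 i)); lra.
have cubi : i%:R ^+ 3 <= 32 * J%:R :> R.
  apply: (@le_trans _ _ (4 * 2 ^+ i)); last by lra.
  by rewrite -natrX -natrX -natrM ler_nat cube_le_exp2.
have sqcub : i%:R ^+ 2 <= i%:R ^+ 3 :> R by rewrite ler_weXn2l.
split; last 2 first.
- by lra.
- have H : J%:R * (1 + i%:R ^+ 2) <= J%:R * (49 * J%:R) :> R by apply: ler_wpM2l; lra.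
  apply: (le_trans H).
  have -> : J%:R * (49 * J%:R) = 49 * J%:R ^+ 2 :> R by ring.
  by lra.
have H : i%:R ^+ 2 * 2 ^+ i <= (48 * J%:R) * (8 * J%:R) :> R.
  by apply: ler_pM => //; exact: exprn_ge0.
apply: (le_trans H).
have -> : 48 * J%:R * (8 * J%:R) = 384 * J%:R ^+ 2 :> R by ring.
by lra.
Qed.

Lemma win_le_mono u d1 d2 x : d1 <= d2 -> win u d1 x <= win u d2 x.
Proof.
move=> d12; rewrite /win; case: ifP => [H|_]; last by case: ifP.
by rewrite ifT //; lra.
Qed.

Definition large_const D N : R := 2305 * D + N * (2 + 384 + 294).

Lemma large_const_ge0 D N : 1 <= D -> 0 <= N -> 0 <= large_const D N.
Proof. by move=> D1 N0; rewrite /large_const; lra. Qed.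

(** [sfsum_win_blocks] is applied beyond a cut-off [i] of about log2 J. At block [k] the part below
    the cut-off has a window of length O(g (dexp k)), for which [sfsum_small_window] costs 1 + q
    with q = i^2 2^i / 2^k. *)
Lemma sfsum_large_window C (a : nat) : 0 < C -> exists2 D : R, 1 <= D &
  forall f P c C1 A, (forall p, P p -> prime p) -> 1 <= c ->
  (forall p, P p -> `|f p| <= C1 / ln p%:R `^ c) ->
  1 <= A <= 2 ^+ a -> spaced f P c A C ->
  forall J d u, (0 < J)%N -> 0 < d -> d <= gsup f P c (dexp (J + a))%:R ->
  sfsum f (sblock P 0 J) (win u d) <=
    D * \sum_(0 <= l < J) (2 * 2^-1 `^ c) ^+ l.
Proof.
move=> C0; have [C' C'0 HW] := window_sblock_sum C0.
have [Cm Cm1 Hm] := mass_sblock_le R.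
have [D D1 HD] := sfsum_small_window a C0.
set N := 3 * Cm * C' * D.
have N0 : 0 <= N by rewrite !mulr_ge0 //; lra.
have K00 := large_const_ge0 D1 N0.
have M0 : 1 <= Cm * 2 ^+ (2 * a + 8).
  have : 1 <= (2 : R) ^+ (2 * a + 8) by rewrite exprn_ege1 //; lra.
  by nra.
have [E [E1 EK EM]] : exists E : R,
    [/\ 1 <= E, Cm * 2 ^+ a * large_const D N <= E & Cm * 2 ^+ (2 * a + 8) <= E].
  have X0 : 0 <= Cm * 2 ^+ a * large_const D N.
    by apply: mulr_ge0 => //; apply: mulr_ge0; [lra|exact: exprn_ge0].
  by exists (Cm * 2 ^+ a * large_const D N + Cm * 2 ^+ (2 * a + 8)); split; lra.
clear M0; exists E => //.
move=> f P c C1 A hP c1 hf hA gap J d u J0 d0 dK.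
have half_le1 : 2^-1 <= 1 :> R by lra.
set r := 2^-1 `^ c; set x := 2 * r.
have r0 : 0 <= r by exact: powR_ge0.
have r1 : r <= 2^-1 by exact: half_powR_le.
have x0 : 0 <= x by rewrite /x; lra.
have x1 : x <= 1 by rewrite /x; lra.
set Sc := \sum_(_ <= _ < _) _.
have Sc1 : 1 <= Sc.
  have hx : 0 <= x <= 1 by rewrite x0.
  by have := geom_term hx J0; rewrite expr0 mulr1.
case: (ltnP J (2 * a + 8)) => Ja.
  apply: (le_trans (sfsum_win_le_mass _ _ _ _)); apply: (le_trans (Hm _ _ _ (leq0n J))).
  rewrite subn0; apply: (@le_trans _ _ (Cm * 2 ^+ (2 * a + 8))).
    apply: ler_wpM2l; first by lra.
    by apply: ler_weXn2l; [lra|exact: ltnW].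
  apply: (le_trans EM); apply: ler_peMr => //; exact: le_trans E1.
have [i [i1 i2 i0]] := exp2_between J0.
have iaJ : (i + a <= J)%N.
  rewrite -(@leq_exp2l 2) // expnD; apply: leq_trans (exp2_dominates Ja).
  by rewrite leq_mul2r i2 orbT.
have JR : (1 : R) <= J%:R by rewrite ler1n.
have J2 : 0 < (2 : R) ^+ J by rewrite exprn_gt0.
have I2 : 0 < (2 : R) ^+ i by rewrite exprn_gt0.
have i2R : 2 ^+ i <= 8 * J%:R :> R by rewrite -natrX -natrM ler_nat.
have gmono k l : (k <= l)%N -> gsup f P c (dexp l)%:R <= gsup f P c (dexp k)%:R.
  move=> kl; apply: (gsup_mono hP c1 hf); first exact: dexp_gt1.
  by rewrite ler_nat dexp_mono.
have split : sblock P 0 J = sblock P 0 i ++ sblock P i (i + a) ++ sblock P (i + a) J.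
  rewrite -block_cat //; last exact: leq_addr.
  by rewrite -block_cat //; apply: leq_trans iaJ; exact: leq_addr.
set s := sblock P 0 i; set t := sblock P (i + a) J.
(* [sfsum_small_window] at level [i] requires k >= i + a, so the [a] blocks in between are frozen,
   at the price of their mass. *)
have skip B : (forall v, sfsum f (s ++ t) (win v d) <= B) ->
    sfsum f (sblock P 0 J) (win u d) <= Cm * 2 ^+ a * B.
  move=> HB; rewrite split -/s -/t sfsum_catC -catA sfsum_cat.
  have B0 : 0 <= B by apply: le_trans (HB 0); apply: sfsum_ge0 => v; exact: win_ge0.
  apply: (@le_trans _ _ (sfsum f (sblock P i (i + a)) (fun=> B))).
    apply: sfsum_le => v; rewrite sfsum_catC; apply: le_trans (HB (u - v)).
    by apply: sfsum_le => w; rewrite winD.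
  rewrite sfsum_cst; apply: ler_wpM2r => //.
  by have := Hm P i (i + a)%N (leq_addr _ _); rewrite addKn.
have Sc0 : 0 <= Sc by apply: le_trans Sc1.
suff main v : sfsum f (s ++ t) (win v d) <= large_const D N * Sc.
  apply: (le_trans (skip _ main)); rewrite mulrA; exact: ler_wpM2r.
clear skip E E1 EK EM K00.
have small k : (i + a <= k)%N -> (k <= J + a)%N ->
    forall w, sfsum f s (win w (gsup f P c (dexp k)%:R)) <= D * (1 + i%:R ^+ 2 * 2 ^+ i / 2 ^+ k).
  move=> ik kJ w; apply: (HD _ _ _ _ _ hP c1 hf hA gap) => //.
  by apply: lt_le_trans d0 _; apply: (le_trans dK); exact: gmono.
pose W k := C' * (r ^+ (J + a - k.+1) + (dexp k.-1)%:R^-1).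
have rec : sfsum f (s ++ t) (win v d) <=
    sfsum f s (win v d) +
    \sum_(i + a <= k < J) mass R (sblock P k J) * W k * (3 * (D * (1 + i%:R ^+ 2 * 2 ^+ i / 2 ^+ k))).
  apply: (@sfsum_win_blocks R f (fun p => `[< P p >]) s (i + a) J d
    (fun k => gsup f P c (dexp k)%:R) W _ iaJ).
  - move=> k _; rewrite mulr_ge0 ?addr_ge0 ?exprn_ge0 ?invr_ge0 //; exact: ltW.
  - move=> k _ p; rewrite mem_block => /and3P[/asboolP Pp _ /andP[kp _]].
    by apply: (norm_le_gsup hP c1 hf); rewrite ?dexp_gt1 // ler_nat.
  - move=> k w /andP[_ kJ]; apply: (HW _ _ _ _ _ _ hP c1 hf hA gap k (J + a)%N d) => //.
    by rewrite leq_add2r.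
  - move=> k w /andP[ik kJ]; set g := gsup _ _ _ _.
    have kJ' : (k <= J + a)%N by apply: leq_trans (ltnW kJ) (leq_addr _ _).
    have dg : d <= g by apply: (le_trans dK); exact: gmono.
    have g0 : 0 <= g by apply: ltW; apply: lt_le_trans dg.
    (* As d <= g, the widened window has length at most 3 g. *)
    apply: (@le_trans _ _ (sfsum f s (fun y => \sum_(0 <= l < 3) win (w + l%:R * g) g y))).
      apply: sfsum_le => y; apply: le_trans (win_split 2 _ _ g0).
      by apply: win_le_mono; lra.
    rewrite sfsum_sum; apply: (@le_trans _ _ (\sum_(0 <= l < 3) (D * (1 + i%:R ^+ 2 * 2 ^+ i / 2 ^+ k)))).
      by apply: ler_sum => l _; exact: small.
    by rewrite sumr_const_nat subn0 mulr_natl.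
apply: (le_trans rec).
have [lv1 lv2 lv3] := level_bounds i0 J0 i2.
have q0 k : 0 <= i%:R ^+ 2 * 2 ^+ i / 2 ^+ k :> R.
  by rewrite divr_ge0 ?mulr_ge0 ?exprn_ge0.
have first : sfsum f s (win v d) <= 2305 * D.
  have dJ : d <= gsup f P c (dexp J)%:R by apply: (le_trans dK); apply: gmono; exact: leq_addr.
  apply: (le_trans (HD _ _ _ _ _ hP c1 hf hA gap i J d v iaJ d0 dJ)).
  rewrite [leRHS]mulrC; apply: ler_wpM2l; first by lra.
  have -> : 2305 = 1 + 2304 :> R by rewrite -(natrD _ 1).
  by rewrite lerD2l ler_pdivrMr.
have term k : (i + a <= k < J)%N ->
    mass R (sblock P k J) * W k * (3 * (D * (1 + i%:R ^+ 2 * 2 ^+ i / 2 ^+ k))) <=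
    N * (2 * x ^+ (J - k.+1) + 2 * (i%:R ^+ 2 * 2 ^+ i * Sc / J%:R) * (k.+1%:R / 2 ^+ k)
         + (1 + i%:R ^+ 2) / 2 ^+ J).
  move=> /andP[iak kJ].
  have ik : (i <= k)%N by apply: leq_trans iak; exact: leq_addr.
  set q := i%:R ^+ 2 * 2 ^+ i / 2 ^+ k.
  set e := (J - k.+1)%N.
  have k0 : 0 < (2 : R) ^+ k by rewrite exprn_gt0.
  have k1 : 1 <= (2 : R) ^+ k by rewrite exprn_ege1 // ler1n.
  have Jke : (J - k = e.+1)%N by rewrite /e; clear -kJ; lia.
  have Wk : W k <= C' * (r ^+ e + (2 ^+ (2 * J))^-1).
    apply: ler_wpM2l; first exact: ltW.
    apply: lerD; last exact: inv_dexp_le i1 ik J0.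
    apply: ler_wiXn2l => //; first exact: le_trans r1 half_le1.
    by rewrite /e; clear -kJ; lia.
  have mk := Hm P k J (ltnW kJ); rewrite Jke in mk.
  have Wk0 : 0 <= W k.
    by rewrite mulr_ge0 ?addr_ge0 ?exprn_ge0 ?invr_ge0 //; exact: ltW.
  have m0 : 0 <= mass R (sblock P k J) by apply: le_trans (mass_ge1 _ _).
  have Dq0 : 0 <= 3 * (D * (1 + q)).
    apply: mulr_ge0 => //; apply: mulr_ge0; first exact: le_trans D1.
    by apply: addr_ge0 => //; exact: q0.
  have mW : mass R (sblock P k J) * W k <= Cm * 2 ^+ e.+1 * (C' * (r ^+ e + (2 ^+ (2 * J))^-1)).
    by apply: ler_pM.
  apply: (le_trans (ler_wpM2r Dq0 mW)).
  have -> : Cm * 2 ^+ e.+1 * (C' * (r ^+ e + (2 ^+ (2 * J))^-1)) * (3 * (D * (1 + q))) =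
     N * ((2 * x ^+ e + 2 ^+ e.+1 / 2 ^+ (2 * J)) * (1 + q)).
    by rewrite /N /x exprMn exprS; ring.
  apply: ler_wpM2l => //.
  (* Near the cut-off [q] may be as large as i^2, but there x^e is a small share of [Sc]: J <=
     (k+1)(e+1) together with [geom_term]. *)
  have xe : J%:R * x ^+ e <= k.+1%:R * Sc.
    have hx : 0 <= x <= 1 by rewrite x0.
    have eJ : (e < J)%N by rewrite /e; clear -kJ; lia.
    have := ler_wpM2l (ler0n R k.+1) (geom_term hx eJ); rewrite -/Sc.
    apply: le_trans; rewrite mulrA; apply: ler_wpM2r; first exact: exprn_ge0.
    rewrite -natrM ler_nat -Jke; clear -kJ.
    by rewrite mulSn -{1}(subnK (ltnW kJ)) leq_add2l leq_pmulr // subn_gt0.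
  have xe2 : 2 * x ^+ e * q <= 2 * (i%:R ^+ 2 * 2 ^+ i * Sc / J%:R) * (k.+1%:R / 2 ^+ k).
    have JR0 : (0 : R) < J%:R by rewrite ltr0n.
    have -> : 2 * (i%:R ^+ 2 * 2 ^+ i * Sc / J%:R) * (k.+1%:R / 2 ^+ k) =
       2 * (k.+1%:R * Sc / J%:R) * q by rewrite /q; ring.
    apply: ler_wpM2r; first exact: q0.
    by rewrite ler_pM2l // ler_pdivlMr // mulrC.
  have small2 : 2 ^+ e.+1 / 2 ^+ (2 * J) * (1 + q) <= (1 + i%:R ^+ 2) / 2 ^+ J.
    have qi : q <= i%:R ^+ 2.
      rewrite /q ler_pdivrMr //; apply: ler_wpM2l; first exact: exprn_ge0.
      by apply: ler_weXn2l => //; rewrite ler1n.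
    have eJ : 2 ^+ e.+1 / 2 ^+ (2 * J) <= (2 ^+ J)^-1 :> R.
      rewrite ler_pdivrMr ?exprn_gt0 // mulnC exprM expr2 mulrA mulVf ?mul1r ?gt_eqF //.
      by apply: ler_weXn2l; [rewrite ler1n|rewrite -Jke leq_subr].
    have X0 : 0 <= 2 ^+ e.+1 / 2 ^+ (2 * J) :> R by apply: divr_ge0; exact: exprn_ge0.
    have q1 : 0 <= 1 + q by apply: addr_ge0 => //; exact: q0.
    by rewrite [leRHS]mulrC; apply: ler_pM => //; rewrite lerD2l.
  have -> : (2 * x ^+ e + 2 ^+ e.+1 / 2 ^+ (2 * J)) * (1 + q) =
    2 * x ^+ e + 2 * x ^+ e * q + 2 ^+ e.+1 / 2 ^+ (2 * J) * (1 + q) by ring.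
  by rewrite !lerD.
have iJ : (i <= J)%N by apply: leq_trans iaJ; exact: leq_addr.
have sumX : \sum_(i + a <= k < J) x ^+ (J - k.+1) <= Sc.
  apply: (@le_trans _ _ (\sum_(0 <= k < J) x ^+ (J - k.+1))).
    rewrite [leRHS](big_cat_nat (leq0n _) iaJ) /= lerDr.
    by apply: sumr_ge0 => k _; exact: exprn_ge0.
  rewrite big_nat_rev /= add0n le_eqVlt; apply/orP; left; apply/eqP.
  rewrite big_nat_cond [RHS]big_nat_cond; apply: eq_bigr => k /andP[/andP[_ kJ] _].
  by congr (x ^+ _); clear -kJ; lia.
have sumL : \sum_(i + a <= k < J) (k.+1%:R / 2 ^+ k) <= (2 * i%:R + 4) / 2 ^+ i :> R.
  apply: le_trans (sum_lin_geom iJ).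
  rewrite [leRHS](big_cat_nat (leq_addr a i) iaJ) /= lerDr.
  by apply: sumr_ge0 => k _; rewrite divr_ge0 ?exprn_ge0.
have tot : \sum_(i + a <= k < J) mass R (sblock P k J) * W k *
     (3 * (D * (1 + i%:R ^+ 2 * 2 ^+ i / 2 ^+ k))) <= N * ((2 + 384 + 294) * Sc).
  apply: (le_trans (ler_sum_nat term)).
  rewrite -big_distrr /=; apply: ler_wpM2l => //.
  rewrite 2!big_split /=.
  have T1 : 2 * \sum_(i + a <= k < J) x ^+ (J - k.+1) <= 2 * Sc by rewrite ler_pM2l.
  have T2 : 2 * (i%:R ^+ 2 * 2 ^+ i * Sc / J%:R) * \sum_(i + a <= k < J) (k.+1%:R / 2 ^+ k) <= 384 * Sc.
    have JR0 : (0 : R) < J%:R by rewrite ltr0n.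
    have X0 : 0 <= 2 * (i%:R ^+ 2 * 2 ^+ i * Sc / J%:R).
      apply: mulr_ge0 => //; apply: divr_ge0; last exact: ltW.
      by apply: mulr_ge0 Sc0; apply: mulr_ge0; exact: exprn_ge0.
    apply: (le_trans (ler_wpM2l X0 sumL)).
    have -> : 2 * (i%:R ^+ 2 * 2 ^+ i * Sc / J%:R) * ((2 * i%:R + 4) / 2 ^+ i) =
      (4 * (i%:R ^+ 3 + 2 * i%:R ^+ 2)) / J%:R * Sc.
      by field; rewrite !gt_eqF.
    by apply: ler_wpM2r => //; rewrite ler_pdivrMr.
  have T3 : \sum_(i + a <= k < J) ((1 + i%:R ^+ 2) / 2 ^+ J) <= 294 * Sc.
    rewrite sumr_const_nat.
    have X0 : 0 <= (1 + i%:R ^+ 2) / 2 ^+ J :> R.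
      by apply: divr_ge0; [apply: addr_ge0 => //; exact: exprn_ge0 | exact: ltW].
    apply: (@le_trans _ _ (J%:R * ((1 + i%:R ^+ 2) / 2 ^+ J))).
      rewrite -[_ *+ (J - _)]mulr_natl; apply: ler_wpM2r => //.
      by rewrite ler_nat leq_subr.
    rewrite mulrA; apply: (@le_trans _ _ 294); first by rewrite ler_pdivrMr.
    by rewrite -[leLHS]mulr1; apply: ler_wpM2l; first exact: ler0n.
  rewrite -[X in X + _ + _]big_distrr -[X in _ + X + _]big_distrr /=.
  by apply: (le_trans (lerD (lerD T1 T2) T3)); rewrite -!mulrDl.
apply: (le_trans (lerD first tot)).
rewrite /large_const [leRHS]mulrDl -[N * _ * Sc]mulrA; apply: lerD => //.
have D0 : 0 <= D by apply: le_trans D1.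
exact: ler_peMr (mulr_ge0 (ler0n R 2305) D0) Sc1.
Qed.

End LargeWindow.
(** * Reduction to the squarefree model *)

Section FriableSums.
Variable R : realType.
Implicit Types (f : nat -> R) (u v B : R) (phi : R -> R) (ps t X : seq nat).

(* The sum of [1/n] over the powers [n = p^e] of [p] with [e >= 2] or, for bad [p], [e >= 1]. *)
Definition power_tail (good : pred nat) p : R :=
  if good p then (p%:R * (p%:R - 1))^-1 else (p%:R - 1)^-1.

Lemma geom_inv_sum p m N : (1 < p)%N ->
  \sum_(m <= e < N) (p%:R ^+ e)^-1 <= (p%:R ^+ m)^-1 * (p%:R / (p%:R - 1)) :> R.
Proof.
move=> p1; have pR : (1 : R) < p%:R by rewrite ltr1n.
have p0 : (0 : R) < p%:R by lra.
have pm : 0 < (p%:R : R) ^+ m by rewrite exprn_gt0.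
case: (leqP m N) => mN; last first.
  rewrite big_geq; last exact: ltnW.
  by apply: mulr_ge0; rewrite ?invr_ge0 ?(ltW pm) // divr_ge0; lra.
suff -> : \sum_(m <= e < N) (p%:R ^+ e)^-1 =
   (p%:R ^+ m)^-1 * (p%:R / (p%:R - 1)) - (p%:R ^+ N)^-1 * (p%:R / (p%:R - 1)) :> R.
  rewrite gerBl; apply: mulr_ge0; last by rewrite divr_ge0; lra.
  by rewrite invr_ge0 exprn_ge0 // ltW.
elim: N mN => [|N IH]; first by rewrite leqn0 => /eqP ->; rewrite big_nil subrr.
rewrite leq_eqVlt => /orP[/eqP ->|]; first by rewrite big_geq // subrr.
rewrite ltnS => mN; rewrite big_nat_recr //= IH // exprS.
have : (p%:R : R) ^+ N != 0 by rewrite expf_neq0 // gt_eqF.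
have := lt0r_neq0 pm.
have p2 : (p%:R : R) - 1 != 0 by rewrite gt_eqF //; lra.
have p3 := lt0r_neq0 p0.
move: (p%:R ^+ N) (p%:R ^+ m) => x y y0 x0; field.
by rewrite ?x0 ?y0 ?p2 ?p3.
Qed.

(** Induction on [ps], splitting by the exponent of [p] in [n]. A factor p^e that is frozen only
    shifts the argument, which the uniformity of [B] absorbs; exponents 0 and 1 of a good [p] are
    kept by moving [p] into [t]. *)
Lemma friable_sum_le f good ps t B phi X u :
  additive_fun f -> uniq ps -> all prime ps -> (forall v, 0 <= phi v) ->
  (forall v, sfsum f ([seq p <- ps | good p] ++ t) (fun w => phi (v + w)) <= B) ->
  uniq X -> {in X, forall n, (0 < n)%N /\ forall p, prime p -> (p %| n)%N -> p \in ps} ->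
  \sum_(n <- X) n%:R^-1 * sfsum f t (fun w => phi (u + f n + w)) <=
    \prod_(p <- ps) (1 + power_tail good p) * B.
Proof.
move=> fadd; have f1 : f 1%N = 0.
  by have := fadd 1%N 1%N isT isT isT; rewrite muln1; lra.
move=> + + phi0.
elim: ps t X u => [|p ps IH] t X u /=.
  move=> _ _ HB uX hX; rewrite big_nil mul1r.
  have B0 : 0 <= B by apply: le_trans (HB 0); apply: sfsum_ge0.
  apply: (@le_trans _ _ (\sum_(n <- [:: 1%N]) n%:R^-1 * sfsum f t (fun w => phi (u + f n + w)))).
    apply: ler_sum_subset => // [n nX|n]; last by rewrite mulr_ge0 ?invr_ge0 // sfsum_ge0.
    have [n0 hn] := hX n nX; rewrite inE eqn_leq n0 andbT leqNgt; apply/negP => n1.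
    by have := hn _ (pdiv_prime n1) (pdiv_dvd n).
  by rewrite big_seq1 invr1 mul1r f1 addr0; exact: HB.
move=> /andP[pns us] /andP[pp ps_pr] HB uX hX.
have p1 := prime_gt1 pp; have p0 := prime_gt0 pp.
have pR : (1 : R) < p%:R by rewrite ltr1n.
set Pi := \prod_(q <- ps) (1 + power_tail good q).
have B0 : 0 <= B by apply: le_trans (HB 0); apply: sfsum_ge0.
have Pi0 : 0 <= Pi.
  rewrite /Pi big_seq; apply: prodr_ge0 => q qs; rewrite addr_ge0 // /power_tail.
  have q1 : (1 : R) < q%:R by rewrite ltr1n prime_gt1 //; apply: (allP ps_pr).
  by case: ifP => _; rewrite invr_ge0 ?mulr_ge0 //; lra.
pose T w n := n%:R^-1 * sfsum f t (fun x => phi (w + f n + x)).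
have T0 w n : 0 <= T w n by rewrite mulr_ge0 ?invr_ge0 // sfsum_ge0.
pose Xe e := [seq (n %/ p ^ e)%N | n <- X & logn p n == e].
have memXe e m : m \in Xe e -> (p ^ e * m)%N \in X /\ coprime p m.
  move=> /mapP[n]; rewrite mem_filter => /andP[/eqP le nX] ->.
  have [n0 _] := hX n nX.
  have dn : (p ^ e %| n)%N by rewrite -le; exact: pfactor_dvdnn.
  rewrite mulnC divnK //; split=> //.
  rewrite prime_coprime //; apply/negP => pd.
  have : (p ^ e.+1 %| n)%N by rewrite expnS -(divnK dn) dvdn_mul.
  by rewrite pfactor_dvdn // le ltnn.
have uXe e : uniq (Xe e).
  rewrite map_inj_in_uniq ?filter_uniq // => n1 n2.
  rewrite !mem_filter => /andP[/eqP l1 _] /andP[/eqP l2 _] E.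
  have d1 : (p ^ e %| n1)%N by rewrite -l1; exact: pfactor_dvdnn.
  have d2 : (p ^ e %| n2)%N by rewrite -l2; exact: pfactor_dvdnn.
  by rewrite -(divnK d1) -(divnK d2) E.
have hXe e : {in Xe e, forall n, (0 < n)%N /\ forall q, prime q -> (q %| n)%N -> q \in ps}.
  move=> m /memXe[mX cop]; have [n0 hn] := hX _ mX.
  split; first by move: n0; rewrite muln_gt0 => /andP[].
  move=> q qp qm; have := hn q qp (dvdn_mull _ qm); rewrite inE => /orP[/eqP qE|//].
  by move: cop; rewrite prime_coprime // -qE qm.
have TE e w : \sum_(n <- X | logn p n == e) T w n =
    (p%:R ^+ e)^-1 * \sum_(m <- Xe e) T (w + f (p ^ e)%N) m.
  rewrite big_map big_filter big_distrr /= big_seq_cond [RHS]big_seq_cond.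
  apply: eq_bigr => n /andP[nX /eqP le].
  have nXe : (n %/ p ^ e)%N \in Xe e by apply: map_f; rewrite mem_filter le eqxx.
  have [_ cop] := memXe _ _ nXe; have [m0 _] := hXe _ _ nXe.
  have dn : (p ^ e %| n)%N by rewrite -le; exact: pfactor_dvdnn.
  have fn : f n = f (p ^ e)%N + f (n %/ p ^ e)%N.
    rewrite -fadd ?expn_gt0 ?p0 // ?coprimeXl //.
    by rewrite mulnC divnK.
  rewrite /T fn -{1}(divnK dn) natrM invfM natrX [X in X * _ = _]mulrC -mulrA.
  by congr (_ * (_ * _)); apply: eq_sfsum => x; congr phi; ring.
pose N := (\max_(n <- X) (logn p n)).+2.
have XN : \sum_(n <- X) T u n = \sum_(0 <= e < N) \sum_(n <- X | logn p n == e) T u n.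
  under [RHS]eq_bigr => e _ do rewrite big_mkcond.
  rewrite exchange_big /= big_seq [RHS]big_seq; apply: eq_bigr => n nX.
  rewrite -big_mkcond /= -big_filter.
  rewrite (@eq_filter _ _ (pred1 (logn p n))); last by move=> e; rewrite /= eq_sym.
  rewrite filter_pred1_uniq ?iota_uniq ?big_seq1 // mem_index_iota /= ltnS leqW //.
  by apply: (@leq_bigmax_seq _ _ _ (logn p)).
rewrite -/(T u) XN big_cons -/Pi.
have bound e : (forall v, sfsum f ([seq q <- ps | good q] ++ t) (fun w => phi (v + w)) <= B) ->
    \sum_(n <- X | logn p n == e) T u n <= (p%:R ^+ e)^-1 * (Pi * B).
  move=> HB'; rewrite TE; apply: ler_wpM2l; first by rewrite invr_ge0 exprn_ge0.
  exact: IH.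
have PB0 : 0 <= Pi * B by exact: mulr_ge0.
have pR0 : (p%:R : R) != 0 by rewrite gt_eqF //; lra.
have pR1 : (p%:R : R) - 1 != 0 by rewrite gt_eqF //; lra.
move: HB; rewrite /power_tail; case: ifP => gp HB; last first.
  apply: (@le_trans _ _ (\sum_(0 <= e < N) (p%:R ^+ e)^-1 * (Pi * B))).
    by apply: ler_sum => e _; exact: bound.
  rewrite -big_distrl -mulrA; apply: ler_wpM2r => //.
  apply: (le_trans (geom_inv_sum 0 N p1)); rewrite expr0 invr1 mul1r.
  by rewrite le_eqVlt; apply/orP; left; apply/eqP; field.
have HBt v : sfsum f ([seq q <- ps | good q] ++ t) (fun w => phi (v + w)) <= B.
  apply: le_trans (HB v); exact: sfsum_cons_ge.
have HBp v : sfsum f ([seq q <- ps | good q] ++ p :: t) (fun w => phi (v + w)) <= B.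
  by rewrite sfsum_swap; exact: HB.
rewrite big_ltn // big_ltn // addrA.
have rest : \sum_(2 <= e < N) \sum_(n <- X | logn p n == e) T u n <=
    (p%:R * (p%:R - 1))^-1 * (Pi * B).
  apply: (@le_trans _ _ (\sum_(2 <= e < N) (p%:R ^+ e)^-1 * (Pi * B))).
    by apply: ler_sum => e _; exact: bound.
  rewrite -big_distrl; apply: ler_wpM2r => //.
  apply: (le_trans (geom_inv_sum 2 N p1)).
  by rewrite le_eqVlt; apply/orP; left; apply/eqP; field; rewrite pR0 pR1.
have main : \sum_(n <- X | logn p n == 0) T u n + \sum_(n <- X | logn p n == 1%N) T u n
    <= Pi * B.
  (* A common set of cofactors for exponents 0 and 1, so that the two sums merge into one [sfsum]
     over [p :: t]. *)
  pose Y := undup (Xe 0 ++ Xe 1).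
  have hY : {in Y, forall n, (0 < n)%N /\ forall q, prime q -> (q %| n)%N -> q \in ps}.
    by move=> n; rewrite mem_undup mem_cat => /orP[]; exact: hXe.
  apply: le_trans (IH (p :: t) Y u us ps_pr HBp (undup_uniq _) hY).
  rewrite !TE expr0 invr1 mul1r f1 addr0 expr1 expn1.
  have sub e : (e < 2)%N -> {subset Xe e <= Y}.
    by case: e => [|[|]] // _ n nX; rewrite mem_undup mem_cat nX ?orbT.
  have H0 : \sum_(m <- Xe 0) T u m <= \sum_(m <- Y) T u m.
    by apply: ler_sum_subset => //; exact: sub.
  have H1 : \sum_(m <- Xe 1) T (u + f p) m <= \sum_(m <- Y) T (u + f p) m.
    by apply: ler_sum_subset => //; exact: sub.
  have p'0 : 0 <= (p%:R : R)^-1 by rewrite invr_ge0.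
  apply: (le_trans (lerD H0 (ler_wpM2l p'0 H1))).
  rewrite big_distrr -big_split /= le_eqVlt; apply/orP; left; apply/eqP.
  apply: eq_bigr => m _; rewrite /T mulrDr mulrCA; congr (_ * _ + _ * (_ * _)).
  by apply: eq_sfsum => x; congr phi; ring.
apply: (le_trans (lerD main rest)).
by rewrite -mulrA mulrDl mul1r.
Qed.

Lemma esum_le_seq (S : set nat) (a : nat -> R) M :
  (forall X, uniq X -> {in X, forall n, S n} -> \sum_(n <- X) a n <= M) ->
  (\esum_(n in S) (a n)%:E <= M%:E)%E.
Proof.
move=> H; apply: ge_ereal_sup => _ [A [finA AS] <-].
rewrite fsbig_finite // sumEFin lee_fin; apply: H; first exact: finmap.fset_uniq.
by move=> n; rewrite in_fset_set // inE => /AS.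
Qed.

Lemma seq_le_esum (S : set nat) (a : nat -> R) X : uniq X -> {in X, forall n, S n} ->
  ((\sum_(n <- X) a n)%:E <= \esum_(n in S) (a n)%:E)%E.
Proof.
move=> uX XS; apply: esum_ge; exists [set` X].
  by split; [exact: finite_seq|move=> n /= /XS].
by rewrite -fsbig_seq // sumEFin.
Qed.

End FriableSums.

(** * The concentration function of the friable distribution *)

Section Concentration.
Variables (R : realType) (f : nat -> R) (y : R).
Hypotheses (fadd : additive_fun f) (y_ge0 : 0 <= y).
Implicit Types (u e B : R) (s X : seq nat).

Let ps := primes_upto (Num.truncn y).
Let V : R := \prod_(p <- ps) (1 - p%:R^-1).

Lemma additive_fun1 : f 1%N = 0.
Proof. by have := fadd (m := 1) (n := 1) isT isT isT; rewrite muln1; lra. Qed.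

Lemma friableP n : friable y n <->
  (0 < n)%N /\ forall p, prime p -> (p %| n)%N -> p \in ps.
Proof.
by split => -[n0 H]; split => // p pp pn; have := H p pp pn;
  rewrite mem_primes_upto pp truncn_ge_nat.
Qed.

Lemma one_sub_inv_prime p : p \in ps -> 0 < 1 - (p%:R : R)^-1.
Proof.
rewrite mem_primes_upto => /andP[pp _].
by rewrite subr_gt0 invf_lt1 ?ltr0n ?prime_gt0 // ltr1n prime_gt1.
Qed.

Lemma euler_gt0 : 0 < V.
Proof. by rewrite /V big_seq; apply: prodr_gt0 => p; exact: one_sub_inv_prime. Qed.

(** At a bad prime the Euler factor cancels the full geometric series; at a good one, (1 - 1/p)(1 +
    1/(p(p-1))) = 1 - 1/p + 1/p^2. *)
Lemma euler_tail (good : pred nat) :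
  V * \prod_(p <- ps) (1 + power_tail R good p) =
  \prod_(p <- ps | good p) (1 - p%:R^-1 + (p%:R ^+ 2)^-1).
Proof.
rewrite /V -big_split [RHS]big_mkcond /= big_seq [RHS]big_seq; apply: eq_bigr => p.
rewrite mem_primes_upto => /andP[/prime_gt1 p1 _].
have pR : (1 : R) < p%:R by rewrite ltr1n.
have p2 : (p%:R : R) - 1 != 0 by rewrite gt_eqF //; lra.
have p3 : (p%:R : R) != 0 by rewrite gt_eqF //; lra.
by rewrite /power_tail; case: ifP => _; field; rewrite ?p2 ?p3.
Qed.

Lemma friable_seq_le (good : pred nat) phi B X : (forall v, 0 <= phi v) ->
  (forall v, sfsum f [seq p <- ps | good p] (fun w => phi (v + w)) <= B) ->
  uniq X -> {in X, forall n, friable y n} ->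
  V * \sum_(n <- X) n%:R^-1 * phi (f n) <=
    \prod_(p <- ps | good p) (1 - p%:R^-1 + (p%:R ^+ 2)^-1) * B.
Proof.
move=> phi0 HB uX hX; rewrite -euler_tail -mulrA; apply: ler_wpM2l; first exact: ltW euler_gt0.
have HB' v : sfsum f ([seq p <- ps | good p] ++ [::]) (fun w => phi (v + w)) <= B.
  by rewrite cats0.
have hX' : {in X, forall n, (0 < n)%N /\ forall p, prime p -> (p %| n)%N -> p \in ps}.
  by move=> n nX; apply/friableP; exact: hX.
have := @friable_sum_le R f good ps [::] B phi X 0 fadd (uniq_primes_upto _)
  (all_primes_upto _) phi0 HB' uX hX'.
apply: le_trans; rewrite le_eqVlt; apply/orP; left; apply/eqP.
by apply: eq_bigr => n _ /=; rewrite add0r addr0.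
Qed.

(** With no good prime everything is frozen. This gives the finiteness behind [fine]. *)
Lemma friable_seq_le1 X : uniq X -> {in X, forall n, friable y n} ->
  \sum_(n <- X) n%:R^-1 <= V^-1.
Proof.
move=> uX hX; rewrite -[leRHS]mul1r ler_pdivlMr ?euler_gt0 // mulrC.
have := @friable_seq_le pred0 (fun=> 1) 1 X (fun=> ler01) _ uX hX.
rewrite big_pred0_eq mul1r; under eq_bigr do rewrite mulr1.
by apply => v; rewrite filter_pred0.
Qed.

Lemma esum_friable_fin (S : set nat) : S `<=` friable y ->
  (\esum_(n in S) (n%:R^-1 : R)%:E)%E \is a fin_num.
Proof.
move=> HS; rewrite ge0_fin_numE; last first.
  by apply: esum_ge0 => n _; rewrite lee_fin invr_ge0.
apply: (@le_lt_trans _ _ (V^-1)%:E); last exact: ltry.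
apply: esum_le_seq => X uX hX; apply: friable_seq_le1 => // n nX.
by apply: HS; exact: hX.
Qed.

Let friable_window u e : set nat := [set n | friable y n /\ u < f n <= u + e].

Lemma distr_fun_window u e : 0 <= e ->
  distr_fun f y (u + e) - distr_fun f y u =
  V * fine (\esum_(n in friable_window u e) (n%:R^-1)%:E).
Proof.
move=> e0.
have VE : \prod_(0 <= p < (Num.truncn y).+1 | prime p) (1 - p%:R^-1) = V.
  by rewrite /V big_filter /index_iota subn0.
rewrite /distr_fun VE -mulrBr; congr (_ * _).
rewrite (esumID [set n | f n <= u]); last by move=> n _; rewrite lee_fin invr_ge0.
have -> : [set n | friable y n /\ f n <= u + e] `&` [set n | f n <= u] =
    [set n | friable y n /\ f n <= u].
  apply/seteqP; split => n; first by move=> [[yn _] fu]; split.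
  by move=> [yn fu]; split => //; split => //; move: fu => /=; lra.
have -> : [set n | friable y n /\ f n <= u + e] `&` ~` [set n | f n <= u] =
    friable_window u e.
  apply/seteqP; split => n.
    by move=> [[yn fu1] /negP]; rewrite -ltNge => fu2; split => //; apply/andP; split.
  by move=> [yn /andP[fu fu2]]; split => //; apply/negP; rewrite -ltNge.
rewrite fineD; last 2 first.
- by apply: esum_friable_fin => n [].
- by apply: esum_friable_fin => n [].
by rewrite addrC addKr.
Qed.

Lemma distr_fun_window_le u e B (good : pred nat) : 0 <= e ->
  (forall v, sfsum f [seq p <- ps | good p] (win v e) <= B) ->
  distr_fun f y (u + e) - distr_fun f y u <=
    \prod_(p <- ps | good p) (1 - p%:R^-1 + (p%:R ^+ 2)^-1) * B.
Proof.
move=> e0 HB; rewrite distr_fun_window //.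
set M := _ * B.
have HS : friable_window u e `<=` friable y by move=> n [].
have V0 := euler_gt0.
suff : (\esum_(n in friable_window u e) (n%:R^-1 : R)%:E <= (V^-1 * M)%:E)%E.
  rewrite -(fineK (esum_friable_fin HS)) lee_fin => H.
  apply: (le_trans (ler_wpM2l (ltW V0) H)).
  by rewrite mulrA divff ?mul1r // gt_eqF.
apply: esum_le_seq => X uX hX.
rewrite mulrC ler_pdivlMr // mulrC.
have HB' v : sfsum f [seq p <- ps | good p] (fun w => win u e (v + w)) <= B.
  apply: le_trans (HB (u - v)); apply: sfsum_le => w; by rewrite winD.
apply: le_trans (friable_seq_le (win_ge0 u e) HB' uX _); last first.
  by move=> n /hX /HS.
apply: ler_wpM2l; first exact: ltW.
rewrite big_seq [leRHS]big_seq; apply: ler_sum => n /hX[_ /andP[fu fue]].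
by rewrite /win (ltW fu) fue mulr1.
Qed.

(** Makes the set in [concentration] bounded, so that its [sup] is a genuine supremum. *)
Lemma distr_fun_window_le1 u e : 0 <= e ->
  distr_fun f y (u + e) - distr_fun f y u <= 1.
Proof.
move=> e0; have := @distr_fun_window_le u e 1 pred0 e0.
rewrite big_pred0_eq mul1r; apply => v.
by rewrite filter_pred0 /= /win; case: ifP.
Qed.

Lemma concentration_le e B (good : pred nat) : 0 <= e ->
  (forall v, sfsum f [seq p <- ps | good p] (win v e) <= B) ->
  concentration (distr_fun f y) e <=
    \prod_(p <- ps | good p) (1 - p%:R^-1 + (p%:R ^+ 2)^-1) * B.
Proof.
move=> e0 HB; apply: ge_sup; first by exists (distr_fun f y (0 + e) - distr_fun f y 0); exists 0.
by move=> _ [u _ <-]; exact: distr_fun_window_le.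
Qed.

Lemma concentration_le1 e : 0 <= e -> concentration (distr_fun f y) e <= 1.
Proof.
move=> e0; apply: ge_sup; first by exists (distr_fun f y (0 + e) - distr_fun f y 0); exists 0.
by move=> _ [u _ <-]; exact: distr_fun_window_le1.
Qed.

Lemma concentration_ge u e s : 0 <= e -> uniq s -> {subset s <= ps} ->
  V * sfsum f s (fun v => if u < v <= u + e then 1 else 0) <=
  concentration (distr_fun f y) e.
Proof.
move=> e0 us sps.
apply: (@le_trans _ _ (distr_fun f y (u + e) - distr_fun f y u)); last first.
  apply: ub_le_sup; last by exists u.
  by exists 1 => _ [w _ <-]; exact: distr_fun_window_le1.
have s_pr : all prime s by apply/allP => p /sps; exact: (allP (all_primes_upto _)).
rewrite distr_fun_window //; apply: ler_wpM2l; first exact: ltW euler_gt0.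
have HS : friable_window u e `<=` friable y by move=> n [].
rewrite sfsumE ?additive_fun1 //; last first.
  by move=> p n ps' n0 cop; apply: fadd => //; apply: prime_gt0; exact: (allP s_pr).
rewrite -lee_fin (fineK (esum_friable_fin HS)).
set a := fun n : nat => (if u < f n <= u + e then 1 else 0 : R).
have -> : \sum_(n <- sfproducts s) n%:R^-1 * a n =
   \sum_(n <- [seq n <- sfproducts s | u < f n <= u + e]) n%:R^-1.
  rewrite [RHS]big_filter [RHS]big_mkcond; apply: eq_bigr => n _.
  by rewrite /a; case: ifP; rewrite ?mulr1 ?mulr0.
apply: seq_le_esum; first by rewrite filter_uniq // uniq_sfproducts.
move=> n; rewrite mem_filter => /andP[fn /(mem_sfproducts s_pr)[n0 hn]].
by split => //; apply/friableP; split => // p pp /(hn p pp) /sps.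
Qed.

End Concentration.
(** * Assembling the bounds *)

Section Products.
Variable R : realType.
Implicit Types (s t : seq nat) (P : set nat) (c A C e : R).

(** The product over all integers from 2 on telescopes to a value above 1/2. *)
Lemma prod_inv_sq_ge s : uniq s -> all prime s ->
  2^-1 <= \prod_(p <- s) (1 - (p%:R ^+ 2)^-1) :> R.
Proof.
move=> us ps.
have H n : (n.+3%:R / (2 * n.+2%:R) : R) =
    \prod_(2 <= m < n.+3) (1 - (m%:R ^+ 2)^-1).
  elim: n => [|n IH]; first by rewrite big_nat1; field.
  rewrite big_nat_recr //= -IH.
  have -> : n.+4%:R = n.+2%:R + 2 :> R by rewrite -[n.+4]addn2 natrD.
  have -> : n.+3%:R = n.+2%:R + 1 :> R by rewrite -[n.+3]addn1 natrD.
  have : (0 : R) < n.+2%:R by rewrite ltr0n.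
  by move: (n.+2%:R) => x x0; field; rewrite !gt_eqF //; lra.
pose N := \max_(p <- s) p.
have sN p : p \in s -> (2 <= p < N.+3)%N.
  move=> psn; rewrite prime_gt1 ?(allP ps) //= ltnS (leq_trans _ (leqnSn _)) //.
  by rewrite (leq_trans _ (leqnSn _)) //; exact: (@leq_bigmax_seq _ _ _ id).
have x0 (m : nat) : (2 <= m)%N -> 0 <= 1 - (m%:R ^+ 2)^-1 :> R.
  move=> m2; rewrite subr_ge0 invf_le1 ?exprn_gt0 ?ltr0n ?(leq_trans _ m2) //.
  by rewrite -natrX ler1n expn_gt0 (leq_trans _ m2).
have x1 (m : nat) : 1 - (m%:R ^+ 2)^-1 <= 1 :> R by rewrite gerBl invr_ge0 exprn_ge0.
apply: (@le_trans _ _ (\prod_(2 <= m < N.+3) (1 - (m%:R ^+ 2)^-1))).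
  rewrite -H ler_pdivlMr ?mulr_gt0 ?ltr0n // mulrA mulVf // mul1r ler_nat.
  exact: leqnSn.
have Y : perm_eq [seq m <- index_iota 2 N.+3 | m \in s] s.
  apply: uniq_perm => //; first by rewrite filter_uniq ?iota_uniq.
  by move=> p; rewrite mem_filter mem_index_iota andb_idr //; exact: sN.
rewrite -(perm_big _ Y) [leRHS]big_filter [leRHS]big_mkcond.
rewrite big_nat_cond [leRHS]big_nat_cond.
apply: ler_prod => m /andP[/andP[m2 _] _].
by rewrite x0 //=; case: ifP.
Qed.

Lemma mass_le_subset s t : uniq s -> {subset s <= t} -> mass R s <= mass R t.
Proof.
elim: s t => [|p s IH] t /=; first by rewrite {1}/mass big_nil => _ _; exact: mass_ge1.
move=> /andP[xs us] st; have xt : p \in t by apply: st; rewrite mem_head.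
rewrite /mass big_cons (perm_big _ (perm_to_rem xt)) big_cons.
apply: ler_wpM2l; first by rewrite addr_ge0 ?invr_ge0.
apply: IH => // q qs.
have := st q; rewrite inE qs orbT => /(_ isT).
rewrite (perm_mem (perm_to_rem xt)) inE => /orP[/eqP yx|//].
by rewrite -yx qs in xs.
Qed.

Lemma mass_le_expR s : mass R s <= expR (\sum_(p <- s) p%:R^-1).
Proof.
rewrite expR_sum /mass; apply: ler_prod => p _.
by rewrite expR_ge1Dx andbT addr_ge0 ?invr_ge0.
Qed.

Lemma mass_exceptional P C s : (\esum_(p in [set p : nat | prime p /\ ~ P p]) (p%:R^-1 : R)%:E
       <= C%:E)%E -> uniq s -> all prime s -> {in s, forall p, ~ P p} ->
  mass R s <= expR C.
Proof.
move=> H us ps sP; apply: (le_trans (mass_le_expR s)); rewrite ler_expR -lee_fin.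
apply: le_trans H; apply: seq_le_esum => // p psn; split; [exact: (allP ps)|exact: sP].
Qed.

Lemma mass_lt_le : exists2 C, 0 < C & forall (K : nat) s, (2 <= K)%N -> uniq s ->
  all prime s -> {in s, forall p, (p < K)%N} -> mass R s <= C * ln K%:R.
Proof.
have [C C1 HC] := mass_primes_le R.
exists (4 * C); first by lra.
move=> K s K2 us ps sK.
have k0 : (0 < up_log 2 K)%N by rewrite up_log_gt0 ?K2.
have /andP[H1 _] := @up_log_bounds 2 K isT K2.
have H2 := @up_logP 2 K isT.
apply: (@le_trans _ _ (mass R (primes_in 2 (2 ^ up_log 2 K)))).
  apply: mass_le_subset => // p psn; rewrite mem_primes_in (allP ps) //=.
  by rewrite prime_gt1 ?(allP ps) // (leq_trans (sK _ psn)).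
apply: (le_trans (HC _ k0)); rewrite -mulrA [leRHS]mulrCA.
apply: ler_wpM2l; first by lra.
move: H1 k0; case: (up_log 2 K) => // k H1 _.
have : ln ((2 ^ k)%N%:R) <= ln (K%:R : R).
  rewrite ler_ln ?posrE ?ltr0n ?expn_gt0 //; last by exact: leq_trans K2.
  by rewrite ler_nat ltnW.
have : ln 2%:R <= ln (K%:R : R) by rewrite ler_ln ?posrE ?ltr0n ?ler_nat //; exact: leq_trans K2.
rewrite natrX lnXn // -[ln _ *+ _]mulr_natr -[k.+1]addn1 natrD.
have l2 := ln2_ge R; have : 2^-1 * k%:R <= ln 2 * k%:R :> R by apply: ler_wpM2r.
lra.
Qed.

(** A dyadic block contributes at most 378 / m^2, and 1/m^2 <= 2 (1/m - 1/(m+1)) telescopes. *)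
Lemma dyadic_tail k m : (0 < k)%N -> (k <= m)%N ->
  \sum_(p <- primes_in (2 ^ k) (2 ^ m)) (p%:R * ln p%:R)^-1 <=
    2 * (2 * 189) * (k%:R^-1 - m%:R^-1) :> R.
Proof.
move=> k0; elim: m => [|m IH]; first by rewrite leqn0; case: k k0.
rewrite leq_eqVlt => /orP[/eqP <-|].
  by rewrite subrr mulr0 /primes_in /index_iota subnn big_nil.
rewrite ltnS => km.
have m0 : (0 < m)%N by apply: leq_trans km.
have mR : (1 : R) <= m%:R by rewrite ler1n.
rewrite (@primes_in_cat _ (2 ^ m)) ?leq_exp2l // big_cat /=.
apply: (le_trans (lerD (IH km) (lexx _))).
have E : \sum_(p <- primes_in (2 ^ m) (2 ^ m.+1)) (p%:R * ln p%:R)^-1 <=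
    2 / m%:R * (189 / m%:R) :> R.
  apply: (@le_trans _ _ (2 / m%:R * \sum_(p <- primes_in (2 ^ m) (2 ^ m.+1)) p%:R^-1)).
    rewrite big_distrr /= big_seq [leRHS]big_seq; apply: ler_sum => p.
    rewrite mem_primes_in => /andP[pp /andP[mp _]].
    rewrite invfM mulrC; apply: ler_wpM2r; first by rewrite invr_ge0.
    rewrite -[X in _ <= X]invrK lef_pV2 ?posrE; last 2 first.
    - by rewrite ln_gt0 // ltr1n prime_gt1.
    - by rewrite invr_gt0 divr_gt0 //; lra.
    rewrite invf_div.
    apply: (@le_trans _ _ (ln ((2 ^ m)%N%:R))).
      rewrite natrX lnXn // -[ln _ *+ _]mulr_natr mulrC.
      by apply: ler_wpM2r => //; exact: ln2_ge.
    by rewrite ler_ln ?posrE ?ltr0n ?expn_gt0 ?prime_gt0 // ler_nat.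
  apply: ler_wpM2l; first by rewrite divr_ge0.
  exact: dyadic_primes_sum.
apply: (le_trans (lerD (lexx _) E)).
have -> : m.+1%:R = m%:R + 1 :> R by rewrite -[m.+1]addn1 natrD.
have k1 : (0 : R) < k%:R by rewrite ltr0n.
rewrite -subr_ge0.
set z : R := k%:R^-1.
have -> : 2 * (2 * 189) * (z - (m%:R + 1)^-1) -
   (2 * (2 * 189) * (z - m%:R^-1) + 2 / m%:R * (189 / m%:R)) =
   2 * 189 * (m%:R - 1) / (m%:R ^+ 2 * (m%:R + 1)) :> R.
  by field; rewrite !gt_eqF //; lra.
apply: divr_ge0; last by apply: mulr_ge0; [exact: exprn_ge0|lra].
by apply: mulr_ge0; lra.
Qed.

Lemma sum_inv_p_ln : exists2 C : R, 0 < C & forall (K : nat) s, (2 <= K)%N -> uniq s ->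
  all prime s -> {in s, forall p, (K <= p)%N} ->
  \sum_(p <- s) (p%:R * ln p%:R)^-1 <= C / ln K%:R.
Proof.
exists (2 * (2 * (2 * 189))); first by lra.
move=> K s K2 us ps sK.
have K0 : (0 < K)%N by apply: leq_trans K2.
have /andP[H1 H2] := @trunc_log_bounds 2 K isT K0.
have k0 : (0 < trunc_log 2 K)%N by rewrite trunc_log_gt0 K2.
move: H1 H2 k0; set k := trunc_log 2 K => H1 H2 k0.
pose m := (k + \max_(p <- s) p)%N.
have lnK : 0 < ln (K%:R : R) by rewrite ln_gt0 // ltr1n.
have pos p : (0 : R) <= (p%:R * ln p%:R)^-1.
  rewrite invr_ge0 mulr_ge0 //; case: p => [|p]; first by rewrite ln0.
  by rewrite ln_ge0 // ler1n.
apply: (@le_trans _ _ (\sum_(p <- primes_in (2 ^ k) (2 ^ m)) (p%:R * ln p%:R)^-1)).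
  apply: ler_sum_subset => // p psn.
  rewrite mem_primes_in (allP ps) //= (leq_trans H1 (sK _ psn)) /=.
  have pm : (p <= \max_(p <- s) p)%N by exact: (@leq_bigmax_seq _ _ _ id).
  apply: (@leq_ltn_trans m); first by rewrite /m (leq_trans pm) // leq_addl.
  exact: ltn_expl.
apply: (le_trans (dyadic_tail k0 (leq_addr _ _))).
have kR : (1 : R) <= k%:R by rewrite ler1n.
apply: (@le_trans _ _ (2 * (2 * 189) * k%:R^-1)).
  apply: ler_wpM2l; first by lra.
  by rewrite gerBl invr_ge0.
have -> : 2 * (2 * (2 * 189)) / ln K%:R = 2 * (2 * 189) * (2 / ln K%:R) :> R by ring.
apply: ler_wpM2l; first by lra.
rewrite ler_pdivlMr // mulrC ler_pdivrMr; last by lra.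
apply: (@le_trans _ _ (ln ((2 ^ k.+1)%N%:R))).
  by rewrite ler_ln ?posrE ?ltr0n ?expn_gt0 // ler_nat ltnW.
rewrite natrX lnXn // -[ln _ *+ _]mulr_natr -[k.+1]addn1 natrD.
have l2 := ln2_le R; have : ln 2 * (k%:R + 1) <= 1 * (k%:R + 1) :> R.
  by apply: ler_wpM2r => //; lra.
lra.
Qed.

End Products.

(** * The lower bound *)

Section Bounds.
Variable R : realType.
Implicit Types (f : nat -> R) (P : set nat) (c A C e y : R).

Lemma gsup_dexp_le f P c C1 j : (forall p, P p -> prime p) -> 1 <= c -> 0 < C1 ->
  (forall p, P p -> `|f p| <= C1 / ln p%:R `^ c) -> (0 < j)%N ->
  gsup f P c (dexp j)%:R <= 2 * C1 / 2 ^+ j.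
Proof.
move=> hP c1 C0 hf j0; apply: (le_trans (gsup_le hP C0 hf (dexp_gt1 R j))).
have P2 : 0 < (2 : R) ^+ j by rewrite exprn_gt0.
have L : 2 ^+ j / 2 <= ln (dexp j)%:R :> R.
  by rewrite ln_dexp; apply: ler_wpM2l; [exact: ltW|exact: ln2_ge].
have L1 : 1 <= ln (dexp j)%:R :> R.
  apply: le_trans L; rewrite ler_pdivlMr // mul1r -{1}[2]expr1.
  by apply: ler_weXn2l; rewrite ?ler1n.
have L0 : 0 < ln (dexp j)%:R `^ c :> R by apply: powR_gt0; apply: lt_le_trans L1.
rewrite ler_pdivrMr //.
have : 2 ^+ j / 2 <= ln (dexp j)%:R `^ c :> R.
  by apply: (le_trans L); exact: le1r_powR.
move=> H; have X : 0 <= 2 * C1 / 2 ^+ j by rewrite divr_ge0 ?mulr_ge0 // ltW.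
apply: le_trans (ler_wpM2l X H).
by rewrite le_eqVlt; apply/orP; left; apply/eqP; field; rewrite gt_eqF.
Qed.

Lemma KminP f P c C1 e : (forall p, P p -> prime p) -> 1 <= c -> 0 < C1 ->
  (forall p, P p -> `|f p| <= C1 / ln p%:R `^ c) -> 0 < e ->
  [/\ (3 <= Kmin f P c e)%N, gsup f P c (Kmin f P c e)%:R <= e &
    forall n, (3 <= n < Kmin f P c e)%N -> e < gsup f P c n%:R].
Proof.
move=> hP c1 C0 hf e0; rewrite /Kmin.
case: pselect => [ex|nex]; last first.
  (* g (dexp j) <= 2 C1 / 2^j is at most [e] at this level, because 2^j > j. *)
  exfalso; apply: nex; set j := (Num.truncn (2 * C1 / e)).+1.
  exists (dexp j); apply/andP; split.
    by apply: leq_trans (dexp_mono (ltn0Sn _ : (1 <= j)%N)).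
  have j0 : (0 < j)%N by [].
  apply: (le_trans (gsup_dexp_le hP c1 C0 hf j0)).
  rewrite ler_pdivrMr ?exprn_gt0 // [leRHS]mulrC -ler_pdivrMr //.
  have jT : 2 * C1 / e <= j%:R by rewrite ltW // /j; exact: truncnS_gt.
  clearbody j; apply: (le_trans jT).
  by rewrite -natrX ler_nat ltnW // ltn_expl.
case: (ex_minnP ex) => n /andP[n3 gn] nmin; split => // m /andP[m3 mn].
rewrite ltNge; apply/negP => gm.
by have := nmin m; rewrite m3 gm => /(_ isT); rewrite leqNgt mn.
Qed.

(* Products of primes of [P] beyond [K] have [|f n| << e] on average. *)
Lemma concentration_lower C1 C2 : 0 < C1 -> 0 < C2 -> exists2 c0, 0 < c0 &
  forall f P c e y, additive_fun f -> (forall p, P p -> prime p) -> 1 <= c ->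
  (forall p, P p -> `|f p| <= C1 / ln p%:R `^ c) ->
  (\esum_(p in [set p : nat | prime p /\ ~ P p]) (p%:R^-1 : R)%:E <= C2%:E)%E ->
  0 < e -> 0 <= y ->
  c0 / ln (Kmin f P c e)%:R <= concentration (distr_fun f y) e.
Proof.
move=> C1_0 C2_0.
have [Ct Ct0 HCt] := sum_inv_p_ln R.
have [Cm Cm0 HCm] := mass_lt_le R.
(* Enough windows of length [e] to cover a length 2 T + e, where T = 2 Ct e. *)
pose n := (Num.truncn (4 * Ct)).+2.
have nT : 4 * Ct + 1 <= n%:R.
  have := truncnS_gt (4 * Ct); rewrite /n; move: (Num.truncn _) => m.
  by rewrite -[m.+2]addn1 natrD => /ltW; rewrite lerD2r.
have n0 : (0 : R) < n%:R by rewrite ltr0n.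
exists ((2 * expR C2 * Cm * (2 * n%:R))^-1).
  by rewrite invr_gt0 !mulr_gt0 // expR_gt0.
move=> f P c e y fadd hP c1 hf hex e0 y0.
have [K3 gK _] := KminP hP c1 C1_0 hf e0.
set K := Kmin f P c e in K3 gK *.
have K2 : (2 <= K)%N by apply: ltnW.
have KR : 1 < K%:R :> R by rewrite ltr1n.
have lnK : 0 < ln (K%:R : R) by rewrite ln_gt0.
set ps := primes_upto (Num.truncn y).
pose s := [seq p <- ps | `[< P p >] && (K <= p)%N].
have us : uniq s by rewrite filter_uniq // uniq_primes_upto.
have sps : {subset s <= ps} by move=> p; rewrite mem_filter => /andP[].
have s_pr : all prime s by apply/allP => p /sps; exact: (allP (all_primes_upto _)).
have sP p : p \in s -> P p /\ (K <= p)%N.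
  by rewrite mem_filter => /andP[/andP[/asboolP]].
set M := mass R s.
have M1 : 1 <= M by exact: mass_ge1.
have small p : p \in s -> `|f p| / p%:R <= e * ln K%:R * (p%:R * ln p%:R)^-1.
  move=> /sP[Pp Kp].
  have p1 : 1 < p%:R :> R by apply: lt_le_trans KR _; rewrite ler_nat.
  have lp : 0 < ln (p%:R : R) by rewrite ln_gt0.
  have KpR : (K%:R : R) <= p%:R by rewrite ler_nat.
  have lKp : ln (K%:R : R) <= ln p%:R.
    by rewrite ler_ln ?posrE //; [apply: lt_trans KR|apply: lt_trans p1].
  have H := gsup_bound hP hf KR Pp KpR.
  have lE : ln (K%:R : R) = ln K%:R / ln p%:R * ln p%:R by rewrite divfK // gt_eqF.
  have q0 : 0 < ln (K%:R : R) / ln p%:R by rewrite divr_gt0.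
  have q1 : ln (K%:R : R) / ln p%:R <= 1 by rewrite ler_pdivrMr // mul1r.
  (* From g K <= e and the monotonicity of g(t) (ln t)^c; the exponent c >= 1 is dropped because ln
     K / ln p <= 1. *)
  have fp : `|f p| <= e * (ln K%:R / ln p%:R).
    have Lc : 0 < ln (p%:R : R) `^ c by exact: powR_gt0.
    apply: (@le_trans _ _ (e * (ln K%:R / ln p%:R) `^ c)).
      rewrite -(ler_pM2r Lc) -mulrA -powRM ?(ltW lp) ?(ltW q0) // -lE.
      by apply: (le_trans H); apply: ler_wpM2r; [exact: powR_ge0|].
    by apply: ler_wpM2l; [exact: ltW|apply: ge1r_powR => //; rewrite q0].
  have p'0 : 0 <= (p%:R : R)^-1 by rewrite invr_ge0.
  apply: (le_trans (ler_wpM2r p'0 fp)).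
  by rewrite invfM le_eqVlt; apply/orP; left; apply/eqP; ring.
have mean : sfsum f s (fun v => `|v|) <= M * (Ct * e).
  apply: (le_trans (sfsum_mean _ _)); apply: ler_wpM2l; first by apply: le_trans M1.
  apply: (@le_trans _ _ (\sum_(p <- s) e * ln K%:R * (p%:R * ln p%:R)^-1)).
    by rewrite big_seq [leRHS]big_seq; apply: ler_sum.
  rewrite -big_distrr /=.
  have eK : 0 <= e * ln K%:R by apply: mulr_ge0; exact: ltW.
  have sK : {in s, forall p, (K <= p)%N} by move=> p /sP[].
  apply: (le_trans (ler_wpM2l eK (HCt K s K2 us s_pr sK))).
  by rewrite le_eqVlt; apply/orP; left; apply/eqP; field; rewrite gt_eqF.
(* [T] is twice the bound on the mean, so half the mass has |v| <= T. The windows are open on the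
   left, hence the start one length below -T. *)
pose T := 2 * Ct * e; pose u := - T - e.
have T0 : 0 < T by rewrite !mulr_gt0.
pose hw (w v : R) : R := if w < v <= w + e then 1 else 0.
have hw0 w v : 0 <= hw w v by rewrite /hw; case: ifP.
have cover m v : u < v -> v <= u + m%:R * e -> 1 <= \sum_(0 <= i < m) hw (u + i%:R * e) v.
  move=> uv; elim: m => [|m IHm]; first by rewrite mul0r addr0 leNgt uv.
  rewrite -[m.+1 in X in X -> _]addn1 natrD mulrDl mul1r => vm; rewrite big_nat_recr //=.
  case: (leP v (u + m%:R * e)) => vm2.
    by apply: (le_trans (IHm vm2)); rewrite lerDl.
  rewrite -[leLHS]add0r; apply: lerD; first by apply: sumr_ge0.
  by rewrite /hw vm2 addrA in vm *; rewrite ifT // -addrA.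
set V : R := \prod_(p <- ps) (1 - p%:R^-1).
set Q := concentration _ _.
have V0 : 0 < V by exact: euler_gt0.
have half : M / 2 <= \sum_(0 <= i < n) sfsum f s (hw (u + i%:R * e)).
  rewrite -sfsum_sum.
  have E1 : M <= sfsum f s (fun v => \sum_(0 <= i < n) hw (u + i%:R * e) v) +
      T^-1 * sfsum f s (fun v => `|v|).
    rewrite -[leLHS]mulr1 -(sfsum_cst f) -sfsumZ -sfsumD; apply: sfsum_le => v.
    have S0 : 0 <= \sum_(0 <= i < n) hw (u + i%:R * e) v by apply: sumr_ge0.
    case: (leP `|v| T) => vT.
      apply: ler_wpDr; first by rewrite mulr_ge0 // invr_ge0 ltW.
      move: vT; rewrite ler_norml => /andP[v1 v2]; apply: cover; first by rewrite /u; lra.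
      apply: (@le_trans _ _ (u + (4 * Ct + 1) * e)).
        by have -> : u + (4 * Ct + 1) * e = T by rewrite /u /T; ring.
      by rewrite lerD2l; apply: ler_wpM2r => //; exact: ltW.
    apply: ler_wpDl => //; rewrite mulrC ler_pdivlMr // mul1r; exact: ltW.
  have E2 : T^-1 * sfsum f s (fun v => `|v|) <= M / 2.
    rewrite mulrC ler_pdivrMr //; apply: (le_trans mean).
    by rewrite /T le_eqVlt; apply/orP; left; apply/eqP; field.
  lra.
have VM : V * M <= 2 * n%:R * Q.
  have : V * (M / 2) <= n%:R * Q.
    apply: (le_trans (ler_wpM2l (ltW V0) half)); rewrite big_distrr /=.
    rewrite mulr_natl -[X in _ *+ X]subn0 -sumr_const_nat; apply: ler_sum => i _.
    by apply: (concentration_ge fadd y0) => //; exact: ltW.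
  lra.
pose sA := [seq p <- ps | (p < K)%N]; pose sB := [seq p <- ps | ~~ `[< P p >]].
have ps_pr : all prime ps by exact: all_primes_upto.
have ups : uniq ps by exact: uniq_primes_upto.
have sub_pr (Q' : pred nat) : all prime [seq p <- ps | Q' p].
  by apply/allP => p; rewrite mem_filter => /andP[_]; exact: (allP ps_pr).
have mA : mass R sA <= Cm * ln K%:R.
  apply: (HCm K sA K2 (filter_uniq _ ups) (sub_pr _)).
  by move=> p; rewrite mem_filter => /andP[].
have mB : mass R sB <= expR C2.
  apply: (mass_exceptional hex (filter_uniq _ ups) (sub_pr _)).
  by move=> p; rewrite mem_filter => /andP[/asboolPn].
(* Each prime up to [y] lies in [s], [sA] or [sB], so its factors have product at least 1 - 1/p^2.
   As [sA] and [sB] together have mass O(ln K), [V * M] is at least of order 1 / ln K. *)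
have prodE : 2^-1 <= V * M * (mass R sA * mass R sB).
  apply: (le_trans (prod_inv_sq_ge R ups ps_pr)).
  have mE (Q' : pred nat) : mass R [seq p <- ps | Q' p] =
      \prod_(p <- ps) (if Q' p then 1 + p%:R^-1 else 1).
    by rewrite /mass big_filter big_mkcond.
  rewrite /M /s /sA /sB !mE /V -!big_split /=.
  rewrite big_seq [leRHS]big_seq; apply: ler_prod => p pps.
  have p1 : (1 : R) < p%:R by rewrite ltr1n prime_gt1 // (allP ps_pr).
  have q1 : 0 < (p%:R : R)^-1 < 1 by rewrite invr_gt0 invf_lt1; lra.
  rewrite -exprVn; move: (p%:R^-1) q1 => q /andP[q0 q1].
  apply/andP; split; first by nra.
  have fact (x y' z : R) : 1 <= x -> 1 <= y' -> 1 <= z ->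
     1 + q <= x * (y' * z) -> 1 - q ^+ 2 <= (1 - q) * x * (y' * z).
    move=> _ _ _ xyz; rewrite -mulrA; have := ler_wpM2l (_ : 0 <= 1 - q) xyz.
    by move=> /(_ ltac:(lra)); apply: le_trans; nra.
  have q2 : (1 : R) <= 1 + q by lra.
  case: asboolP => _ /=; case: (ltnP p K) => _ /=; apply: fact => //; nra.
have lK := lnK.
have D0 : 0 < 2 * expR C2 * Cm * (2 * n%:R) by rewrite !mulr_gt0 // expR_gt0.
rewrite ler_pdivrMr // [leRHS]mulrC -[leLHS]mulr1 ler_pdivrMl //.
have X1 : mass R sA * mass R sB <= Cm * ln K%:R * expR C2.
  by apply: ler_pM => //; apply: le_trans (mass_ge1 _ _).
have VM0 : 0 <= V * M by apply: mulr_ge0; [exact: ltW|lra].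
have X2 := le_trans prodE (ler_wpM2l VM0 X1).
have Y0 : 0 <= Cm * ln K%:R * expR C2 by rewrite !mulr_ge0 ?expR_ge0 ?(ltW Cm0) ?(ltW lK).
have X3 := le_trans X2 (ler_wpM2r Y0 VM).
have -> : 2 * expR C2 * Cm * (2 * n%:R) * (ln K%:R * Q) =
   2 * (2 * n%:R * Q * (Cm * ln K%:R * expR C2)) by ring.
lra.
Qed.

End Bounds.

(** * The upper bound *)

Section UpperBound.
Variable R : realType.
Implicit Types (f : nat -> R) (P : set nat) (c A C e y x : R).

(* The factor [min {1/(c-1), log (1/e)}] of the theorem, with [1/0] read as infinity. *)
Definition loss c e : R :=
  if c == 1 then ln e^-1 else Num.min (c - 1)^-1 (ln e^-1).

Lemma ln_inv_ge e : 0 < e <= 2^-1 -> 2^-1 <= ln e^-1.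
Proof.
move=> /andP[e0 e1]; apply: (le_trans (ln2_ge R)).
by rewrite ler_ln ?posrE ?invr_gt0 // -[leLHS]invrK lef_pV2 ?posrE ?invr_gt0.
Qed.

Lemma loss_ge c e : 1 <= c <= 2 -> 0 < e <= 2^-1 -> 2^-1 <= loss c e.
Proof.
move=> /andP[c1 c2] he; have L := ln_inv_ge he; rewrite /loss.
case: eqP => // c1'; rewrite le_min L andbT.
have c0 : 0 < c - 1 by rewrite subr_gt0 lt_neqAle c1 andbT eq_sym; apply/eqP.
by rewrite lef_pV2 ?posrE //; lra.
Qed.

(** The ratio is x = 2^(1-c), and 1/x = 2^(c-1) >= 1 + (c-1)/2 gives 1 - x >= (c-1)/3 for c <= 2. *)
Lemma geom_le_inv c J : 1 < c <= 2 ->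
  \sum_(0 <= l < J) (2 * 2^-1 `^ c) ^+ l <= 3 / (c - 1).
Proof.
move=> /andP[c1 c2].
set x := 2 * _.
have x0 : 0 <= x by rewrite mulr_ge0 // powR_ge0.
have z0 : 0 < (c - 1) / 2 by rewrite divr_gt0 // subr_gt0.
have xE : x * expR ((c - 1) * ln 2) = 1.
  rewrite /x /powR gt_eqF ?invr_gt0 // lnV ?posrE //.
  rewrite -{1}[2](@lnK R 2) ?posrE //.
  rewrite -!expRD; have -> : ln 2 + c * - ln 2 + (c - 1) * ln 2 = 0 :> R by ring.
  exact: expR0.
have E : 1 + (c - 1) / 2 <= expR ((c - 1) * ln 2).
  apply: le_trans (expR_ge1Dx _); rewrite lerD2l.
  by apply: ler_wpM2l; [rewrite subr_ge0 ltW|exact: ln2_ge].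
have x1 : x * (1 + (c - 1) / 2) <= 1 by apply: (le_trans (ler_wpM2l x0 E)); rewrite xE.
have S1 : (1 - x) * \sum_(0 <= l < J) x ^+ l <= 1.
  have -> : (1 - x) * \sum_(0 <= l < J) x ^+ l = 1 - x ^+ J.
    by rewrite -[in RHS](expr1n _ J) subrXX big_mkord; congr (_ * _);
      apply: eq_bigr => l _; rewrite expr1n mul1r.
  by rewrite gerBl exprn_ge0.
have S0 : 0 <= \sum_(0 <= l < J) x ^+ l by apply: sumr_ge0 => l _; exact: exprn_ge0.
move: S1 S0; move: (\sum_(_ <= _ < _) _) => S S1 S0.
rewrite ler_pdivlMr; last by lra.
have : (c - 1) / 3 * S <= (1 - x) * S.
  apply: ler_wpM2r => //; have : x <= 1 by nra.
  nra.
lra.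
Qed.

(** The product times the mass of the same primes is at most 2, by comparison with the product of 1
    - 1/p^2. That mass is at least 2^J / (4 e^C), since the primes outside [P] have mass at most
    e^C. *)
Lemma prod_good_le J P C :
  (\esum_(p in [set p : nat | prime p /\ ~ P p]) (p%:R^-1 : R)%:E <= C%:E)%E ->
  \prod_(p <- sblock P 0 J) (1 - p%:R^-1 + (p%:R ^+ 2)^-1) <= 8 * expR C / 2 ^+ J :> R.
Proof.
move=> hex.
set s := sblock P 0 J; set s' := [seq p <- primes_in 2 (dexp J) | ~~ `[< P p >]].
have s_pr : all prime s.
  by apply/allP => p; rewrite mem_block => /and3P[].
have us : uniq s by rewrite filter_uniq // uniq_primes_in.
have m1 : mass R s * mass R s' = mass R (primes_in 2 (dexp J)).
  rewrite /s /s' /mass /sblock /block [X in X * _]big_filter [X in _ * X]big_filter.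
  by rewrite [RHS](bigID (fun p => `[< P p >])).
have m2 : mass R s' <= expR C.
  apply: (mass_exceptional hex); first by rewrite filter_uniq // uniq_primes_in.
    by apply/allP => p; rewrite mem_filter mem_primes_in => /andP[_ /andP[]].
  by move=> p; rewrite mem_filter => /andP[/asboolPn].
have m3 := mass_primes_ge R J; rewrite -m1 in m3.
have sm := mass_ge1 R s.
have J0 : 0 < (2 : R) ^+ J by rewrite exprn_gt0.
set X := \prod_(p <- s) _.
have X0 : 0 <= X.
  rewrite /X big_seq; apply: prodr_ge0 => p ps.
  have p1 : (1 : R) < p%:R by rewrite ltr1n prime_gt1 // (allP s_pr).
  have : (p%:R : R)^-1 < 1 by rewrite invf_lt1; lra.
  by rewrite -exprVn; have := sqr_ge0 (p%:R : R)^-1; lra.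
have prod1 : X * mass R s * \prod_(p <- s) (1 - (p%:R ^+ 2)^-1) <= 1.
  rewrite /X /mass -!big_split /= big_seq.
  apply: (@le_trans _ _ (\prod_(p <- s | p \in s) 1)); last by rewrite big1_eq.
  apply: ler_prod => p ps.
  have p1 : (1 : R) < p%:R by rewrite ltr1n prime_gt1 // (allP s_pr).
  have q1 : 0 < (p%:R : R)^-1 < 1 by rewrite invr_gt0 invf_lt1; lra.
  rewrite -exprVn; move: (p%:R^-1) q1 => q /andP[q0 q1].
  have -> : (1 - q + q ^+ 2) * (1 + q) * (1 - q ^+ 2) = 1 - q ^+ 2 * (1 - q + q ^+ 3) by ring.
  have q3 : 0 <= q ^+ 3 <= 1 by rewrite exprn_ge0 ?exprn_ile1 //; lra.
  have q2 : 0 <= q ^+ 2 <= 1 by rewrite exprn_ge0 ?exprn_ile1 //; lra.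
  have -> : 1 - q ^+ 2 * (1 - q + q ^+ 3) = (1 - q ^+ 2) * (1 + q ^+ 3) by ring.
  apply/andP; split; first by apply: mulr_ge0; lra.
  have -> : (1 - q ^+ 2) * (1 + q ^+ 3) = 1 - q ^+ 2 * (1 - q) - q ^+ 2 * q ^+ 3 by ring.
  have : 0 <= q ^+ 2 * (1 - q) by apply: mulr_ge0; lra.
  have : 0 <= q ^+ 2 * q ^+ 3 by apply: mulr_ge0; lra.
  lra.
have half := prod_inv_sq_ge R us s_pr.
have Xm : X * mass R s <= 2.
  have X1 : 0 <= X * mass R s by apply: mulr_ge0 => //; lra.
  have := le_trans (ler_wpM2l X1 half) prod1; lra.
have E0 := expR_gt0 C.
rewrite ler_pdivlMr //.
have H1 : mass R s * mass R s' <= mass R s * expR C by apply: ler_wpM2l => //; lra.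
have H2 : 2 ^+ J <= 4 * (mass R s * expR C) by lra.
apply: (le_trans (ler_wpM2l X0 H2)).
have H3 := ler_wpM2r (ltW E0) Xm.
have -> : X * (4 * (mass R s * expR C)) = 4 * (X * mass R s * expR C) by ring.
lra.
Qed.

Lemma concentration_upper C1 C2 C3 A : 0 < C1 -> 0 < C2 -> 0 < C3 -> 1 <= A ->
  exists2 C0, 0 < C0 &
  forall f P c e y, additive_fun f -> (forall p, P p -> prime p) -> 1 <= c <= 2 ->
  (forall p, P p -> `|f p| <= C1 / ln p%:R `^ c) ->
  (\esum_(p in [set p : nat | prime p /\ ~ P p]) (p%:R^-1 : R)%:E <= C2%:E)%E ->
  spaced f P c A C3 -> 0 < e <= 2^-1 -> (Kmin f P c e)%:R `^ A^-1 <= y ->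
  concentration (distr_fun f y) e <= C0 * loss c e / ln (Kmin f P c e)%:R.
Proof.
move=> C1_0 C2_0 C3_0 A1.
have A0 : 0 < A by apply: lt_le_trans A1.
have [a Aa] : exists a : nat, A <= 2 ^+ a.
  exists (Num.truncn A).+1; apply: (@le_trans _ _ (Num.truncn A).+1%:R).
    by rewrite ltW // truncnS_gt.
  by rewrite -natrX ler_nat ltnW // ltn_expl.
have [D D1 HD] := @sfsum_large_window R C3 a C3_0.
set l1 := `|ln (2 * C1)|.
have l1_0 : 0 <= l1 by exact: normr_ge0.
(* [Sc] is at most J <= 2 (l1 + ln (1/e)), where ln (1/e) >= 1/2 absorbs [l1] at the cost 4 l1. The
   summand 5 also covers the constant 3 of [geom_le_inv]. *)
set Cl := 4 * l1 + 5.
have Cl0 : 5 <= Cl by rewrite /Cl; lra.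
set C0 := 2 * 2 ^+ a.+1 * (8 * expR C2 * D * Cl + 1).
have E0 := expR_gt0 C2.
have Pa : 0 < (2 : R) ^+ a.+1 by rewrite exprn_gt0.
have W0 : 0 < 8 * expR C2 * D * Cl by rewrite !mulr_gt0 //; lra.
have C0_0 : 0 < C0 by rewrite /C0 mulr_gt0 ?mulr_gt0 //; lra.
exists C0 => // f P c e y fadd hP hc hf hex gap he yK.
have /andP[c1 c2] := hc; have /andP[e0 e1] := he.
have lossG := loss_ge hc he.
have y0 : 0 <= y by apply: le_trans yK; exact: powR_ge0.
have [K3 gK Kmin_gt] := KminP hP c1 C1_0 hf e0.
set K := Kmin f P c e in yK K3 gK Kmin_gt *.
have KR : 1 < K%:R :> R by rewrite ltr1n ltnW.
have lnK : 0 < ln (K%:R : R) by rewrite ln_gt0.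
rewrite ler_pdivlMr //.
(* For bounded K the trivial bound 1 suffices, as [loss c e >= 1/2]; otherwise the level J below is
   positive. *)
case: (leqP K (dexp (1 + a))) => Ka.
  have lK : ln (K%:R : R) <= 2 ^+ a.+1.
    apply: (@le_trans _ _ (ln (dexp (1 + a))%:R)).
      by rewrite ler_ln ?posrE ?ler_nat //; [apply: lt_trans KR|apply: lt_trans (dexp_gt1 R _)].
    by rewrite ln_dexp add1n; apply: ler_piMr; [exact: ltW|exact: ln2_le].
  have Q1 := concentration_le1 fadd y0 (ltW e0).
  apply: (le_trans (ler_wpM2r (ltW lnK) Q1)); rewrite mul1r; apply: (le_trans lK).
  rewrite /C0.
  have : 2 ^+ a.+1 * 1 <= 2 ^+ a.+1 * (2 * (8 * expR C2 * D * Cl + 1) * loss c e).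
    apply: ler_wpM2l; first exact: ltW.
    by move: W0; move: (8 * expR C2 * D * Cl) => w w0; nra.
  by rewrite mulr1 => /le_trans; apply; rewrite le_eqVlt; apply/orP; left; apply/eqP; ring.
(* This level gives three things: e < g (dexp (J + a)) by minimality of K, dexp J <= K^(1/A) <= y
   because A <= 2^a, and ln K <= 2^(J + a + 1). *)
have [J [J0 JK KJ]] : exists J, [/\ (0 < J)%N, (dexp (J + a) < K)%N & (K <= dexp (J.+1 + a))%N].
  have ex : exists J, (0 < J)%N && (dexp (J + a) < K)%N by exists 1%N.
  have ub J : (0 < J)%N && (dexp (J + a) < K)%N -> (J <= K)%N.
    move=> /andP[_ H]; apply: ltnW; apply: leq_ltn_trans H.
    apply: leq_trans (leq_addr a J) _; apply: leq_trans (ltnW (ltn_expl _ (ltnSn 1))) _.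
    exact: ltnW (ltn_expl _ (ltnSn 1)).
  case: (ex_maxnP ex ub) => J /andP[J0 JK] Jmax; exists J; split=> //.
  rewrite leqNgt; apply/negP => H.
  by have := Jmax J.+1; rewrite H ltnn => /(_ isT).
have J2 : ln (K%:R : R) <= 2 ^+ J * 2 ^+ a.+1.
  apply: (@le_trans _ _ (ln (dexp (J.+1 + a))%:R)).
    by rewrite ler_ln ?posrE ?ler_nat //; [apply: lt_trans KR|apply: lt_trans (dexp_gt1 R _)].
  rewrite ln_dexp -exprD addSnnS; apply: ler_piMr; [exact: exprn_ge0|exact: ln2_le].
have eJ : e < gsup f P c (dexp (J + a))%:R.
  apply: Kmin_gt; rewrite JK andbT.
  apply: leq_trans (dexp_mono (_ : (1 <= J + a)%N)) => //.
  by rewrite (leq_trans J0) // leq_addr.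
have yJ : (dexp J)%:R <= y.
  apply: le_trans yK.
  have -> : (dexp J)%:R = ((dexp J)%:R `^ A) `^ A^-1 :> R.
    by rewrite -powRrM divff ?gt_eqF // powRr1.
  apply: ge0_ler_powR; rewrite ?nnegrE ?powR_ge0 ?invr_ge0 ?(ltW A0) ?ler0n //.
  apply: (@le_trans _ _ ((dexp J)%:R `^ (2 ^+ a))).
    by apply: ler_powR => //; rewrite ltW // dexp_gt1.
  rewrite -natrX powR_mulrn // -natrX ler_nat /dexp -expnM -expnD.
  exact: ltnW.
have JN : (dexp J <= Num.truncn y)%N by rewrite truncn_ge_nat.
pose good p := `[< P p >] && (p < dexp J)%N.
have goodE : [seq p <- primes_upto (Num.truncn y) | good p] = sblock P 0 J.
  have -> : primes_upto (Num.truncn y) = primes_in 0 (Num.truncn y).+1.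
    by rewrite /primes_in /index_iota subn0.
  rewrite (@primes_in_cat 0 2) //; last by apply: ltnW; apply: leq_trans (dexp_ge2 J) JN.
  rewrite (@primes_in_cat 2 (dexp J)) ?dexp_ge2 //; last exact: ltnW.
  rewrite !filter_cat [X in X ++ _ ++ _ = _](_ : _ = [::]); last first.
    by rewrite /primes_in /index_iota /=.
  rewrite [X in _ ++ _ ++ X = _](_ : _ = [::]); last first.
    rewrite (@eq_in_filter _ _ pred0) ?filter_pred0 // => p.
    by rewrite mem_primes_in /good => /andP[_ /andP[pJ _]]; rewrite ltnNge pJ andbF.
  rewrite cats0; apply: eq_in_filter => p.
  by rewrite mem_primes_in /good => /andP[_ /andP[_ ->]]; rewrite andbT.
set Sc := \sum_(0 <= l < J) (2 * 2^-1 `^ c) ^+ l.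
have hA : 1 <= A <= 2 ^+ a by rewrite A1.
have HB v : sfsum f [seq p <- primes_upto (Num.truncn y) | good p] (win v e) <= D * Sc.
  by rewrite goodE; apply: (HD _ _ _ _ _ hP c1 hf hA gap J e v J0 e0); exact: ltW.
have Q1 := concentration_le fadd y0 (ltW e0) HB.
rewrite -big_filter goodE in Q1.
have prodL := prod_good_le J hex.
have Sc0 : 0 <= Sc.
  by apply: sumr_ge0 => l _; apply: exprn_ge0; rewrite mulr_ge0 // powR_ge0.
have J20 : 0 < (2 : R) ^+ J by rewrite exprn_gt0.
have ScL : Sc <= Cl * loss c e.
  have L := ln_inv_ge he.
  have ScJ : Sc <= Cl * ln e^-1.
    apply: (@le_trans _ _ J%:R).
      apply: (@le_trans _ _ (\sum_(0 <= l < J) 1)); last by rewrite sumr_const_nat subn0.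
      apply: ler_sum => l _; have h1 := half_powR_le c1.
      by apply: exprn_ile1; [rewrite mulr_ge0 // powR_ge0|lra].
    (* J is logarithmic in 1/e because e < g (dexp (J + a)) <= 2 C1 / 2^(J + a). *)
    have lJ : J%:R * ln 2 <= l1 + ln e^-1.
      have H : 2 ^+ (J + a) < 2 * C1 / e.
        have := lt_le_trans eJ (gsup_dexp_le hP c1 C1_0 hf (_ : (0 < J + a)%N)).
        rewrite addn_gt0 J0 => /(_ isT).
        by rewrite ltr_pdivlMr ?exprn_gt0 // mulrC -ltr_pdivlMr.
      have P0 : 0 < 2 * C1 by rewrite mulr_gt0.
      have H2 : ln (2 ^+ (J + a)) <= ln (2 * C1 / e).
        by rewrite ler_ln ?posrE ?exprn_gt0 ?divr_gt0 // ltW.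
      rewrite lnM ?posrE ?invr_gt0 // lnXn // -[ln _ *+ _]mulr_natr natrD in H2.
      have H3 := ler_norm (ln (2 * C1)).
      have := ln2_ge R; have : 0 <= ln 2 * a%:R :> R.
        by apply: mulr_ge0 => //; have := ln2_ge R; lra.
      by rewrite /l1; lra.
    have lJ2 : J%:R * 2^-1 <= J%:R * ln 2 :> R by apply: ler_wpM2l => //; exact: ln2_ge.
    have : 0 <= l1 * (ln e^-1 - 2^-1) by apply: mulr_ge0; lra.
    by rewrite /Cl; lra.
  rewrite /loss; case: eqP => [//|c1'].
  have c3 : 1 < c by rewrite lt_neqAle c1 andbT eq_sym; apply/eqP.
  have c0 : 0 < c - 1 by rewrite subr_gt0.
  rewrite minr_pMr; last by lra.
  rewrite le_min ScJ andbT; apply: (le_trans (geom_le_inv J _)); first by rewrite c3.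
  by apply: ler_wpM2r; [rewrite invr_ge0 ltW|lra].
have DS0 : 0 <= D * Sc by apply: mulr_ge0 => //; lra.
have Q2 := le_trans Q1 (ler_wpM2r DS0 prodL).
apply: (le_trans (ler_wpM2r (ltW lnK) Q2)).
have X0 : 0 <= 8 * expR C2 / 2 ^+ J * (D * Sc).
  apply: mulr_ge0 DS0; apply: divr_ge0; last exact: ltW.
  by apply: mulr_ge0; [exact: ler0n|exact: ltW].
apply: (le_trans (ler_wpM2l X0 J2)).
have -> : 8 * expR C2 / 2 ^+ J * (D * Sc) * (2 ^+ J * 2 ^+ a.+1) =
  8 * expR C2 * D * 2 ^+ a.+1 * Sc.
  by field; rewrite gt_eqF.
have Y0 : 0 <= 8 * expR C2 * D * 2 ^+ a.+1 by rewrite !mulr_ge0 ?(ltW E0) ?(ltW Pa) //; lra.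
apply: (le_trans (ler_wpM2l Y0 ScL)).
have -> : 8 * expR C2 * D * 2 ^+ a.+1 * (Cl * loss c e) =
   2 ^+ a.+1 * (8 * expR C2 * D * Cl) * loss c e by ring.
apply: ler_wpM2r; first by lra.
have -> : C0 = 2 ^+ a.+1 * (2 * (8 * expR C2 * D * Cl + 1)) by rewrite /C0; ring.
by apply: ler_wpM2l; [exact: ltW|lra].
Qed.

End UpperBound.

(* C1, C2, C3 are the implied constants of the hypotheses; the constant c0 of
   the lower bound is chosen before A, the constant C0 of the upper bound after
   A, and both before f, P and c. *)
Theorem theorem1p4 (R : realType) (C1 C2 C3 : R)
  (hC1 : 0 < C1) (hC2 : 0 < C2) (hC3 : 0 < C3) :
  exists2 c0 : R, 0 < c0 &
  forall A : R, 1 <= A ->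
  exists2 C0 : R, 0 < C0 &
  forall (f : nat -> R) (P : set nat) (c : R),
    additive_fun f ->
    (forall p, P p -> prime p) ->
    1 <= c <= 2 ->
    (forall p, P p -> `|f p| <= C1 / ln p%:R `^ c) ->
    (\esum_(p in [set p : nat | prime p /\ ~ P p]) (p%:R^-1 : R)%:E
       <= C2%:E)%E ->
    (forall p1 p2, P p1 -> P p2 -> (p1 < p2)%N ->
       Num.min (gsup f P c p2%:R * (p2%:R - p1%:R) / (p2%:R * ln p2%:R))
               (gsup f P c (p2%:R `^ A))
         <= C3 * `|f p2 - f p1|) ->
    forall eps y : R,
      0 < eps <= 2^-1 ->
      (Kmin f P c eps)%:R `^ A^-1 <= y ->
      c0 / ln (Kmin f P c eps)%:R <= concentration (distr_fun f y) eps /\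
      concentration (distr_fun f y) eps
        <= C0 * (if c == 1 then ln eps^-1
                 else Num.min (c - 1)^-1 (ln eps^-1))
             / ln (Kmin f P c eps)%:R.
Proof.
have [c0 c0_gt0 Hlow] := concentration_lower hC1 hC2.
exists c0 => // A A1.
have [C0 C0_gt0 Hup] := concentration_upper hC1 hC2 hC3 A1.
exists C0 => // f P c fadd hP hc hf hex gap eps y heps yK.
have y0 : 0 <= y by apply: le_trans yK; exact: powR_ge0.
split; last exact: Hup hf hex gap heps yK.
have /andP[c1 _] := hc; have /andP[e0 _] := heps.
exact: Hlow hf hex e0 y0.
Qed.
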